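(* Let $d\ge1$, $\alpha\in[-1/2,\infty)^d$, $\sigma>0$, $1\le p<\infty$, $1\le q<\infty$. If $\sigma\ge|\alpha|+d$, then there is a constant $C$ such that $$\|\mathcal{I}^{\alpha,\sigma}f\|_{L^q(d\mu_\alpha)}\le C\|f\|_{L^p(d\mu_\alpha)},\qquad f\in L^p(\mathbb{R}^d_+,d\mu_\alpha).\qquad( * )$$ If $0<\sigma<|\alpha|+d$, then $( * )$ holds under the additional condition $$\frac1p-\frac{\sigma}{|\alpha|+d}\le\frac1q<\frac1p+\frac{\sigma}{|\alpha|+d},$$ with exclusion of the case when $p=1$ and $q=\frac{|\alpha|+d}{|\alpha|+d-\sigma}$. Moreover, if either $\sigma\ge|\alpha|+d$, or $0<\sigma<|\alpha|+d$ and $\frac1p-\frac{\sigma}{|\alpha|+d}\le\frac1q<\frac1p+\frac{\sigma}{|\alpha|+d}$ with $(p,q)\ne\big(1,\frac{|\alpha|+d}{|\alpha|+d-\sigma}\big)$ (so that $( * )$ holds), then for every $k\in\mathbb{N}^d$, $$\langle\mathcal{I}^{\alpha,\sigma}f,\ell_k^\alpha\rangle_{d\mu_\alpha}=(4|k|+2|\alpha|+2d)^{-\sigma}\langle f,\ell_k^\alpha\rangle_{d\mu_\alpha},\qquad f\in L^p(\mathbb{R}^d_+,d\mu_\alpha).$$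
   Context: $\mathbb{R}^d_+=(0,\infty)^d$, $\mathbb{N}=\{0,1,\ldots\}$, $|k|=\sum k_i$, $|\alpha|=\sum\alpha_i$ (possibly negative). For $\alpha\in(-1,\infty)^d$ let $\mu_\alpha(dx)=x_1^{2\alpha_1+1}\cdots x_d^{2\alpha_d+1}\,dx$ on $\mathbb{R}^d_+$, and $\langle f,g\rangle_{d\mu_\alpha}=\int_{\mathbb{R}^d_+}f\overline{g}\,d\mu_\alpha$ whenever it makes sense. The Laguerre functions of convolution type are $\ell_k^\alpha(x)=\prod_{i=1}^d\ell_{k_i}^{\alpha_i}(x_i)$, $k\in\mathbb{N}^d$, where $$\ell_{k_i}^{\alpha_i}(x_i)=\Big(\frac{2\Gamma(k_i+1)}{\Gamma(k_i+\alpha_i+1)}\Big)^{1/2}L_{k_i}^{\alpha_i}(x_i^2)e^{-x_i^2/2}$$ and $L_m^\nu$ is the Laguerre polynomial of degree $m$ and order $\nu$. They form an orthonormal basis of $L^2(d\mu_\alpha)$. Define $$G_t^{\alpha}(x,y)=\sum_{k\in\mathbb{N}^d}e^{-t(4|k|+2|\alpha|+2d)}\ell_k^\alpha(x)\ell_k^\alpha(y),\qquad \mathcal{K}^{\alpha,\sigma}(x,y)=\frac1{\Gamma(\sigma)}\int_0^\infty G_t^{\alpha}(x,y)t^{\sigma-1}\,dt,$$ $$\mathcal{I}^{\alpha,\sigma}f(x)=\int_{\mathbb{R}^d_+}\mathcal{K}^{\alpha,\sigma}(x,y)f(y)\,d\mu_\alpha(y),$$ the last one on the natural domain of functions $f$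 for which the integral converges for a.e. $x\in\mathbb{R}^d_+$. The estimate $( * )$ implicitly includes the assertion that $L^p(\mathbb{R}^d_+,d\mu_\alpha)$ is contained in the natural domain of $\mathcal{I}^{\alpha,\sigma}$. *)

(* Defs.v *)
From HB Require Import structures.
From mathcomp Require Import all_boot all_order all_algebra.
From mathcomp Require Import all_classical all_reals all_analysis.
From mathcomp Require Import measurable_realfun.
From mathcomp.real_closed Require Import complex.

Set Implicit Arguments.
Unset Strict Implicit.
Unset Printing Implicit Defensive.
Import Order.TTheory GRing.Theory Num.Theory.
Import numFieldNormedType.Exports.

Local Open Scope classical_set_scope.
Local Open Scope ring_scope.

(* Points of R^d, multi-indices of N^d and type parameters alpha are d-tuples.
   Functions on R^d_+ are represented by functions on all of R^d of which only
   the restriction to [orthant] matters. *)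

Definition orthant {R : realType} {d : nat} : set (d.-tuple R) :=
  [set x | forall i : 'I_d, 0 < tnth x i].

Definition tsum {V : nmodType} {d : nat} (a : d.-tuple V) : V :=
  \sum_(i < d) tnth a i.

Definition tuple_of_prod {R : realType} (n : nat) (z : n.-tuple R * R) :
    n.+1.-tuple R := [tuple of z.2 :: z.1].

Lemma measurable_tuple_of_prod (R : realType) (n : nat) :
  measurable_fun [set: n.-tuple R * R] (@tuple_of_prod R n).
Proof.
exact: (@measurable_cons _ _ _ _ snd n fst measurable_snd measurable_fst).
Qed.

Definition tuple_product {R : realType} (n : nat)
    (m : {measure set (n.-tuple R) -> \bar R}) : set (n.+1.-tuple R) -> \bar R :=
  pushforward (m \x lebesgue_measure)%E (@tuple_of_prod R n).

HB.instance Definition _ (R : realType) (n : nat)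
    (m : {measure set (n.-tuple R) -> \bar R}) :=
  Measure.copy (tuple_product m)
    (measure_function_pushforward__canonical__measure_function_Measure
       (m \x lebesgue_measure)%E (@measurable_tuple_of_prod R n)).

(* Lebesgue measure on R^n, as the n-fold product of [lebesgue_measure] *)
Fixpoint lebesgue_tuple {R : realType} (n : nat) :
    {measure set (n.-tuple R) -> \bar R} :=
  match n with
  | 0 => \d_([tuple])
  | m.+1 => tuple_product (lebesgue_tuple m)
  end.

Lemma measurable_orthant (R : realType) (d : nat) :
  measurable (orthant : set (d.-tuple R)).
Proof.
rewrite (_ : orthant =
  \bigcap_(i in [set: 'I_d]) ((fun x : d.-tuple R => tnth x i) @^-1` `]0, +oo[)).
  apply: fin_bigcap_measurable => // i _; rewrite -[X in measurable X]setTI.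
  exact: measurable_tnth.
by apply/seteqP; split=> x /= h i; have := h i; rewrite /= in_itv /= andbT//; apply.
Qed.

Definition mu_density {R : realType} {d : nat} (alpha x : d.-tuple R) : R :=
  \prod_(i < d) (tnth x i `^ (2 * tnth alpha i + 1)).

Lemma measurable_mu_density (R : realType) (d : nat) (alpha : d.-tuple R) :
  measurable_fun setT (mu_density alpha).
Proof.
apply: measurable_prod => i _.
by apply: (measurableT_comp (measurable_powR _)); exact: measurable_tnth.
Qed.

Definition laguerre_measure {R : realType} {d : nat} (alpha : d.-tuple R) :
    set (d.-tuple R) -> \bar R :=
  fun A => (\int[lebesgue_tuple d]_(x in A `&` orthant)
              (mu_density alpha x)%:E)%E.

Section laguerre_measure_is_measure.
Local Open Scope ereal_scope.
Context (R : realType) (d : nat) (alpha : d.-tuple R).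

Let mu_density_ge0 x : 0 <= (mu_density alpha x)%:E.
Proof. by rewrite lee_fin prodr_ge0// => i _; exact: powR_ge0. Qed.

Let mu0 : laguerre_measure alpha set0 = 0.
Proof. by rewrite /laguerre_measure set0I integral_set0. Qed.

Let mu_ge0 A : 0 <= laguerre_measure alpha A.
Proof. exact: integral_ge0. Qed.

Let mu_sigma_additive : semi_sigma_additive (laguerre_measure alpha).
Proof.
move=> F mF tF mUF; rewrite /laguerre_measure setI_bigcupl ge0_integral_bigcup//.
- by apply: is_cvg_nneseries => n _ _; exact: integral_ge0.
- by move=> k; apply: measurableI => //; exact: measurable_orthant.
- apply: measurable_funTS; apply/measurable_EFinP.
  exact: measurable_mu_density.
- exact: trivIset_setIr.
Qed.

HB.instance Definition _ :=
  isMeasure.Build _ _ _ (laguerre_measure alpha) mu0 mu_ge0 mu_sigma_additive.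

End laguerre_measure_is_measure.

Definition Gamma {R : realType} (s : R) : R :=
  \int[lebesgue_measure]_(t in `]0, +oo[) (t `^ (s - 1) * expR (- t)).

(* L_m^nu(X) = \sum_(j <= m) (-1)^j binom(m + nu, m - j) X^j / j!, where
   binom(m + nu, m - j) = (nu + j + 1) ... (nu + m) / (m - j)! *)
Definition laguerre_poly {R : realType} (nu : R) (m : nat) : {poly R} :=
  \poly_(j < m.+1) ((-1) ^+ j * (\prod_(j <= i < m) (nu + i.+1%:R))
                     / ((m - j)`!%:R * j`!%:R)).

Definition laguerre_fun1 {R : realType} (nu : R) (m : nat) (s : R) : R :=
  Num.sqrt (2 * Gamma (m%:R + 1) / Gamma (m%:R + nu + 1))
  * (laguerre_poly nu m).[s ^+ 2] * expR (- (s ^+ 2 / 2)).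

Definition laguerre_fun {R : realType} {d : nat} (alpha : d.-tuple R)
    (k : d.-tuple nat) (x : d.-tuple R) : R :=
  \prod_(i < d) laguerre_fun1 (tnth alpha i) (tnth k i) (tnth x i).

Definition laguerre_eigenvalue {R : realType} {d : nat} (alpha : d.-tuple R)
    (k : d.-tuple nat) : R :=
  4 * (tsum k)%:R + 2 * tsum alpha + 2 * d%:R.

(* Sum of an absolutely convergent family of real numbers, [esum] being meant
   for nonnegative families only. *)
Definition rsum {R : realType} {I : choiceType} (u : I -> R) : R :=
  fine (\esum_(i in [set: I]) ((EFin \o u)^\+ i)
        - \esum_(i in [set: I]) ((EFin \o u)^\- i))%E.

Definition heat_kernel {R : realType} {d : nat} (alpha : d.-tuple R) (t : R)
    (x y : d.-tuple R) : R :=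
  rsum (fun k : d.-tuple nat => expR (- t * laguerre_eigenvalue alpha k)
          * laguerre_fun alpha k x * laguerre_fun alpha k y).

(* Extended-real valued, as it can be infinite on the diagonal. *)
Definition potential_kernel {R : realType} {d : nat} (alpha : d.-tuple R)
    (sigma : R) (x y : d.-tuple R) : \bar R :=
  ((Gamma sigma)^-1%:E * \int[lebesgue_measure]_(t in `]0%R, +oo[)
     (heat_kernel alpha t x y * t `^ (sigma - 1))%:E)%E.

Definition potential_domain {R : realType} {d : nat} (alpha : d.-tuple R)
    (sigma : R) (f : d.-tuple R -> R[i]) : Prop :=
  {ae laguerre_measure alpha, forall x, orthant x ->
     (laguerre_measure alpha).-integrable orthant
       (fun y => potential_kernel alpha sigma x y * (complex.Re (f y))%:E)%E /\
     (laguerre_measure alpha).-integrable orthant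
       (fun y => potential_kernel alpha sigma x y * (complex.Im (f y))%:E)%E}.

Definition potential {R : realType} {d : nat} (alpha : d.-tuple R)
    (sigma : R) (f : d.-tuple R -> R[i]) (x : d.-tuple R) : R[i] :=
  Complex
    (fine (\int[laguerre_measure alpha]_(y in orthant)
       (potential_kernel alpha sigma x y * (complex.Re (f y))%:E)))%E
    (fine (\int[laguerre_measure alpha]_(y in orthant)
       (potential_kernel alpha sigma x y * (complex.Im (f y))%:E)))%E.

Definition Lp_norm {R : realType} {d : nat} (alpha : d.-tuple R) (p : R)
    (f : d.-tuple R -> R[i]) : \bar R :=
  'N[laguerre_measure alpha]_p%:E [(fun x => (Normc.normc (f x))%:E) \_ orthant]%E.

Definition in_Lp {R : realType} {d : nat} (alpha : d.-tuple R) (p : R)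
    (f : d.-tuple R -> R[i]) : Prop :=
  [/\ measurable_fun orthant (fun x => complex.Re (f x)),
      measurable_fun orthant (fun x => complex.Im (f x)) &
      (Lp_norm alpha p f < +oo)%E].

Definition Lp_Lq_bounded {R : realType} {d : nat} (alpha : d.-tuple R)
    (sigma p q : R) : Prop :=
  exists C : R, forall f : d.-tuple R -> R[i], in_Lp alpha p f ->
    [/\ potential_domain alpha sigma f,
        in_Lp alpha q (potential alpha sigma f) &
        (Lp_norm alpha q (potential alpha sigma f)
           <= C%:E * Lp_norm alpha p f)%E].

Definition pairing_defined {R : realType} {d : nat} (alpha : d.-tuple R)
    (f g : d.-tuple R -> R[i]) : Prop :=
  (laguerre_measure alpha).-integrable orthant
    (fun x => (complex.Re (f x * conjc (g x)))%:E) /\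
  (laguerre_measure alpha).-integrable orthant
    (fun x => (complex.Im (f x * conjc (g x)))%:E).

Definition pairing {R : realType} {d : nat} (alpha : d.-tuple R)
    (f g : d.-tuple R -> R[i]) : R[i] :=
  Complex (\int[laguerre_measure alpha]_(x in orthant) complex.Re (f x * conjc (g x)))
          (\int[laguerre_measure alpha]_(x in orthant) complex.Im (f x * conjc (g x))).

(* (p, q) lies in the admissible strip minus the excluded endpoint, where
   D stands for |alpha| + d. *)
Definition admissible {R : realType} (D sigma p q : R) : Prop :=
  p^-1 - sigma / D <= q^-1 < p^-1 + sigma / D /\
  ~ (p = 1 /\ q = D / (D - sigma)).

(* Main.v *)
(* The eigenvalues are sums over the coordinates, so G_t factors into
   one-dimensional heat kernels, which the Hille-Hardy formula gives in closed
   form. With D = |alpha| + d and alpha >= -1/2 this yields G_t <= S t^(-D),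
   \int G_t(x, y) dmu(y) <= B e^(-bt) and \iint G_t dmu dmu <= S t^(-D).

   The L^p-L^q bound is proved in bilinear form. Put u = 1/p, v = 1 - 1/q and
   let a, b >= 0 have integral at most 1 (so a = |f|^p and b = |g|^q'). One
   has to bound \iiint t^(sigma-1) G_t(x, y) a(y)^u b(x)^v dt dmu(y) dmu(x).
   If D |1/p - 1/q| < sigma, then X^r Y^s Z^w <= X + Y + Z for r + s + w = 1,
   used at fixed t, bounds the inner double integral by
   C t^(-D|1/p - 1/q|) e^(-ct), and this is integrable against t^(sigma-1) dt.
   At the Hardy-Littlewood-Sobolev endpoint 1/q = 1/p - sigma/D, p > 1, the
   t-integral is cut according to whether a t^D and b t^D exceed 1.

   Finally l_k = e^(t lambda_k) \int G_t l_k shows that l_k is bounded and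
   integrable, which justifies Fubini in the identity for <I f, l_k>. *)
Require Import Defs.
From HB Require Import structures.
From mathcomp Require Import all_boot all_order all_algebra.
From mathcomp Require Import all_classical all_reals all_analysis.
From mathcomp Require Import measurable_realfun.
From mathcomp.real_closed Require Import complex.
From mathcomp Require Import ring lra.
Set Implicit Arguments.
Unset Strict Implicit.
Unset Printing Implicit Defensive.
Import Order.TTheory GRing.Theory Num.Theory.
Import numFieldNormedType.Exports.
Local Open Scope classical_set_scope.
Local Open Scope ring_scope.

(** * Unconditional sums *)

(** The potential kernel is never estimated pointwise: it is singular, possibly infinite, on the
    diagonal. Everything rests on the size bounds for [G_t]. The bound on the double integral opens
    the range q < p: [mu] is infinite, and only the decay in x of the y-integral of [G_t] makes it
    finite. If sigma >= D the strict case applies, because |1/p - 1/q| < 1 for finite p and q. At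
    the endpoint the cut in t depends on a(y) and b(x), so that the t-integrals are bounded by
    multiples of a, of b or of a b and no interpolation of operators is needed. The constants
    contain 1/(1 - u) and 1/(1 - v), whence the exclusion of p = 1 there. The Hille-Hardy formula is
    obtained by rearranging explicit series. Absolute convergence comes from the same computation at
    -|X| and -|Y|, where all terms are nonnegative. Sums are therefore handled by predicates that
    assert convergence, which an equation on [rsum] would not do. *)

Section psum.
Context {R : realType}.
Implicit Types I J : choiceType.

(** Since [s] is real, the predicate includes finiteness of the sum. *)
Definition psum {I} (u : I -> R) (s : R) : Prop :=
  (forall i, 0 <= u i) /\ \esum_(i in [set: I]) (u i)%:E = s%:E.

Lemma psum_sum_ge0 I (u : I -> R) s : psum u s -> 0 <= s.
Proof. by case=> u0 us; rewrite -lee_fin -us; apply: esum_ge0 => i _; rewrite lee_fin. Qed.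

Lemma psum_uniq I (u : I -> R) s t : psum u s -> psum u t -> s = t.
Proof. by move=> [_ us] [_]; rewrite us => -[]. Qed.

Lemma eq_psum I (u v : I -> R) s : u =1 v -> psum u s -> psum v s.
Proof. by move=> /funext ->. Qed.

Lemma psum0 I : psum (fun _ : I => 0 : R) 0.
Proof. by split=> //; rewrite esum1. Qed.

Lemma psumD I (u v : I -> R) s t :
  psum u s -> psum v t -> psum (fun i => u i + v i) (s + t).
Proof.
move=> [u0 us] [v0 vt]; split=> [i|]; first exact: addr_ge0.
by under eq_esum do rewrite EFinD; rewrite esumD ?us ?vt// => i _; rewrite lee_fin.
Qed.

Lemma psumZ I c (u : I -> R) s :
  0 <= c -> psum u s -> psum (fun i => c * u i) (c * s).
Proof.
move=> c0 [u0 us]; split=> [i|]; first exact: mulr_ge0.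
rewrite EFinM -us; apply/eqP; rewrite eq_le; apply/andP; split.
  apply: ge_ereal_sup => _ [X [fX _] <-].
  under eq_fsbigr do rewrite EFinM.
  rewrite -ge0_mule_fsumr; last by move=> i; rewrite lee_fin.
  by apply: lee_wpmul2l; [rewrite lee_fin|apply: ereal_sup_ubound; exists X].
have [->|cn0] := eqVneq c 0.
  by rewrite mul0e; apply: esum_ge0 => i _; rewrite mul0r.
have cp : 0 < c by rewrite lt_neqAle eq_sym cn0.
rewrite muleC -lee_pdivlMr//.
apply: ge_ereal_sup => _ [X [fX _] <-].
rewrite lee_pdivlMr// muleC ge0_mule_fsumr; last by move=> i; rewrite lee_fin.
by apply: ereal_sup_ubound; exists X => //; apply: eq_fsbigr => i _; rewrite EFinM.
Qed.

Lemma psum_dom I (u v : I -> R) t :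
  (forall i, 0 <= u i <= v i) -> psum v t -> exists2 s, psum u s & s <= t.
Proof.
move=> uv [v0 vt].
have uvt : (\esum_(i in [set: I]) (u i)%:E <= t%:E)%E.
  by rewrite -vt; apply: le_esum => i _; rewrite lee_fin; have /andP[] := uv i.
have u0 : (0 <= \esum_(i in [set: I]) (u i)%:E)%E.
  by apply: esum_ge0 => i _; rewrite lee_fin; have /andP[] := uv i.
have uf : \esum_(i in [set: I]) (u i)%:E \is a fin_num.
  by rewrite ge0_fin_numE// (le_lt_trans uvt)// ltry.
exists (fine (\esum_(i in [set: I]) (u i)%:E)).
  by split=> [i|]; [have /andP[] := uv i|rewrite fineK].
by rewrite -lee_fin fineK.
Qed.

Lemma psum_pair_esum I J (u : I * J -> R) : (forall x, 0 <= u x) ->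
  (\esum_(i in [set: I]) \esum_(j in [set: J]) (u (i, j))%:E =
  \esum_(x in [set: I * J]) (u x)%:E)%E.
Proof.
move=> u0; rewrite esum_esum; last by move=> i j _ _; rewrite lee_fin.
rewrite (_ : _ `*`` _ = setT); last by apply/seteqP; split.
by apply: eq_esum => -[].
Qed.

Lemma psum_row I J (u : I * J -> R) s : psum u s ->
  forall i, exists t, psum (fun j => u (i, j)) t.
Proof.
move=> [u0 us] i; exists (fine (\esum_(j in [set: J]) (u (i, j))%:E)).
split=> //; rewrite fineK// ge0_fin_numE; last by apply: esum_ge0 => *; rewrite lee_fin.
apply: le_lt_trans (ltry s); rewrite -us -psum_pair_esum//.
rewrite (esumID [set i])//; last by move=> *; apply: esum_ge0 => *; rewrite lee_fin.
rewrite setTI esum_set1; last by apply: esum_ge0 => *; rewrite lee_fin.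
by rewrite leeDl// esum_ge0// => *; apply: esum_ge0 => *; rewrite lee_fin.
Qed.

(** Tonelli for families. Being an equivalence, it makes summability of the row sums a test for
    summability of the whole family. *)
Lemma psum_pair I J (u : I * J -> R) (v : I -> R) s :
  (forall i, psum (fun j => u (i, j)) (v i)) -> psum v s <-> psum u s.
Proof.
move=> uv; have u0 x : 0 <= u x by case: x => i j; have [+ _] := uv i; apply.
rewrite /psum -psum_pair_esum//; under [in X in _ <-> X]eq_esum do rewrite (uv _).2.
by split=> -[] => // _; split => // i; exact: psum_sum_ge0 (uv i).
Qed.

Lemma psum_inj I J (f : I -> J) (u : J -> R) s : injective f ->
  (forall j, ~ range f j -> u j = 0) ->
  psum (fun i => u (f i)) s <-> psum u s.
Proof.
move=> fi f0; rewrite /psum -(esum_image [set: I] f (fun j => (u j)%:E)); last by move=> x y _ _; exact: fi.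
have -> : \esum_(j in range f) (u j)%:E = \esum_(j in [set: J]) (u j)%:E.
  rewrite esum_mkcond; apply: eq_esum => j _.
  by case: ifPn => //; rewrite notin_setE => /f0 ->.
split=> -[u0 ->]; split => // j; have [[i _ <-]//|nf] := pselect (range f j).
by rewrite f0.
Qed.

Lemma psum_fin (u : nat -> R) n : (forall i, 0 <= u i) ->
  (forall i, (n <= i)%N -> u i = 0) -> psum u (\sum_(i < n) u i).
Proof.
move=> u0 un; split=> //; rewrite -nneseries_esumT//.
rewrite (nneseries_split 0 n)//; last by move=> k _; exact: u0.
rewrite eseries0 ?adde0; last by move=> i ni _; rewrite add0n in ni; rewrite un.
by rewrite add0n big_mkord sumEFin.
Qed.

Lemma psum_series (u : nat -> R) s : psum u s ->
  (\sum_(i < n) u i) @[n --> \oo] --> s.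
Proof.
move=> [u0 us]; have e0 n : (0 <= (u n)%:E)%E by rewrite lee_fin.
have : ((\sum_(0 <= i < n) (u i)%:E)%E @[n --> \oo] --> s%:E).
  by rewrite -us -nneseries_esumT//; exact: is_cvg_nneseries.
by under eq_fun do rewrite sumEFin big_mkord; move=> /fine_cvg.
Qed.

Lemma series_psum (u : nat -> R) s : (forall i, 0 <= u i) ->
  (\sum_(i < n) u i) @[n --> \oo] --> s -> psum u s.
Proof.
move=> u0 us; split=> //; rewrite -nneseries_esumT//.
apply/cvg_lim => //; under eq_fun do rewrite sumEFin big_mkord.
by apply: cvg_EFin => //; exact: nearW.
Qed.

End psum.

Section hsum.
Context {R : realType}.
Implicit Types I J : choiceType.

(* Absolutely summable with sum [s]; contrary to [rsum u = s], this asserts convergence. *)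
Definition hsum {I} (u : I -> R) (s : R) : Prop := exists a b A B,
  [/\ psum a A, psum b B, (forall i, u i = a i - b i) & s = A - B].

Lemma psum_hsum I (u : I -> R) s : psum u s -> hsum u s.
Proof.
by move=> us; exists u, (fun=> 0), s, 0; split; rewrite ?subr0//; [exact: psum0|move=> i; rewrite subr0].
Qed.

Lemma eq_hsum I (u v : I -> R) s : u =1 v -> hsum u s -> hsum v s.
Proof. by move=> /funext ->. Qed.

(** Two decompositions a - b = a' - b' give a + b' = a' + b, to which uniqueness of nonnegative sums
    applies. *)
Lemma hsum_uniq I (u : I -> R) s t : hsum u s -> hsum u t -> s = t.
Proof.
move=> [a [b [A [B [aA bB uab ->]]]]] [a' [b' [A' [B' [aA' bB' uab' ->]]]]].
have : psum (fun i => a i + b' i) (A' + B).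
  apply: eq_psum (psumD aA' bB) => i.
  by have := uab i; rewrite uab'; lra.
by move=> /(psum_uniq (psumD aA bB')); lra.
Qed.

Lemma hsumD I (u v : I -> R) s t :
  hsum u s -> hsum v t -> hsum (fun i => u i + v i) (s + t).
Proof.
move=> [a [b [A [B [aA bB uab ->]]]]] [a' [b' [A' [B' [aA' bB' uab' ->]]]]].
exists (fun i => a i + a' i), (fun i => b i + b' i), (A + A'), (B + B').
by split; [exact: psumD|exact: psumD|move=> i; rewrite uab uab'; lra|lra].
Qed.

Lemma hsumN I (u : I -> R) s : hsum u s -> hsum (fun i => - u i) (- s).
Proof.
move=> [a [b [A [B [aA bB uab ->]]]]]; exists b, a, B, A.
by split => //; [move=> i; rewrite uab; lra|lra].
Qed.

Lemma hsumZ I c (u : I -> R) s : hsum u s -> hsum (fun i => c * u i) (c * s).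
Proof.
wlog c0 : c u s / 0 <= c => [hw us|].
  have [c0|/ltW c0] := leP 0 c; first exact: hw.
  have := hw (- c) _ _ _ (hsumN us); rewrite oppr_ge0 mulrNN => /(_ c0).
  by apply: eq_hsum => i; rewrite mulrNN.
move=> [a [b [A [B [aA bB uab ->]]]]].
exists (fun i => c * a i), (fun i => c * b i), (c * A), (c * B).
by split; [exact: psumZ|exact: psumZ|move=> i; rewrite uab mulrBr|rewrite mulrBr].
Qed.

Lemma hsum_abs I (u : I -> R) s : hsum u s -> exists t, psum (fun i => `|u i|) t.
Proof.
move=> [a [b [A [B [aA bB uab _]]]]].
have [|t ? _] := psum_dom (u := fun i => `|u i|) _ (psumD aA bB); last by exists t.
move=> i; by rewrite normr_ge0/= uab (le_trans (ler_normB _ _))// !ger0_norm//; [case: bB|case: aA].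
Qed.

Lemma hsum_dom I (u c : I -> R) C : (forall i, `|u i| <= c i) -> psum c C ->
  exists s, hsum u s.
Proof.
move=> uc cC.
have [i|A aA _] := @psum_dom _ _ (fun i => Num.max (u i) 0) _ _ _ cC.
  have := uc i; rewrite ler_norml => /andP[c1 c2].
  by rewrite le_max lexx orbT/= ge_max c2/=; lra.
have [i|B bB _] := @psum_dom _ _ (fun i => Num.max (- u i) 0) _ _ _ cC.
  have := uc i; rewrite ler_norml => /andP[c1 c2].
  by rewrite le_max lexx orbT/= ge_max/=; apply/andP; split; lra.
exists (A - B), (fun i => Num.max (u i) 0), (fun i => Num.max (- u i) 0), A, B; split => // i.
by case: (leP (u i) 0); case: (leP (- u i) 0); lra.
Qed.

Lemma hsum_psum I (u : I -> R) s : (forall i, 0 <= u i) -> hsum u s -> psum u s.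
Proof.
move=> u0 us; have [t] := hsum_abs us.
move=> /(eq_psum (v := u)) => /(_ (fun i => ger0_norm (u0 i))) ut.
by rewrite (hsum_uniq us (psum_hsum ut)).
Qed.

(** [rsum] yields a number for every family, meaningful or not; this gives its value once absolute
    convergence is established, in particular for [heat_kernel]. *)
Lemma hsum_rsum I (u : I -> R) s : hsum u s -> rsum u = s.
Proof.
move=> us; have [t ut] := hsum_abs us.
have [i|A aA _] := @psum_dom _ _ (fun i => Num.max (u i) 0) _ _ _ ut.
  by rewrite le_max lexx orbT/= ge_max ler_norm normr_ge0.
have [i|B bB _] := @psum_dom _ _ (fun i => Num.max (- u i) 0) _ _ _ ut.
  by rewrite le_max lexx orbT/= ge_max ler_normr normr_ge0 lexx orbT.
have : hsum u (A - B).
  exists (fun i => Num.max (u i) 0), (fun i => Num.max (- u i) 0), A, B; split => // i.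
  by case: (leP (u i) 0); case: (leP (- u i) 0); lra.
move=> /(hsum_uniq us) ->; rewrite /rsum.
rewrite (_ : \esum_(i in _) _ = A%:E); last first.
  by rewrite -aA.2; apply: eq_esum => i _; rewrite funeposE/= EFin_max.
rewrite (_ : \esum_(i in _) _ = B%:E)//.
by rewrite -bB.2; apply: eq_esum => i _; rewrite funenegE/= EFin_max.
Qed.

(** Fubini for families. The common sum is left existential and is identified afterwards by
    [hsum_uniq]. *)
Lemma hsum_pair I J (u : I * J -> R) (v : I -> R) C : psum (fun x => `|u x|) C ->
  (forall i, hsum (fun j => u (i, j)) (v i)) -> exists2 s, hsum u s & hsum v s.
Proof.
move=> uC uv; have [s us] := hsum_dom (fun x => lexx `|u x|) uC.
exists s => //; case: us => a [b [A [B [aA bB uab ->]]]].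
have [f af] := choice (psum_row aA); have [g bg] := choice (psum_row bB).
exists f, g, A, B; split => //; [exact/(psum_pair _ af)|exact/(psum_pair _ bg)|].
move=> i; apply: hsum_uniq (uv i) _.
by exists (fun j => a (i, j)), (fun j => b (i, j)), (f i), (g i).
Qed.

(** Reindexing along an injection whose range carries all nonzero terms. It serves to transpose a
    double family, to regroup it by diagonals, to shift an index and to split a tuple. *)
Lemma hsum_inj I J (f : I -> J) (u : J -> R) s : injective f ->
  (forall j, ~ range f j -> u j = 0) ->
  hsum (fun i => u (f i)) s <-> hsum u s.
Proof.
move=> fi f0.
have H t : hsum u t -> hsum (fun i => u (f i)) t.
  move=> ut; have [c uc] := hsum_abs ut.
  have [i|A aA _] := @psum_dom _ _ (fun i => Num.max (u i) 0) _ _ _ uc.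
    by rewrite le_max lexx orbT/= ge_max ler_norm normr_ge0.
  have [i|B bB _] := @psum_dom _ _ (fun i => Num.max (- u i) 0) _ _ _ uc.
    by rewrite le_max lexx orbT/= ge_max ler_normr normr_ge0 lexx orbT.
  have E i : u i = Num.max (u i) 0 - Num.max (- u i) 0.
    by case: (leP (u i) 0); case: (leP (- u i) 0); lra.
  have -> : t = A - B.
    apply: hsum_uniq ut _.
    by exists (fun i => Num.max (u i) 0), (fun i => Num.max (- u i) 0), A, B.
  exists (fun i => Num.max (u (f i)) 0), (fun i => Num.max (- u (f i)) 0), A, B; split => //.
    by apply/(psum_inj (u := fun i => Num.max (u i) 0)) => // j /f0 ->; rewrite maxxx.
  by apply/(psum_inj (u := fun i => Num.max (- u i) 0)) => // j /f0 ->; rewrite oppr0 maxxx.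
split; last exact: H.
move=> ufs; have [c ufc] := hsum_abs ufs.
have uc : psum (fun j => `|u j|) c.
  by apply/(psum_inj (u := fun j => `|u j|) _ fi) => // j /f0 ->; rewrite normr0.
have [t ut] := hsum_dom (fun j => lexx `|u j|) uc.
by rewrite (hsum_uniq ufs (H _ ut)).
Qed.

Lemma hsum_swap I J (u : I * J -> R) v w C s : psum (fun x => `|u x|) C ->
  (forall i, hsum (fun j => u (i, j)) (v i)) ->
  (forall j, hsum (fun i => u (i, j)) (w j)) -> hsum v s -> hsum w s.
Proof.
move=> uC uv uw vs; have [s' us' /(hsum_uniq vs) ss'] := hsum_pair uC uv.
pose sw (x : J * I) := (x.2, x.1).
have swi : injective sw by move=> [? ?] [? ?] [-> ->].
have swr x : ~ range sw x -> False by case: x => i j; apply; exists (j, i).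
have uC' : psum (fun x => `|(fun x => u (sw x)) x|) C.
  by apply/(psum_inj (u := fun x => `|u x|) _ swi) => // j /swr.
have [t ut wt] := hsum_pair uC' uw.
move/hsum_inj : ut => /(_ swi) ut.
by rewrite ss' (hsum_uniq us' (ut _))// => j /swr.
Qed.

Lemma hsum_fin (u : nat -> R) n : (forall i, (n <= i)%N -> u i = 0) ->
  hsum u (\sum_(i < n) u i).
Proof.
move=> un.
have h1 := @psum_fin _ (fun i => Num.max (u i) 0) n.
have h2 := @psum_fin _ (fun i => Num.max (- u i) 0) n.
apply: eq_hsum (_ : hsum (fun i => Num.max (u i) 0 - Num.max (- u i) 0) _).
  by move=> i; case: (leP (u i) 0); case: (leP (- u i) 0); lra.
rewrite (eq_bigr (fun i : 'I_n => Num.max (u i) 0 - Num.max (- u i) 0)); last first.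
  by move=> i _; case: (leP (u i) 0); case: (leP (- u i) 0); lra.
rewrite sumrB; apply: hsumD; last apply: hsumN.
  by apply/psum_hsum/h1 => i; [rewrite le_max lexx orbT|move=> /un ->; rewrite maxxx].
by apply/psum_hsum/h2 => i; [rewrite le_max lexx orbT|move=> /un ->; rewrite oppr0 maxxx].
Qed.

Lemma hsum_series (u : nat -> R) s : hsum u s ->
  (\sum_(i < n) u i) @[n --> \oo] --> s.
Proof.
move=> [a [b [A [B [aA bB uab ->]]]]].
under eq_fun do under eq_bigr do rewrite uab.
under eq_fun do rewrite sumrB.
by apply: cvgB; exact: psum_series.
Qed.

Lemma hsum_mul I J (u : I -> R) (v : J -> R) s t : hsum u s -> hsum v t ->
  hsum (fun x : I * J => u x.1 * v x.2) (s * t).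
Proof.
move=> us vt; have [s' us'] := hsum_abs us; have [t' vt'] := hsum_abs vt.
have h : psum (fun x : I * J => `|u x.1 * v x.2|) (s' * t').
  apply/(psum_pair (v := fun i => `|u i| * t')).
    by move=> i; under eq_fun do rewrite normrM/=; exact: psumZ.
  rewrite mulrC; apply: eq_psum (psumZ _ us') => [i|]; first by rewrite mulrC.
  exact: psum_sum_ge0 vt'.
have [|r h1 h2] := hsum_pair h (v := fun i => u i * t).
  by move=> i; exact: (hsumZ (u i) vt).
suff -> : s * t = r by [].
apply: hsum_uniq h2; rewrite mulrC; apply: eq_hsum (hsumZ t us) => i.
by rewrite mulrC.
Qed.

(** The regrouping of a Cauchy product: (j, m) is sent to (j + m, j), which turns [u] into a family
    on pairs (n, j) vanishing for j > n, so that each row is a finite sum. *)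
Lemma hsum_diag (u : nat * nat -> R) s : hsum u s ->
  hsum (fun n => \sum_(j < n.+1) u (j : nat, n - j)%N) s.
Proof.
move=> us; pose f (x : nat * nat) := ((x.1 + x.2)%N, x.1).
have fi : injective f.
  by move=> [i j] [i' j'] [/[swap] ->] /addnI ->.
pose v (x : nat * nat) := if (x.2 <= x.1)%N then u (x.2, x.1 - x.2)%N else 0.
have : hsum v s.
  apply/(hsum_inj (f := f)) => //.
    move=> [n j] nr; rewrite /v/=; case: ifPn => // jn.
    by exfalso; apply: nr; exists (j, n - j)%N => //; rewrite /f/= subnKC.
  by apply: eq_hsum us => -[i j]; rewrite /v/f/= leq_addr addKn.
move=> vs; have [C vC] := hsum_abs vs.
have [n|t vt h] := hsum_pair vC (v := fun n => \sum_(j < n.+1) u (j : nat, n - j)%N).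
  have -> : \sum_(j < n.+1) u (j : nat, (n - j)%N) = \sum_(j < n.+1) v (n, j : nat).
    by apply: eq_bigr => j _; rewrite /v/= -ltnS ltn_ord.
  by apply: (@hsum_fin (fun j => v (n, j))) => i ni; rewrite /v/= leqNgt ni.
by rewrite (hsum_uniq vs vt).
Qed.

Lemma hsum_exp (z : R) : hsum (fun n => z ^+ n / n`!%:R) (expR z).
Proof.
have cv (x : R) : (\sum_(i < n) (x ^+ i / i`!%:R)) @[n --> \oo] --> expR x.
  have h : series (exp_coeff x) @ \oo --> expR x by exact: is_cvg_series_exp_coeff.
  rewrite [X in X @ _](_ : _ = series (exp_coeff x))//.
  by apply/funext => n; rewrite /series/= big_mkord.
have : psum (fun n => `|z| ^+ n / n`!%:R) (expR `|z|).
  by apply: series_psum => // i; rewrite divr_ge0// exprn_ge0.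
move=> /(@hsum_dom _ (fun n => z ^+ n / n`!%:R)) [i|s zs].
  by rewrite normrM normrX normfV normr_nat.
suff -> : expR z = s by [].
by apply: (cvg_unique _ (cv z) (hsum_series zs)).
Qed.

(** A tuple is split into head and tail, and [hsum_mul] applies. With one series per coordinate this
    factors [heat_kernel] into one-dimensional kernels. *)
Lemma hsum_tuple (n : nat) (u : 'I_n -> nat -> R) (s : 'I_n -> R) :
  (forall i, hsum (u i) (s i)) ->
  hsum (fun k : n.-tuple nat => \prod_(i < n) u i (tnth k i)) (\prod_(i < n) s i).
Proof.
elim: n u s => [|n IH] u s us.
  rewrite big_ord0; apply/psum_hsum; split=> [k|]; first by rewrite big_ord0.
  rewrite (_ : [set: 0.-tuple nat] = [set [tuple]]) ?esum_set1 ?big_ord0//.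
  by apply/seteqP; split=> // k _; rewrite /= tuple0.
pose f (x : nat * n.-tuple nat) : n.+1.-tuple nat := [tuple of x.1 :: x.2].
have fi : injective f.
  by move=> [i k] [i' k'] /(congr1 val)/= [-> /val_inj ->].
apply/(hsum_inj (f := f)) => //.
  move=> k []; exists (thead k, behead_tuple k) => //.
  by apply/val_inj; rewrite /= [in RHS](tuple_eta k).
rewrite big_ord_recl.
have := hsum_mul (us ord0) (IH _ _ (fun i => us (lift ord0 i))).
apply: eq_hsum => -[i k] /=; rewrite big_ord_recl tnth0; congr (_ * _).
by apply: eq_bigr => j _; rewrite tnthS.
Qed.

End hsum.

(** * Integrals over the half-line *)

Section half_line.
Context {R : realType}.
Local Notation leb := (@lebesgue_measure R).

Lemma bigcup_itvcc :
  \bigcup_n `[n.+1%:R^-1, n.+1%:R]%classic = `]0, +oo[%classic :> set R.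
Proof.
apply/seteqP; split=> [x [n _]|x] /=; rewrite !in_itv/= ?andbT.
  by move=> /andP[+ _]; apply: lt_le_trans; rewrite invr_gt0.
move=> x0; have [n hn] : exists n, x <= n%:R /\ x^-1 <= n%:R.
  exists (maxn (Num.truncn x).+1 (Num.truncn x^-1).+1).
  rewrite !natr_max !le_max; split.
    by rewrite ltW// truncnS_gt.
  by rewrite [X in _ || X]ltW ?orbT// truncnS_gt.
exists n => //; rewrite /= in_itv/=; apply/andP; split.
  rewrite -[leRHS]invrK lef_pV2 ?posrE ?invr_gt0//.
  by rewrite (le_trans hn.2)// ler_nat.
by rewrite (le_trans hn.1)// ler_nat.
Qed.

Lemma nondecreasing_itvcc (F : R -> R) :
  (forall x y : R, 0 < x -> x <= y -> F x <= F y) ->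
  nondecreasing_seq (fun n => `[F n.+1%:R^-1, F n.+1%:R]%classic : set R).
Proof.
move=> ndF m n mn; rewrite subsetEset => x /=; rewrite !in_itv/= => /andP[h1 h2].
apply/andP; split; [apply: le_trans h1|apply: le_trans h2 _]; apply: ndF => //.
- by rewrite lef_pV2 ?posrE// ler_nat.
- by rewrite ler_nat.
Qed.

Lemma measurable_fun_itv0y (f : R -> R) : (forall x : R, 0 < x -> {for x, continuous f}) ->
  measurable_fun (`]0%R, +oo[%classic : set R) f.
Proof.
move=> cf; apply: open_continuous_measurable_fun => // x.
by rewrite inE/= in_itv/= andbT; exact: cf.
Qed.

(** Change of variables on the compact intervals [1/(n+1), n+1], then monotone convergence on both
    sides. The hypothesis that each [y] lies between F(1/(n+1)) and F(n+1) for some n replaces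
    limits of [F] at 0 and at infinity: the image intervals exhaust the half-line. *)
Lemma ge0_integration_by_substitution_pos (F f G : R -> R) :
  (forall x y : R, 0 < x -> x < y -> F x < F y) ->
  (forall x : R, 0 < x -> is_derive x 1 F (f x)) ->
  (forall x : R, 0 < x -> {for x, continuous f}) ->
  (forall x : R, 0 < x -> 0 <= f x) ->
  (forall x : R, 0 < x -> 0 < F x) ->
  (forall y : R, 0 < y -> exists n : nat, F n.+1%:R^-1 <= y <= F n.+1%:R) ->
  (forall x : R, 0 < x -> {for x, continuous G}) ->
  (forall x : R, 0 < x -> 0 <= G x) ->
  (\int[leb]_(x in `]0%R, +oo[) (G x)%:E =
   \int[leb]_(x in `]0%R, +oo[) (G (F x) * f x)%:E)%E.
Proof.
move=> incF dF cf f0 F0 Fn cG G0.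
have ndF x y : 0 < x -> x <= y -> F x <= F y.
  by move=> x0; rewrite le_eqVlt => /predU1P[->//|/(incF _ _ x0)/ltW].
have cF x : 0 < x -> {for x, continuous F}.
  move=> /dF[dFx _]; apply: differentiable_continuous; exact/derivable1_diffP.
have F'f (x : R) : 0 < x -> derive1 F x = f x by move=> /dF[_ <-]; rewrite derive1E.
have cF' (x : R) : 0 < x -> {for x, continuous (derive1 F)}.
  move=> x0; have : f @ x --> f x := cf _ x0.
  rewrite -(F'f x x0); apply: cvg_trans.
  apply: near_eq_cvg; near=> y; rewrite F'f//; near: y.
  exact: lt_nbhsr.
have mG := measurable_fun_itv0y cG.
have cGf (x : R) : 0 < x -> {for x, continuous (fun x => G (F x) * f x)}.
  move=> x0; apply: cvgM; last exact: cf.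
  by apply: (@continuous_comp _ _ _ F G); [exact: cF|exact/cG/F0].
have mGf := measurable_fun_itv0y cGf.
have UF : \bigcup_n `[F n.+1%:R^-1, F n.+1%:R]%classic = `]0, +oo[%classic.
  apply/seteqP; split=> [x [n _]|x] /=; rewrite !in_itv/= ?andbT.
    by move=> /andP[+ _]; apply: lt_le_trans; apply: F0; rewrite invr_gt0.
  by move=> /Fn[n hn]; exists n => //=; rewrite in_itv.
have h1 : (\int[leb]_(x in `[(F n.+1%:R^-1)%R, (F n.+1%:R)%R]) (G x)%:E)%E @[n --> \oo] -->
    (\int[leb]_(x in `]0%R, +oo[) (G x)%:E)%E.
  rewrite -UF; apply: ge0_nondecreasing_set_cvg_integral => //.
  - exact: nondecreasing_itvcc.
  - by move=> n; apply/measurable_EFinP; apply: measurable_funS mG => // x; rewrite -UF => ?; exists n.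
  - move=> n x; rewrite /= in_itv/= => /andP[h _]; rewrite lee_fin G0// (lt_le_trans _ h)//.
    by rewrite F0// invr_gt0.
have h2 : (\int[leb]_(x in `[(n.+1%:R^-1)%R, n.+1%:R%R]) (G (F x) * f x)%:E)%E @[n --> \oo] -->
    (\int[leb]_(x in `]0%R, +oo[) (G (F x) * f x)%:E)%E.
  rewrite -bigcup_itvcc; apply: ge0_nondecreasing_set_cvg_integral => //.
  - exact: (@nondecreasing_itvcc id).
  - by move=> n; apply/measurable_EFinP; apply: measurable_funS mGf => // x; rewrite -bigcup_itvcc => ?; exists n.
  - move=> n x; rewrite /= in_itv/= => /andP[h _].
    have x0 : 0 < x by rewrite (lt_le_trans _ h)// invr_gt0.
    by rewrite lee_fin mulr_ge0// ?f0// G0// F0.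
apply: (cvg_unique _ h1) => //; apply: cvg_trans h2; apply: near_eq_cvg; near=> n.
have n1 : n.+1%:R^-1 <= n.+1%:R :> R.
  by rewrite (@le_trans _ _ 1)// ?invf_le1// ler1n.
rewrite integration_by_substitution_increasing//.
- apply: eq_integral => x; rewrite inE/= in_itv/= => /andP[h _].
  by rewrite fctE F'f// (lt_le_trans _ h)// invr_gt0.
- move=> x y; rewrite !in_itv/= => /andP[h _] _; apply: incF.
  by rewrite (lt_le_trans _ h)// invr_gt0.
- move=> x; rewrite in_itv/= => /andP[h _]; apply: cF'.
  by rewrite (lt_trans _ h)// invr_gt0.
- apply/cvg_ex; exists (derive1 F n.+1%:R^-1); apply: cvg_at_right_filter.
  by apply: cF'; rewrite invr_gt0.
- by apply/cvg_ex; exists (derive1 F n.+1%:R); apply: cvg_at_left_filter; exact: cF'.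
- split.
  + move=> x; rewrite in_itv/= => /andP[h _].
    by have [] := dF x; rewrite // (lt_trans _ h)// invr_gt0.
  + by apply: cvg_at_right_filter; apply: cF; rewrite invr_gt0.
  + by apply: cvg_at_left_filter; exact: cF.
- apply: continuous_in_subspaceT => x; rewrite inE/= in_itv/= => /andP[h _].
  by apply: cG; rewrite (lt_le_trans _ h)// F0// invr_gt0.
Unshelve. all: by end_near. Qed.

Lemma continuous_powR_gt0 (a x : R) : 0 < x -> {for x, continuous (fun x => x `^ a)}.
Proof.
move=> x0; apply: differentiable_continuous; apply/derivable1_diffP.
by apply: derivable_powR; rewrite in_itv/= x0.
Qed.

Lemma is_derive_powR (a x : R) : 0 < x -> is_derive x 1 (fun x => x `^ a) (a * x `^ (a - 1)).
Proof.
move=> x0; apply: DeriveDef.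
  by apply: derivable_powR; rewrite in_itv/= x0.
by rewrite -derive1E powR_derive1// in_itv/= x0.
Qed.

Lemma integral_scale (c : R) (G : R -> R) : 0 < c ->
  (forall x : R, 0 < x -> {for x, continuous G}) ->
  (forall x : R, 0 < x -> 0 <= G x) ->
  (\int[leb]_(x in `]0%R, +oo[) (G x)%:E =
   \int[leb]_(x in `]0%R, +oo[) (G (c * x) * c)%:E)%E.
Proof.
move=> c0 cG G0; apply: (@ge0_integration_by_substitution_pos ( *%R c) (fun=> c)) => //.
- by move=> x y _ xy; rewrite ltr_pM2l.
- move=> x x0; have -> : *%R c = c *: (id : R -> R) by [].
  by apply: is_derive_eq; rewrite /GRing.scale/= mulr1.
- by move=> x _; exact: cvg_cst.
- by move=> x _; exact: ltW.
- by move=> x x0; exact: mulr_gt0.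
- move=> y y0; have : `]0, +oo[%classic (y / c) by rewrite /= in_itv/= divr_gt0.
  rewrite -bigcup_itvcc => -[n _]; rewrite /= in_itv/= => /andP[h1 h2].
  by exists n; rewrite -ler_pdivlMl// mulrC h1/= -ler_pdivrMl// mulrC.
Qed.

Lemma integral_sqr (G : R -> R) :
  (forall x : R, 0 < x -> {for x, continuous G}) ->
  (forall x : R, 0 < x -> 0 <= G x) ->
  (\int[leb]_(x in `]0%R, +oo[) (G x)%:E =
   \int[leb]_(x in `]0%R, +oo[) (G (x ^+ 2) * (2 * x))%:E)%E.
Proof.
move=> cG G0; apply: (@ge0_integration_by_substitution_pos (fun x => x ^+ 2) (fun x => 2 * x)) => //.
- by move=> x y x0 xy; rewrite ltr_pXn2r// nnegrE ltW// (lt_trans x0).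
- move=> x x0; apply: is_derive_eq.
  by rewrite /GRing.scale/= !mulr1 -mulr2n mulr_natl.
- by move=> x _; apply: mulrl_continuous.
- by move=> x /ltW; exact: mulr_ge0.
- by move=> x x0; exact: exprn_gt0.
- move=> y y0; have : `]0, +oo[%classic (Num.sqrt y) by rewrite /= in_itv/= sqrtr_gt0 y0.
  rewrite -bigcup_itvcc => -[n _]; rewrite /= in_itv/= => /andP[h1 h2].
  exists n; rewrite -(sqr_sqrtr (ltW y0)).
  by rewrite !ler_pXn2r ?nnegrE ?sqrtr_ge0// h1.
Qed.

(** For a < 1 the integrand is unbounded at 0, so the fundamental theorem is applied on [b/(n+1), b]
    and n tends to infinity. *)
Lemma integral_powR_itv0 (a b : R) : 0 < a -> 0 < b ->
  (\int[leb]_(x in `]0%R, b]) (a * x `^ (a - 1))%:E = (b `^ a)%:E)%E.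
Proof.
move=> a0 b0.
have cf (x : R) : 0 < x -> {for x, continuous (fun x => a * x `^ (a - 1))}.
  by move=> x0; apply: cvgM; [exact: cvg_cst|exact: continuous_powR_gt0].
have -> : `]0%R, b]%classic = \bigcup_n `[b / n.+1%:R, b]%classic.
  apply/seteqP; split=> [x|x [n _]] /=; rewrite !in_itv/= => /andP[h1 h2].
    have : `]0, +oo[%classic (x / b) by rewrite /= in_itv/= divr_gt0.
    rewrite -bigcup_itvcc => -[n _]; rewrite /= in_itv/= => /andP[h3 _].
    by exists n => //=; rewrite in_itv/= h2 andbT -ler_pdivlMl// mulrC.
  by rewrite h2 andbT (lt_le_trans _ h1)// divr_gt0.
have h1 : (\int[leb]_(x in `[(b / n.+1%:R)%R, b]) (a * x `^ (a - 1))%:E)%E @[n --> \oo] -->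
    (\int[leb]_(x in \bigcup_n `[(b / n.+1%:R)%R, b]%classic) (a * x `^ (a - 1))%:E)%E.
  apply: ge0_nondecreasing_set_cvg_integral => //.
  - move=> m n mn; rewrite subsetEset => x /=; rewrite !in_itv/= => /andP[h1 ->].
    rewrite andbT (le_trans _ h1)// ler_pM2l// lef_pV2 ?posrE// ler_nat.
    by rewrite ltnS.
  - move=> n; apply/measurable_EFinP; apply: measurable_funS (measurable_fun_itv0y cf) => //.
    move=> x; rewrite /= !in_itv/= andbT => /andP[+ _]; apply: lt_le_trans.
    by rewrite divr_gt0.
  - by move=> n x _; rewrite lee_fin mulr_ge0// ?powR_ge0// ltW.
apply: (cvg_unique _ h1) => //.
have h2 : (b `^ a - (b / n.+1%:R) `^ a) @[n --> \oo] --> b `^ a.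
  rewrite -[X in _ --> X]subr0; apply: cvgB; first exact: cvg_cst.
  have h : (b / n.+1%:R) @[n --> \oo] --> (0 : R).
    rewrite -(mulr0 b); apply: cvgM; first exact: cvg_cst.
    exact: cvg_harmonic.
  have := powR_cvg0 a0 => /cvg_at_rightP; apply; split => // n.
  by rewrite divr_gt0.
have : (b `^ a - (b / n.+1%:R) `^ a)%:E @[n --> \oo] --> (b `^ a)%:E.
  by apply: cvg_EFin => //; exact: nearW.
apply: cvg_trans; apply: near_eq_cvg; near=> n.
have bn0 : 0 < b / n.+1%:R by rewrite divr_gt0.
have bnb : b / n.+1%:R < b.
  rewrite ltr_pdivrMr// ltr_pMr// ltr1n ltnS; near: n; exact: nbhs_infty_gt.
rewrite (@continuous_FTC2 _ _ (fun x => x `^ a))//.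
- apply: continuous_in_subspaceT => x; rewrite inE/= in_itv/= => /andP[h _].
  by apply: cf; exact: lt_le_trans h.
- split.
  + move=> x; rewrite in_itv/= => /andP[h _].
    by have [] := is_derive_powR a (lt_trans bn0 h).
  + by apply: cvg_at_right_filter; exact: continuous_powR_gt0.
  + by apply: cvg_at_left_filter; exact: continuous_powR_gt0.
- move=> x; rewrite in_itv/= => /andP[h _].
  by rewrite powR_derive1// in_itv/= (lt_trans bn0 h).
Unshelve. all: by end_near. Qed.

Lemma integral_powR_itvy (a b : R) : 0 < a -> 0 < b ->
  (\int[leb]_(x in `[b, +oo[) (a * x `^ (- a - 1))%:E = (b `^ (- a))%:E)%E.
Proof.
move=> a0 b0.
have cf (x : R) : 0 < x -> {for x, continuous (fun x => a * x `^ (- a - 1))}.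
  by move=> x0; apply: cvgM; [exact: cvg_cst|exact: continuous_powR_gt0].
have dF (x : R) : b < x -> is_derive x 1 (fun x => - x `^ (- a)) (a * x `^ (- a - 1)).
  move=> bx; apply: is_derive_eq; first by apply: is_deriveN; apply: is_derive_powR; exact: lt_trans bx.
  by rewrite mulNr opprK.
rewrite (@ge0_continuous_FTC2y _ _ (fun x => - x `^ (- a)) _ 0).
- by rewrite -EFinB sub0r opprK.
- by move=> x _; rewrite mulr_ge0// ?powR_ge0// ltW.
- apply: continuous_in_subspaceT => x; rewrite inE/= in_itv/= andbT => h.
  by apply: cf; exact: lt_le_trans h.
- rewrite -oppr0; apply: cvgN; apply/cvgrPdist_lt => e e0; near=> t.
  have t0 : 0 < t by near: t; exact: nbhs_pinfty_gt.
  rewrite sub0r normrN ger0_norm ?powR_ge0// powRN.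
  rewrite -[ltRHS]invrK ltf_pV2 ?posrE ?powR_gt0// ?invr_gt0//.
  (* The threshold beyond which t^(-a) < e is t = (1/e)^(1/a). *)
  have -> : e^-1 = (e^-1 `^ a^-1) `^ a.
    by rewrite -powRrM mulVf ?gt_eqF// powRr1// invr_ge0 ltW.
  apply: gt0_ltr_powR; rewrite ?nnegrE ?powR_ge0 ?(ltW t0)//.
- by move=> x /dF[].
- by apply: cvg_at_right_filter; apply: cvgN; exact: continuous_powR_gt0.
- by move=> x; rewrite in_itv/= andbT => /dF[_ <-]; rewrite derive1E.
Unshelve. all: by end_near. Qed.

Lemma integral_expR_itvy (b : R) :
  (\int[leb]_(x in `[b, +oo[) (expR (- x))%:E = (expR (- b))%:E)%E.
Proof.
have dF (x : R) : is_derive x 1 (fun x => - expR (- x)) (expR (- x)).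
  apply: is_derive_eq.
  by rewrite mulrN1 opprK.
rewrite (@ge0_continuous_FTC2y _ _ (fun x => - expR (- x)) _ 0).
- by rewrite -EFinB sub0r opprK.
- by move=> x _; exact: expR_ge0.
- apply: continuous_subspaceT => x.
  by apply: continuous_comp; [exact: opp_continuous|exact: continuous_expR].
- by rewrite -oppr0; apply: cvgN; exact: cvgr_expR.
- by move=> x _; case: (dF x).
- apply: cvg_at_right_filter; apply: cvgN.
  by apply: (@continuous_comp _ _ _ -%R expR); [exact: opp_continuous|exact: continuous_expR].
- by move=> x _; case: (dF x) => _ <-; rewrite derive1E.
Qed.
End half_line.

Lemma measurable_fun_boolr {R : realType} d (T : measurableType d) (b : T -> bool) :
  measurable_fun setT b -> measurable_fun setT (fun x => (b x)%:R : R).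
Proof.
move=> mb; rewrite (_ : (fun x => _) = (fun x => if b x then 1 else 0)); last first.
  by apply/funext => x; case: (b x).
exact: measurable_fun_ifT.
Qed.

(** * The Gamma function and Gaussian moments *)

Section Gamma.
Context {R : realType}.
Local Notation leb := (@lebesgue_measure R).
Implicit Types a b c : R.

(** [Gamma] is a real-valued integral, meaningful only once finiteness is known. The recursion is
    therefore proved for the extended-valued integral, and finiteness is deduced from it. *)
Let eGamma a : \bar R :=
  (\int[leb]_(t in `]0%R, +oo[) (t `^ (a - 1) * expR (- t))%:E)%E.

Lemma continuous_expRN c (x : R) : {for x, continuous (fun x => expR (- (c * x)))}.
Proof.
apply: (@continuous_comp _ _ _ (fun x => - (c * x)) expR); last exact: continuous_expR.
by apply: cvgN; apply: cvgM; [exact: cvg_cst|exact: cvg_id].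
Qed.

Lemma continuous_powR_expRN a c (x : R) : 0 < x ->
  {for x, continuous (fun x => x `^ a * expR (- (c * x)))}.
Proof. by move=> x0; apply: cvgM; [exact: continuous_powR_gt0|exact: continuous_expRN]. Qed.

Let m_eGamma a : measurable_fun [set: R] (fun t => t `^ (a - 1) * expR (- t)).
Proof.
apply: measurable_funM; first exact: measurable_powR.
by apply: measurableT_comp => //; exact: measurableT_comp.
Qed.

(** Tonelli for a y^(a-1) exp(-x) on the region 0 < y <= x, in place of an integration by parts:
    integrating first in y gives x^a exp(-x), first in x gives a y^(a-1) exp(-y). *)
Let eGammaS a : 0 < a -> eGamma (a + 1) = (a%:E * eGamma a)%E.
Proof.
move=> a0.
pose f (z : R * R) := (a * z.2 `^ (a - 1) * (expR (- z.1)) *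
  ((0 < z.2) && (z.2 <= z.1))%R%:R)%:E.
have mf : measurable_fun setT f.
  apply/measurable_EFinP; apply: measurable_funM.
    apply: measurable_funM.
      apply: measurable_funM => //.
      by apply: (measurableT_comp (measurable_powR _)); exact: measurable_snd.
    by apply: measurableT_comp => //; exact: measurableT_comp.
  apply: measurable_fun_boolr.
  apply: measurable_and; first exact: measurable_fun_ltr.
  exact: measurable_fun_ler.
have f0 z : (0 <= f z)%E.
  by rewrite lee_fin !mulr_ge0// ?powR_ge0 ?expR_ge0// ltW.
have := fubini_tonelli (m1 := leb) (m2 := leb) f mf f0.
have -> : (\int[leb]_x \int[leb]_y f (x, y) = eGamma (a + 1))%E.
  rewrite /eGamma [RHS]integral_mkcond; apply: eq_integral => t _.
  rewrite patchE mem_setE in_itv/= andbT; case: ifPn => t0.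
    transitivity (\int[leb]_(y in `]0%R, (t : R)]) ((expR (- t))%:E * (a * y `^ (a - 1))%:E))%E.
      rewrite [RHS]integral_mkcond; apply: eq_integral => y _.
      rewrite patchE mem_setE in_itv/= /f/=; case: ifPn => h; rewrite ?mulr0// mulr1.
      by rewrite -EFinM mulrC.
    rewrite ge0_integralZl//.
    - by rewrite integral_powR_itv0// -EFinM addrK mulrC.
    - apply/measurable_EFinP; apply: measurable_funTS; apply: measurable_funM => //.
    - by move=> y _; rewrite lee_fin mulr_ge0 ?powR_ge0// ltW.
  apply: integral0_eq => y _; rewrite /f/= [_ && _](_ : _ = false) ?mulr0//.
  by apply/negP => /andP[y0 yt]; rewrite (lt_le_trans y0 yt) in t0.
move=> ->.
transitivity (\int[leb]_(y in `]0%R, +oo[) (a%:E * (y `^ (a - 1) * expR (- y))%:E))%E; last first.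
  rewrite ge0_integralZl//.
  - by apply/measurable_EFinP; apply: measurable_funTS; exact: m_eGamma.
  - by move=> y _; rewrite lee_fin mulr_ge0 ?powR_ge0// expR_ge0.
  - by rewrite lee_fin ltW.
rewrite [RHS]integral_mkcond; apply: eq_integral => y _.
rewrite patchE mem_setE in_itv/= andbT; case: ifPn => y0.
  transitivity (\int[leb]_(x in `[(y : R), +oo[) ((a * y `^ (a - 1))%:E * (expR (- x))%:E))%E.
    rewrite [RHS]integral_mkcond; apply: eq_integral => x _.
    by rewrite patchE mem_setE in_itv/= /f/= andbT y0/=; case: ifPn; rewrite ?mulr0// mulr1.
  rewrite ge0_integralZl//.
  - by rewrite integral_expR_itvy// -!EFinM mulrA.
  - by apply/measurable_EFinP; apply: measurable_funTS; exact: measurableT_comp.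
  - by rewrite lee_fin mulr_ge0 ?powR_ge0// ltW.
by apply: integral0_eq => x _; rewrite /f/= (negbTE y0)/= mulr0.
Qed.

(** Induction on an integer above [a]. The recursion lowers any a > 1 by one; for a <= 1 the
    integrand is at most t^(a-1) on ]0, 1] and at most exp(-t) beyond 1. *)
Let eGamma_lty a : 0 < a -> (eGamma a < +oo)%E.
Proof.
move=> a0; have [n an] : exists n : nat, a <= n%:R.
  by exists (Num.truncn a).+1; rewrite ltW// truncnS_gt.
elim: n a a0 an => [|n IH] a a0; first by rewrite leNgt a0.
rewrite -natr1 => an; have [a1|a1] := leP a 1; last first.
  have -> : a = (a - 1) + 1 by rewrite subrK.
  rewrite eGammaS ?subr_gt0// -ge0_fin_numE.
    rewrite fin_numM// ge0_fin_numE; first by apply: IH; lra.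
    by apply: integral_ge0 => t _; rewrite lee_fin mulr_ge0 ?powR_ge0// expR_ge0.
  rewrite mule_ge0//; first by rewrite lee_fin; lra.
  by apply: integral_ge0 => t _; rewrite lee_fin mulr_ge0 ?powR_ge0// expR_ge0.
pose g := ((fun t : R => (a^-1 * (a * t `^ (a - 1)))%:E) \_ (`]0%R, 1%R]%classic))%E.
pose h := ((fun t : R => (expR (- t))%:E) \_ (`[1%R, +oo[%classic))%E.
have mg : measurable_fun setT g.
  apply/(measurable_restrictT _ _).1 => //; apply/measurable_EFinP.
  by apply: measurable_funTS; do 2 apply: measurable_funM => //.
have mh : measurable_fun setT h.
  apply/(measurable_restrictT _ _).1 => //; apply/measurable_EFinP.
  by apply: measurable_funTS; exact: measurableT_comp.
have g0 x : (0 <= g x)%E.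
  apply: erestrict_ge0 => t _.
  by rewrite lee_fin !mulr_ge0 ?powR_ge0// ?invr_ge0 ltW.
have h0 x : (0 <= h x)%E by apply: erestrict_ge0 => t _; rewrite lee_fin expR_ge0.
rewrite /eGamma integral_mkcond.
apply: (@le_lt_trans _ _ (\int[leb]_t (g t + h t))%E).
  apply: ge0_le_integral => //.
  - by move=> x _; apply: erestrict_ge0 => t _; rewrite lee_fin mulr_ge0 ?powR_ge0 ?expR_ge0.
  - by apply/(measurable_restrictT _ _).1 => //; apply/measurable_EFinP/measurable_funTS; exact: m_eGamma.
  - exact: emeasurable_funD.
  - move=> t _; rewrite patchE mem_setE in_itv/= andbT; case: ifPn => t0; last first.
      by rewrite adde_ge0.
    have [t1|t1] := leP t 1.
      rewrite -[leLHS]adde0 leeD// /g patchE mem_setE in_itv/= t0 t1/= mulKf ?gt_eqF//.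
      by rewrite lee_fin ler_piMr ?powR_ge0// expR_le1 oppr_le0 ltW.
    rewrite -[leLHS]add0e leeD// /h patchE mem_setE in_itv/= (ltW t1)/=.
    rewrite lee_fin ler_piMl ?expR_ge0// -[leRHS](powRr0 t).
    by apply: ler_powR; [exact: ltW|rewrite subr_le0].
rewrite ge0_integralD// /g /h -!integral_mkcond.
have := integral_expR_itvy 1 => ->.
under eq_integral do rewrite EFinM.
rewrite ge0_integralZl//.
- by rewrite integral_powR_itv0// -EFinM -EFinD ltry.
- by apply/measurable_EFinP/measurable_funTS/measurable_funM.
- by move=> t _; rewrite lee_fin mulr_ge0 ?powR_ge0 ?ltW.
- by rewrite lee_fin invr_ge0 ltW.
Qed.

Lemma GammaE a : 0 < a ->
  (\int[leb]_(t in `]0%R, +oo[) (t `^ (a - 1) * expR (- t))%:E = (Gamma a)%:E)%E.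
Proof.
move=> a0; rewrite /Gamma /Rintegral fineK// ge0_fin_numE; first exact: eGamma_lty.
by apply: integral_ge0 => t _; rewrite lee_fin mulr_ge0 ?powR_ge0 ?expR_ge0.
Qed.

Lemma GammaS a : 0 < a -> Gamma (a + 1) = a * Gamma a.
Proof.
by move=> a0; apply: EFin_inj; rewrite EFinM -!GammaE// ?addr_gt0//; exact: eGammaS.
Qed.

(** On ]0, 1] one has exp(-t) >= exp(-1), which bounds the integral below by exp(-1)/a. *)
Lemma Gamma_gt0 a : 0 < a -> 0 < Gamma a.
Proof.
move=> a0; rewrite -lte_fin -GammaE//.
apply: (@lt_le_trans _ _ (expR (- 1) * a^-1)%:E).
  by rewrite lte_fin mulr_gt0 ?expR_gt0// invr_gt0.
have -> : ((expR (- 1) * a^-1)%:E =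
    \int[leb]_(t in `]0%R, 1%R]) ((expR (- 1) * a^-1)%:E * (a * t `^ (a - 1))%:E))%E.
  rewrite ge0_integralZl//.
  - by rewrite integral_powR_itv0// powR1 mule1.
  - by apply/measurable_EFinP/measurable_funTS/measurable_funM.
  - by move=> t _; rewrite lee_fin mulr_ge0 ?powR_ge0 ?ltW.
  - by rewrite lee_fin mulr_ge0 ?expR_ge0// invr_ge0 ltW.
apply: (@le_trans _ _ (\int[leb]_(t in `]0%R, 1%R]) (t `^ (a - 1) * expR (- t))%:E)%E).
  apply: ge0_le_integral => //.
  - by move=> t _; rewrite -EFinM lee_fin !mulr_ge0 ?powR_ge0 ?expR_ge0 ?invr_ge0 ?ltW.
  - apply/measurable_EFinP/measurable_funTS.
    by do 2 apply: measurable_funM => //.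
  - by apply/measurable_EFinP/measurable_funTS; exact: m_eGamma.
  - move=> t; rewrite /= in_itv/= => /andP[t0 t1].
    rewrite -EFinM lee_fin mulrA divfK ?gt_eqF// mulrC.
    by rewrite ler_wpM2l ?powR_ge0// ler_expR lerN2.
apply: ge0_subset_integral => //.
- by apply/measurable_EFinP/measurable_funTS; exact: m_eGamma.
- by move=> t _; rewrite lee_fin mulr_ge0 ?powR_ge0 ?expR_ge0.
- by move=> t; rewrite /= !in_itv/= andbT => /andP[].
Qed.

Lemma Gamma1 : Gamma 1 = 1 :> R.
Proof.
apply: EFin_inj; rewrite -GammaE//.
have := integral_expR_itvy (0 : R); rewrite oppr0 expR0 => <-.
rewrite -integral_itv_obnd_cbnd; last first.
  by apply/measurable_EFinP/measurable_funTS; exact: measurableT_comp.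
by apply: eq_integral => t _; rewrite subrr powRr0 mul1r.
Qed.

Lemma Gamma_nat n : Gamma (n%:R + 1) = n`!%:R :> R.
Proof.
elim: n => [|n IH]; first by rewrite add0r Gamma1.
by rewrite -natr1 GammaS ?IH// ?factS ?natrM ?natr1// ltr_wpDl.
Qed.

Lemma integral_powR_expR a c : 0 < a -> 0 < c ->
  (\int[leb]_(t in `]0%R, +oo[) (t `^ (a - 1) * expR (- (c * t)))%:E =
   (Gamma a / c `^ a)%:E)%E.
Proof.
move=> a0 c0; rewrite EFinM -GammaE// (@integral_scale _ c (fun t => t `^ (a - 1) * expR (- t)))//.
- rewrite -ge0_integralZr//.
  + apply: eq_integral => t; rewrite inE/= in_itv/= andbT => t0.
    rewrite -EFinM powRM//; try exact: ltW.
    have -> : c `^ a = c `^ (a - 1) * c.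
      by rewrite -[X in _ * X]powRr1 ?ltW// -powRD ?subrK// (gt_eqF c0) implybT.
    have := powR_gt0 (a - 1) c0 => /gt_eqF/negbT cn.
    congr EFin; field.
    by rewrite cn gt_eqF.
  + apply/measurable_EFinP/measurable_funTS; apply: measurable_funM => //.
    apply: measurable_funM; last by apply: measurableT_comp => //; apply: measurableT_comp => //; exact: mulrl_measurable.
    by apply: (measurableT_comp (measurable_powR _)); exact: mulrl_measurable.
  + by move=> t _; rewrite lee_fin !mulr_ge0 ?powR_ge0 ?expR_ge0// ltW.
  + by rewrite lee_fin invr_ge0 powR_ge0.
- move=> x x0; rewrite (_ : (fun t => _) = (fun t => t `^ (a - 1) * expR (- (1 * t)))).
    exact: continuous_powR_expRN.
  by apply/funext => t; rewrite mul1r.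
- by move=> t _; rewrite mulr_ge0 ?powR_ge0 ?expR_ge0.
Qed.

(** Substitution t = s^2. With a = nu + 1 the power 2 a - 1 is the exponent 2 nu + 1 of one factor
    of the density of [laguerre_measure]. *)
Lemma integral_powR_expR_sqr a c : 0 < a -> 0 < c ->
  (\int[leb]_(s in `]0%R, +oo[) (s `^ (2 * a - 1) * expR (- (c * s ^+ 2)))%:E =
   (Gamma a / (2 * c `^ a))%:E)%E.
Proof.
move=> a0 c0.
have -> : Gamma a / (2 * c `^ a) = 2^-1 * (Gamma a / c `^ a).
  have := powR_gt0 a c0 => /gt_eqF/negbT cn; field; by rewrite cn.
rewrite EFinM -integral_powR_expR// (@integral_sqr _ (fun t => t `^ (a - 1) * expR (- (c * t)))).
- rewrite -ge0_integralZl//.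
  + apply: eq_integral => s; rewrite inE/= in_itv/= andbT => s0.
    rewrite -EFinM; congr EFin.
    have -> : s `^ (2 * a - 1) = (s ^+ 2) `^ (a - 1) * s.
      rewrite -powR_mulrn ?(ltW s0)// -powRrM -[X in _ = _ * X]powRr1 ?(ltW s0)//.
      by rewrite -powRD ?(gt_eqF s0) ?implybT//; congr (_ `^ _); lra.
    by field.
  + apply/measurable_EFinP/measurable_funTS; apply: measurable_funM => //.
    apply: measurable_funM.
      by apply: (measurableT_comp (measurable_powR _)); exact: exprn_measurable.
    do 2 apply: measurableT_comp => //; apply: measurable_funM => //.
  + move=> t; rewrite /= in_itv/= andbT => t0.
    by rewrite lee_fin !mulr_ge0 ?powR_ge0 ?expR_ge0// ltW.
- by move=> x; exact: continuous_powR_expRN.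
- by move=> t _; rewrite mulr_ge0 ?powR_ge0 ?expR_ge0.
Qed.

End Gamma.

(** * The Hille-Hardy formula *)

Section psum_integral.
Context d (T : measurableType d) {R : realType} (mu : {measure set T -> \bar R}).

Lemma integral_psum (D : set T) (f : nat -> T -> R) (g : T -> R) : measurable D ->
  (forall n, measurable_fun D (f n)) ->
  (forall x, D x -> psum (fun n => f n x) (g x)) ->
  (\int[mu]_(x in D) (g x)%:E =
   \esum_(n in [set: nat]) \int[mu]_(x in D) (f n x)%:E)%E.
Proof.
move=> mD mf fg.
rewrite -nneseries_esumT; last first.
  by move=> n; apply: integral_ge0 => x /fg[f0 _]; rewrite lee_fin.
rewrite -integral_nneseries//.
- apply: eq_integral => x /[1!inE] /fg[f0 <-].
  by rewrite nneseries_esumT// => n; rewrite lee_fin.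
- by move=> n; exact/measurable_EFinP.
- by move=> n x /fg[f0 _]; rewrite lee_fin.
Qed.

End psum_integral.

Section laguerre_series.
Context {R : realType}.
Local Notation leb := (@lebesgue_measure R).
Implicit Types a r X Y : R.

Local Opaque Gamma.

Definition poch a (n : nat) : R := \prod_(i < n) (a + i%:R).

Lemma poch0 a : poch a 0 = 1. Proof. by rewrite /poch big_ord0. Qed.

Lemma pochSr a n : poch a n.+1 = poch a n * (a + n%:R).
Proof. by rewrite /poch big_ord_recr. Qed.

Lemma pochD a m n : poch a (m + n) = poch a m * poch (a + m%:R) n.
Proof.
elim: n => [|n IH]; first by rewrite addn0 poch0 mulr1.
by rewrite addnS !pochSr IH -mulrA natrD addrA.
Qed.

Lemma pochSl a n : poch a n.+1 = a * poch (a + 1) n.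
Proof. by rewrite -add1n pochD pochSr poch0 mul1r addr0. Qed.

Lemma poch_gt0 a n : 0 < a -> 0 < poch a n.
Proof. by move=> a0; apply: prodr_gt0 => i _; rewrite ltr_wpDr. Qed.

Lemma Gamma_poch a n : 0 < a -> Gamma (a + n%:R) = poch a n * Gamma a.
Proof.
move=> a0; elim: n => [|n IH]; first by rewrite addr0 poch0 mul1r.
rewrite -[n.+1%:R]natr1 addrA GammaS; last by rewrite ltr_wpDr.
by rewrite IH pochSr mulrA [(a + _) * _]mulrC.
Qed.

(** A lower bound uniform in [n], used to dominate the series of [Ea] by an exponential series: past
    the first factor [a], all factors are at least 1. *)
Lemma poch_ge a n : 0 < a -> Num.min a 1 <= poch a n.
Proof.
move=> a0; case: n => [|n]; first by rewrite poch0 ge_min lexx orbT.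
rewrite pochSl ge_min -[leLHS]mulr1 ler_pM2l//; apply/orP; left.
elim: n => [|n IH]; first by rewrite poch0.
rewrite pochSr; apply: mulr_ege1 => //.
by rewrite addrAC lerDr addr_ge0// ltW.
Qed.

(** The Gamma integral of t^(a-1) exp(-(1 - r) t), in which exp(r t) is expanded and integrated term
    by term; Gamma(a + n) = (a)_n Gamma(a) produces the coefficients. *)
Lemma psum_binomial a r : 0 < a -> 0 <= r < 1 ->
  psum (fun n => poch a n / n`!%:R * r ^+ n) ((1 - r) `^ (- a)).
Proof.
move=> a0 /andP[r0 r1]; have G0 := Gamma_gt0 a0.
suff : psum (fun n => Gamma a * (poch a n / n`!%:R * r ^+ n)) (Gamma a / (1 - r) `^ a).
  move=> h; rewrite powRN -[X in psum _ X](mulKf (lt0r_neq0 G0)).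
  by apply: eq_psum (psumZ _ h) => [n|]; rewrite ?invr_ge0 ?(ltW G0)// mulKf// gt_eqF.
pose f n t : R := t `^ (a - 1) * expR (- t) * ((r * t) ^+ n / n`!%:R).
have mf n : measurable_fun (`]0, +oo[%classic : set R) (f n).
  apply: measurable_funTS; apply: measurable_funM; apply: measurable_funM => //.
    by apply: measurableT_comp => //; exact: measurableT_comp.
  by apply: measurable_funX; exact: mulrl_measurable.
have E := @integral_psum _ _ _ leb `]0, +oo[ f
  (fun t => t `^ (a - 1) * expR (- ((1 - r) * t))) _ mf _.
split=> [n|]; first by rewrite !mulr_ge0 ?invr_ge0 ?exprn_ge0// ltW// poch_gt0.
rewrite -integral_powR_expR ?subr_gt0// E//.
  apply: eq_esum => n _; rewrite /f.
  have an0 : 0 < a + n%:R by rewrite ltr_wpDr.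
  transitivity (\int[leb]_(x in `]0%R, +oo[)
     ((r ^+ n / n`!%:R)%:E * (x `^ (a + n%:R - 1) * expR (- x))%:E))%E.
    rewrite ge0_integralZl//.
    - by rewrite GammaE// Gamma_poch// -EFinM; congr EFin; ring.
    - apply/measurable_EFinP/measurable_funTS; apply: measurable_funM => //.
      by apply: measurableT_comp => //; exact: measurableT_comp.
    - by move=> t _; rewrite lee_fin mulr_ge0 ?powR_ge0 ?expR_ge0.
    - by rewrite lee_fin divr_ge0// exprn_ge0.
  apply: eq_integral => t; rewrite inE/= in_itv/= andbT => t0.
  rewrite -EFinM; congr EFin.
  have -> : a + n%:R - 1 = (a - 1) + n%:R by ring.
  rewrite powRD ?(gt_eqF t0) ?implybT// powR_mulrn ?(ltW t0)// exprMn; ring.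
move=> t; rewrite /= in_itv/= andbT => t0.
have -> : t `^ (a - 1) * expR (- ((1 - r) * t)) =
    t `^ (a - 1) * expR (- t) * expR (r * t).
  by rewrite -mulrA -expRD; congr (_ * expR _); ring.
apply: psumZ; first by rewrite mulr_ge0 ?powR_ge0 ?expR_ge0.
apply: hsum_psum (hsum_exp _) => i.
by rewrite divr_ge0// exprn_ge0// mulr_ge0// ltW.
Qed.

(* L_k^(a-1): the order is shifted so that the hypothesis reads [0 < a]. *)
Definition Lag a (k : nat) X : R :=
  \sum_(j < k.+1) (- X) ^+ j * (poch (a + j%:R) (k - j) / ((k - j)`!%:R * j`!%:R)).

Lemma Lag0 a X : Lag a 0 X = 1.
Proof. by rewrite /Lag big_ord1 /= subnn poch0 fact0 expr0 mul1r mulr1 divr1. Qed.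

(** The coefficients alternate in sign, so the right side is the sum of the absolute values of the
    terms on the left. It is the majorant for the rearrangements that follow. *)
Lemma ler_norm_Lag a k X : 0 < a -> `|Lag a k X| <= Lag a k (- `|X|).
Proof.
move=> a0; apply: le_trans (ler_norm_sum _ _ _) _; apply: ler_sum => j _.
have c0 : 0 <= poch (a + j%:R) (k - j) / ((k - j)`!%:R * j`!%:R).
  by rewrite divr_ge0 ?mulr_ge0// ltW// poch_gt0// ltr_wpDr.
by rewrite opprK normrM normrX normrN (ger0_norm c0).
Qed.

Lemma Lag_ge0 a k X : 0 < a -> X <= 0 -> 0 <= Lag a k X.
Proof.
move=> a0 X0; have := ler_norm_Lag k X a0.
by rewrite (ler0_norm X0) opprK; apply: le_trans.
Qed.

(** Comparison of the coefficients of each power of X, the extreme powers 0 and k + 1 being split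
    off. This contiguous relation drives the induction on [l] in [hsum_Lag]. *)
Lemma LagS a k X :
  k.+1%:R * Lag a k.+1 X = a * Lag (a + 1) k X - X * Lag (a + 2) k X.
Proof.
rewrite /Lag big_ord_recl big_ord_recr/= [in RHS]big_ord_recl/=.
rewrite [X in _ - _ * X]big_ord_recr/= !mulrDr opprD !addrA -[X in _ = X + _]addrA.
have F n : n`!%:R != 0 :> R by rewrite pnatr_eq0 -lt0n fact_gt0.
have FS n : n.+1`!%:R = n.+1%:R * n`!%:R :> R by rewrite factS natrM.
have N n : n.+1%:R != 0 :> R by rewrite pnatr_eq0.
congr (_ + _ + _).
- by rewrite !subn0 !addr0 pochSl FS fact0 !expr0; rewrite -!natr1; field; rewrite F natr1 N.
- rewrite !mulr_sumr -sumrN -big_split/=; apply: eq_bigr => j _.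
  move: (ltn_ord j); move: (nat_of_ord j) => {}j jk.
  have [m ->] : exists m, k = (j.+1 + m)%N by exists (k - j.+1)%N; rewrite subnKC.
  rewrite /bump/= !add1n subSS.
  have -> : (j.+1 + m - j)%N = m.+1 by rewrite addSnnS addKn.
  rewrite addKn pochSl pochSr !FS exprS.
  have -> : a + 1 + 1 + j%:R = a + j.+1%:R + 1 by rewrite -natr1; ring.
  have -> : a + 1 + j.+1%:R = a + j.+1%:R + 1 by ring.
  rewrite -?natr1 ?natrD -?natr1; field.
  by rewrite !F !natr1 !N.
- rewrite /bump/= !add1n !subnn !poch0 FS fact0 exprS -!natr1; field.
  by rewrite F natr1 N.
Qed.

Lemma powRN_natD r a n : 0 < r -> r `^ (- (a + n%:R)) = r `^ (- a) * (r^-1) ^+ n.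
Proof.
move=> r0; rewrite opprD powRD ?(gt_eqF r0) ?implybT//; congr (_ * _).
by rewrite powR_invn ?ltW// exprVn.
Qed.

(** The generating function of the Laguerre polynomials, from a double family whose rows are
    binomial series of order a + j, whose row sums form an exponential series and whose diagonals
    are the r^k L_k. At -|X| all its terms are nonnegative, which gives absolute convergence. *)
Lemma hsum_Lag0 a r X : 0 < a -> 0 <= r < 1 ->
  hsum (fun k => r ^+ k * Lag a k X) ((1 - r) `^ (- a) * expR (- (r * X / (1 - r)))).
Proof.
move=> a0 r01; have /andP[r0 r1] := r01; have r10 : 0 < 1 - r by rewrite subr_gt0.
pose u X (x : nat * nat) :=
  (- X) ^+ x.1 / x.1`!%:R * r ^+ x.1 * (poch (a + x.1%:R) x.2 / x.2`!%:R * r ^+ x.2).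
pose v X j := (1 - r) `^ (- a) * ((- (r * X / (1 - r))) ^+ j / j`!%:R).
have uv Z j : hsum (fun n => u Z (j, n)) (v Z j).
  have /psum_hsum/(hsumZ ((- Z) ^+ j / j`!%:R * r ^+ j)) :=
    @psum_binomial (a + j%:R) r (ltr_wpDr (ler0n _ _) a0) r01.
  rewrite powRN_natD//; congr hsum; rewrite /v -mulNr -mulrN !exprMn; ring.
have vs Z : hsum (v Z) ((1 - r) `^ (- a) * expR (- (r * Z / (1 - r)))).
  exact: hsumZ (hsum_exp _).
have u0 x : 0 <= u (- `|X|) x.
  rewrite /u opprK !mulr_ge0 ?invr_ge0 ?exprn_ge0// ltW// poch_gt0// ltr_wpDr//.
have /hsum_psum pv := vs (- `|X|).
have : psum (u (- `|X|)) ((1 - r) `^ (- a) * expR (- (r * - `|X| / (1 - r)))).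
  apply/(psum_pair (v := v (- `|X|))); last first.
    by apply: pv => j; rewrite /v mulr_ge0 ?powR_ge0// divr_ge0// exprn_ge0// mulrN mulNr opprK !mulr_ge0// invr_ge0 ltW.
  by move=> j; apply: hsum_psum (uv _ _) => n; exact: u0.
move=> /(eq_psum (v := fun x => `|u X x|)) => uC.
have [|s us /(hsum_uniq (vs X)) ->] := hsum_pair (uC _) (uv X).
  move=> [j n]; have h : 0 <= poch (a + j%:R) n / n`!%:R * r ^+ n.
    by rewrite !mulr_ge0 ?invr_ge0 ?exprn_ge0// ltW// poch_gt0// ltr_wpDr.
  rewrite /u/= opprK [in RHS]normrM (ger0_norm h) !normrM !normrX normrN normfV normr_nat.
  by rewrite (ger0_norm r0).
apply: eq_hsum (hsum_diag us) => k; rewrite /u/Lag mulr_sumr; apply: eq_bigr => j _ /=.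
have jk : (j <= k)%N by rewrite -ltnS.
have -> : r ^+ k = r ^+ j * r ^+ (k - j) by rewrite -exprD subnKC.
rewrite invfM; ring.
Qed.

(** This is r^l / l! times the l-th derivative in r of the generating function. The induction on
    [l], with [LagS] and (k + 1) C(k, l) = (l + 1) C(k + 1, l + 1), stands in for
    differentiation. *)
Lemma hsum_Lag l a r X : 0 < a -> 0 <= r < 1 ->
  hsum (fun k => 'C(k, l)%:R * r ^+ k * Lag a k X)
    (r ^+ l * (1 - r) `^ (- (a + l%:R)) * expR (- (r * X / (1 - r))) * Lag a l (X / (1 - r))).
Proof.
move=> + r01; have /andP[r0 r1] := r01; have r10 : 0 < 1 - r by rewrite subr_gt0.
elim: l a => [|l IH] a a0.
  rewrite Lag0 expr0 mul1r addr0 mulr1.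
  by apply: eq_hsum (hsum_Lag0 X a0 r01) => k; rewrite bin0 mul1r.
have N n : n.+1%:R != 0 :> R by rewrite pnatr_eq0.
have h1 := hsumZ (r * a / l.+1%:R) (IH (a + 1) (ltr_wpDr ler01 a0)).
have h2 := hsumZ (- (r * X / l.+1%:R)) (IH (a + 2) (ltr_wpDr (ler0n _ _) a0)).
have := hsumD h1 h2; set s := (X in hsum _ X) => h.
(* The term k = 0 vanishes since C(0, l + 1) = 0, so the index can be shifted by one, as [LagS]
   requires. *)
apply/(hsum_inj (f := S)).
- by move=> i j [].
- by case=> [_|k []]; [rewrite bin0n !mul0r|exists k].
suff <- : s = r ^+ l.+1 * (1 - r) `^ (- (a + l.+1%:R)) *
    expR (- (r * X / (1 - r))) * Lag a l.+1 (X / (1 - r)).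
  apply: eq_hsum h => k.
  have /(congr1 (fun n => n%:R : R)) := mul_bin_diag k.+1 l; rewrite !natrM => hb.
  have -> : 'C(k.+1, l.+1)%:R = k.+1%:R * 'C(k, l)%:R / l.+1%:R :> R.
    by rewrite [_.+1%:R * _]hb mulrAC mulfV// mul1r.
  transitivity (r * 'C(k, l)%:R * r ^+ k / l.+1%:R * (a * Lag (a + 1) k X - X * Lag (a + 2) k X)).
    by ring.
  by rewrite -LagS exprS; ring.
have : Lag a l.+1 (X / (1 - r)) = l.+1%:R^-1 *
    (a * Lag (a + 1) l (X / (1 - r)) - X / (1 - r) * Lag (a + 2) l (X / (1 - r))).
  by rewrite -LagS mulKf.
have e1 : a + 1 + l%:R = a + l.+1%:R by rewrite -[l.+1%:R]natr1; ring.
have e2 : a + 2 + l%:R = a + l.+2%:R by rewrite -[l.+2%:R]natr1 -[l.+1%:R]natr1; ring.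
move=> ->; rewrite /s e1 e2 !powRN_natD// !exprS; field.
by rewrite gt_eqF//= addrC natr1.
Qed.

(* Gamma(a) z^((1-a)/2) I_(a-1)(2 sqrt z), with I the modified Bessel function. *)
Definition Ea a (z : R) : R := rsum (fun m => z ^+ m / (m`!%:R * poch a m)).

Lemma hsum_Ea a z : 0 < a -> hsum (fun m => z ^+ m / (m`!%:R * poch a m)) (Ea a z).
Proof.
move=> a0; have c0 : 0 < Num.min a 1 by rewrite lt_min a0 ltr01.
suff [s hs] : exists s, hsum (fun m => z ^+ m / (m`!%:R * poch a m)) s.
  by rewrite /Ea (hsum_rsum hs).
have E : psum (fun n => `|z| ^+ n / n`!%:R) (expR `|z|).
  by apply: hsum_psum (hsum_exp _) => i; rewrite divr_ge0// exprn_ge0.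
apply: hsum_dom (psumZ (c := (Num.min a 1)^-1) _ E) => [m|]; last by rewrite invr_ge0 ltW.
rewrite normrM normrX normfV normrM normr_nat (gtr0_norm (poch_gt0 m a0)).
rewrite invfM mulrA [leRHS]mulrC ler_wpM2l ?divr_ge0 ?exprn_ge0//.
by rewrite lef_pV2 ?posrE ?poch_gt0// poch_ge.
Qed.

(** A second generating function, with weights 1/(a)_l: its terms are the diagonals of the product
    of the series of Ea(-xi w) and of exp(w). *)
Lemma hsum_Lag_poch a w xi : 0 < a ->
  hsum (fun l => w ^+ l / poch a l * Lag a l xi) (expR w * Ea a (- (xi * w))).
Proof.
move=> a0; have := hsum_diag (hsum_mul (hsum_Ea (- (xi * w)) a0) (hsum_exp w)).
rewrite [expR w * _]mulrC; apply: eq_hsum => l /=.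
rewrite /Lag mulr_sumr; apply: eq_bigr => j _.
have jl : (j <= l)%N by rewrite -ltnS.
have -> : w ^+ l = w ^+ j * w ^+ (l - j) by rewrite -exprD subnKC.
have -> : poch a l = poch a j * poch (a + j%:R) (l - j) by rewrite -pochD subnKC.
rewrite -mulNr exprMn; field.
by rewrite !gt_eqF ?poch_gt0 ?ltr_wpDr// ltr0n fact_gt0.
Qed.

(** The left side is the terminating series 1F1(-k; a; Y). In this form k enters through C(k, l)
    only, which is what [hsum_Lag] sums over k. *)
Lemma sum_bin_poch a k Y : 0 < a ->
  \sum_(l < k.+1) 'C(k, l)%:R * (- Y) ^+ l / poch a l = k`!%:R / poch a k * Lag a k Y.
Proof.
move=> a0; rewrite /Lag mulr_sumr; apply: eq_bigr => j _.
have jk : (j <= k)%N by rewrite -ltnS.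
have -> : poch a k = poch a j * poch (a + j%:R) (k - j) by rewrite -pochD subnKC.
rewrite -(bin_fact jk) !natrM; field.
by rewrite !gt_eqF ?poch_gt0 ?ltr_wpDr// ltr0n fact_gt0.
Qed.

(** L_k(Y) is expanded by [sum_bin_poch] and the sums over k and l are exchanged. The inner sum over
    k is [hsum_Lag]; the outer sum over l is [hsum_Lag_poch] with w = -r Y/(1 - r) and xi = X/(1 -
    r), so that -xi w is the argument of [Ea]. *)
Theorem hille_hardy a r X Y : 0 < a -> 0 <= r < 1 ->
  hsum (fun k => r ^+ k * (k`!%:R / poch a k) * Lag a k X * Lag a k Y)
    ((1 - r) `^ (- a) * expR (- (r * (X + Y) / (1 - r))) * Ea a (r * (X * Y) / (1 - r) ^+ 2)).
Proof.
move=> a0 r01; have /andP[r0 r1] := r01; have r10 : 0 < 1 - r by rewrite subr_gt0.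
pose u X Y (x : nat * nat) :=
  (- Y) ^+ x.1 / poch a x.1 * ('C(x.2, x.1)%:R * r ^+ x.2 * Lag a x.2 X).
pose c X := (1 - r) `^ (- a) * expR (- (r * X / (1 - r))).
pose v X Y l := c X * ((- (r * Y / (1 - r))) ^+ l / poch a l * Lag a l (X / (1 - r))).
have uv X' Y' l : hsum (fun k => u X' Y' (l, k)) (v X' Y' l).
  have := hsumZ ((- Y') ^+ l / poch a l) (hsum_Lag l X' a0 r01).
  congr hsum; rewrite powRN_natD// /v /c.
  have -> : - (r * Y' / (1 - r)) = - Y' * r * (1 - r)^-1 by ring.
  by rewrite !exprMn; ring.
have vs X' Y' : hsum (v X' Y') (c X' * (expR (- (r * Y' / (1 - r))) *
     Ea a (r * (X' * Y') / (1 - r) ^+ 2))).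
  have -> : r * (X' * Y') / (1 - r) ^+ 2 = - (X' / (1 - r) * - (r * Y' / (1 - r))).
    by field; rewrite gt_eqF.
  exact: hsumZ (hsum_Lag_poch _ _ a0).
have u0 x : 0 <= u (- `|X|) (- `|Y|) x.
  rewrite /u opprK; apply: mulr_ge0; last by rewrite !mulr_ge0 ?exprn_ge0// Lag_ge0// oppr_le0.
  by rewrite divr_ge0 ?exprn_ge0// ltW// poch_gt0.
have v0 l : 0 <= v (- `|X|) (- `|Y|) l.
  rewrite /v /c mulr_ge0//; first by rewrite mulr_ge0 ?powR_ge0 ?expR_ge0.
  rewrite mulr_ge0// ?Lag_ge0// ?mulNr ?oppr_le0 ?divr_ge0// ?(ltW r10)//.
  by rewrite exprn_ge0// mulrN mulNr opprK !mulr_ge0// invr_ge0 ltW.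
  by rewrite ltW// poch_gt0.
(* At -|X| and -|Y| the terms and the row sums are nonnegative, with the same closed forms for their
   sums, and they dominate the family at X and Y. *)
have [C uC] : exists C, psum (fun x => `|u X Y x|) C.
  have [S h] : exists S, psum (u (- `|X|) (- `|Y|)) S.
    eexists; apply/(psum_pair (v := v (- `|X|) (- `|Y|))); last exact: hsum_psum v0 (vs _ _).
    by move=> l; apply: hsum_psum (uv _ _ _) => k; exact: u0.
  have [|C uC _] := psum_dom (u := fun x => `|u X Y x|) _ h; last by exists C.
  move=> [l k]; rewrite normr_ge0/= /u/= opprK !normrM !normrX normrN normfV normr_nat.
  rewrite (ger0_norm r0) (gtr0_norm (poch_gt0 l a0)) ler_wpM2l ?mulr_ge0 ?exprn_ge0 ?invr_ge0 ?(ltW (poch_gt0 l a0))//.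
  by rewrite ler_wpM2l ?mulr_ge0 ?exprn_ge0// ler_norm_Lag.
have -> : (1 - r) `^ (- a) * expR (- (r * (X + Y) / (1 - r))) * Ea a (r * (X * Y) / (1 - r) ^+ 2) =
    c X * (expR (- (r * Y / (1 - r))) * Ea a (r * (X * Y) / (1 - r) ^+ 2)).
  rewrite /c mulrDr mulrDl opprD expRD; ring.
apply: (hsum_swap uC (uv X Y) _ (vs X Y)) => k.
have -> : r ^+ k * (k`!%:R / poch a k) * Lag a k X * Lag a k Y =
    \sum_(l < k.+1) u X Y (l : nat, k).
  transitivity (r ^+ k * Lag a k X * (k`!%:R / poch a k * Lag a k Y)); first by ring.
  rewrite -sum_bin_poch// mulr_sumr; apply: eq_bigr => l _; rewrite /u/=; ring.
apply: (@hsum_fin _ (fun l => u X Y (l, k))) => l kl.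
by rewrite /u/= bin_small// !mul0r mulr0.
Qed.

End laguerre_series.

(** * The one-dimensional heat kernel *)

Section heat1.
Context {R : realType}.
Local Notation leb := (@lebesgue_measure R).
Local Opaque Gamma.
Implicit Types nu a t x y : R.

Lemma powR_expR x y : expR x `^ y = expR (y * x).
Proof. by rewrite /powR gt_eqF ?expR_gt0// expRK. Qed.

Lemma powRV x b : 0 <= x -> x^-1 `^ b = x `^ (- b).
Proof. by move=> x0; rewrite -(powR_inv1 x0) -powRrM mulN1r. Qed.

Lemma powRD_natr x b n : 0 < x -> x `^ (b + n%:R) = x `^ b * x ^+ n.
Proof. by move=> x0; rewrite powRD ?(gt_eqF x0) ?implybT// powR_mulrn// ltW. Qed.

Lemma horner_laguerre_poly nu m X : (laguerre_poly nu m).[X] = Lag (nu + 1) m X.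
Proof.
rewrite /laguerre_poly horner_poly /Lag; apply: eq_bigr => j _.
have jm : (j <= m)%N by rewrite -ltnS.
have -> : \prod_(j <= i < m) (nu + i.+1%:R) = poch (nu + 1 + j%:R) (m - j).
  rewrite -{1}[j : nat]add0n big_addn big_mkord; apply: eq_bigr => i _.
  by rewrite -natr1 natrD; ring.
have -> : (- X) ^+ j = (-1) ^+ j * X ^+ j by rewrite -exprMn mulN1r.
ring.
Qed.

(** The square of the normalizing factor of [laguerre_fun1], with a = nu + 1 and Gamma(k + a)
    written as (a)_k Gamma(a). *)
Definition lnorm a (k : nat) : R := 2 * k`!%:R / (Gamma a * poch a k).

Lemma lnorm_gt0 a k : 0 < a -> 0 < lnorm a k.
Proof.
move=> a0; rewrite divr_gt0 ?mulr_gt0 ?Gamma_gt0 ?poch_gt0//.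
Qed.

Lemma laguerre_fun1E nu k x : 0 < nu + 1 ->
  laguerre_fun1 nu k x =
  Num.sqrt (lnorm (nu + 1) k) * Lag (nu + 1) k (x ^+ 2) * expR (- (x ^+ 2 / 2)).
Proof.
move=> a0; rewrite /laguerre_fun1 horner_laguerre_poly Gamma_nat.
have -> : k%:R + nu + 1 = nu + 1 + k%:R by ring.
by rewrite Gamma_poch// [poch _ _ * _]mulrC.
Qed.

Lemma mul_laguerre_fun1 nu k x y : 0 < nu + 1 ->
  laguerre_fun1 nu k x * laguerre_fun1 nu k y = lnorm (nu + 1) k *
    (Lag (nu + 1) k (x ^+ 2) * Lag (nu + 1) k (y ^+ 2)) * expR (- ((x ^+ 2 + y ^+ 2) / 2)).
Proof.
move=> a0; rewrite !laguerre_fun1E//.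
rewrite mulrDl opprD expRD -[X in _ = X * _ * _]sqr_sqrtr ?(ltW (lnorm_gt0 _ _))//; ring.
Qed.

(* With r = e^(-4t): coth(2t)/2 = (1 + r)/(2(1 - r)) and 1/(2 sinh 2t) = e^(-2t)/(1 - r). *)
Definition heat1 nu t x y : R :=
  let a := nu + 1 in let r := expR (- (4 * t)) in
  2 / Gamma a * (expR (- (2 * t)) / (1 - r)) `^ a *
  expR (- ((1 + r) / (2 * (1 - r)) * (x ^+ 2 + y ^+ 2))) *
  Ea a (r * (x ^+ 2 * y ^+ 2) / (1 - r) ^+ 2).

Definition eigen1 nu (k : nat) : R := 4 * k%:R + 2 * nu + 2.

Lemma expR4_lt1 t : 0 < t -> 0 <= expR (- (4 * t)) < 1.
Proof. by move=> t0; rewrite expR_ge0/= expR_lt1 oppr_lt0 mulr_gt0. Qed.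

(** Hille-Hardy at r = exp(-4 t), X = x^2, Y = y^2. The factor exp(-(x^2 + y^2)/2) of the Laguerre
    functions joins the exponent -r (x^2 + y^2)/(1 - r) and produces the coefficient (1 + r)/(2 (1 -
    r)). *)
Lemma hsum_heat1 nu t x y : 0 < nu + 1 -> 0 < t ->
  hsum (fun k => expR (- t * eigen1 nu k) * (laguerre_fun1 nu k x * laguerre_fun1 nu k y))
    (heat1 nu t x y).
Proof.
move=> a0 t0; have r01 := expR4_lt1 t0; have /andP[r0 r1] := r01.
have G0 := Gamma_gt0 a0.
have := hsumZ (2 / Gamma (nu + 1) * expR (- (2 * (nu + 1) * t)) * expR (- ((x ^+ 2 + y ^+ 2) / 2)))
  (hille_hardy (x ^+ 2) (y ^+ 2) a0 r01).
set r := expR (- (4 * t)) in r01 r0 r1 *.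
have r10 : 0 < 1 - r by rewrite subr_gt0.
set S := (X in hsum _ X); have -> : S = heat1 nu t x y.
  rewrite /S /heat1 -/r powRM ?expR_ge0// ?invr_ge0 ?(ltW r10)//.
  rewrite (powRV _ (ltW r10)) powR_expR.
  have -> : - (2 * (nu + 1) * t) = (nu + 1) * - (2 * t) by ring.
  have -> : - ((1 + r) / (2 * (1 - r)) * (x ^+ 2 + y ^+ 2)) =
      - ((x ^+ 2 + y ^+ 2) / 2) + - (r * (x ^+ 2 + y ^+ 2) / (1 - r)).
    by field; rewrite gt_eqF.
  by rewrite expRD; ring.
apply: eq_hsum => k; rewrite mul_laguerre_fun1//.
have -> : - t * eigen1 nu k = - (2 * (nu + 1) * t) + (- (4 * t)) * k%:R.
  by rewrite /eigen1; ring.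
rewrite expRD expRM_natr -/r /lnorm invfM; ring.
Qed.

Lemma Ea_ge0 a w : 0 < a -> 0 <= w -> 0 <= Ea a w.
Proof.
move=> a0 w0; apply: psum_sum_ge0 (hsum_psum _ (hsum_Ea w a0)) => m.
by rewrite divr_ge0 ?exprn_ge0// mulr_ge0// ltW// poch_gt0.
Qed.

Lemma heat1_ge0 nu t x y : 0 < nu + 1 -> 0 <= heat1 nu t x y.
Proof.
move=> a0; have G0 := Gamma_gt0 a0; rewrite /heat1 !mulr_ge0 ?expR_ge0 ?powR_ge0 ?invr_ge0 ?(ltW G0)//.
rewrite Ea_ge0// divr_ge0 ?exprn_even_ge0//.
by rewrite mulr_ge0 ?expR_ge0// mulr_ge0 ?sqr_ge0.
Qed.

(* The only place where [- 2^-1 <= nu] is needed: it makes [Ea a w] at most the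
   even part of [expR (2 * Num.sqrt w)]. *)
Lemma fact_double_le a m : 2^-1 <= a -> (m.*2)`!%:R <= 4 ^+ m * (m`!%:R * poch a m).
Proof.
move=> a2; have a0 : 0 < a by apply: lt_le_trans a2.
elim: m => [|m IH]; first by rewrite poch0 expr0 !mulr1.
rewrite doubleS !factS !natrM pochSr exprS.
have -> : 4 * 4 ^+ m * (m.+1%:R * m`!%:R * (poch a m * (a + m%:R))) =
   (4 * m.+1%:R * (a + m%:R)) * (4 ^+ m * (m`!%:R * poch a m)) by ring.
rewrite mulrA; apply: ler_pM => //.
(* What remains, (2 m + 2)(2 m + 1) <= 4 (m + 1)(a + m), amounts to 1/2 <= a. *)
rewrite -!natr1 -mul2n natrM.
have : 0 <= m%:R :> R by []. 
nra.
Qed.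

Lemma Ea_le a w : 2^-1 <= a -> 0 <= w -> Ea a w <= expR (2 * Num.sqrt w).
Proof.
move=> a2 w0; have a0 : 0 < a by apply: lt_le_trans a2.
set z := 2 * Num.sqrt w.
have z0 : 0 <= z by rewrite mulr_ge0// sqrtr_ge0.
have pz : psum (fun n => z ^+ n / n`!%:R) (expR z).
  by apply: hsum_psum (hsum_exp z) => i; rewrite divr_ge0// exprn_ge0.
(* The odd terms of the exponential series are replaced by 0, so that the even ones can be reindexed
   along doubling. *)
have [n|s us sz] := @psum_dom _ _ (fun n => if odd n then 0 else z ^+ n / n`!%:R) _ _ _ pz.
  by case: ifPn => _; rewrite ?lexx ?andbT divr_ge0// exprn_ge0.
apply: le_trans sz.
have : psum (fun m => z ^+ m.*2 / (m.*2)`!%:R) s.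
  apply: (eq_psum (u := fun m => (fun n => if odd n then 0 else z ^+ n / n`!%:R) m.*2)).
    by move=> m; rewrite odd_double.
  apply/(psum_inj (u := fun n => if odd n then 0 else z ^+ n / n`!%:R) _ double_inj) => // n nr.
  case: ifPn => // ne; exfalso; apply: nr; exists n./2 => //.
  by rewrite halfK (negbTE ne) subn0.
move=> h; have [m|s' us' s's] := @psum_dom _ _ (fun m => w ^+ m / (m`!%:R * poch a m)) _ _ _ h.
  rewrite divr_ge0 ?exprn_ge0 ?mulr_ge0 ?(ltW (poch_gt0 m a0))//=.
  rewrite ler_pdivrMr ?mulr_gt0 ?poch_gt0 ?ltr0n ?fact_gt0//.
  rewrite mulrAC ler_pdivlMr ?ltr0n ?fact_gt0//.
  rewrite /z exprMn -!mul2n !exprM sqr_sqrtr//.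
  rewrite -[_ * w ^+ m * _]mulrA [w ^+ m * _]mulrC mulrA mulrC.
  have -> : 2 ^+ 2 = 4 :> R by ring.
  by rewrite ler_wpM2r ?exprn_ge0// mul2n fact_double_le.
by rewrite (hsum_uniq (hsum_Ea w a0) (psum_hsum us')).
Qed.

(** The growth exp(2 sqrt(r) |x y|/(1 - r)) allowed by [Ea_le] is absorbed by the Gaussian factor,
    because 4 sqrt(r) |x y| <= (1 + r)(x^2 + y^2). What is left is a power of 1/(2 sinh 2t), which
    is at most 1/t. *)
Lemma heat1_le nu t x y : 2^-1 <= nu + 1 -> 0 < t ->
  heat1 nu t x y <= 2 / Gamma (nu + 1) * t `^ (- (nu + 1)).
Proof.
move=> a2 t0; have a0 : 0 < nu + 1 by apply: lt_le_trans a2.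
have G0 := Gamma_gt0 a0; have /andP[r0 r1] := expR4_lt1 t0.
rewrite /heat1; set r := expR (- (4 * t)) in r0 r1 *.
set s := expR (- (2 * t)); set a := nu + 1 in a2 a0 G0 *.
have rs : r = s ^+ 2 by rewrite /r /s expr2 -expRD; congr expR; ring.
have s0 : 0 < s by exact: expR_gt0.
have r10 : 0 < 1 - r by rewrite subr_gt0.
have s1 : s < 1 by rewrite /s expR_lt1 oppr_lt0 mulr_gt0.
(* From exp(2 t) >= 1 + 2 t follows 2 t s <= 1 - s, hence t s <= 1 - s^2. *)
have E1 : s / (1 - r) <= t^-1.
  rewrite ler_pdivrMr// ler_pdivlMl//.
  have : 1 + 2 * t <= expR (2 * t) by exact: expR_ge1Dx.
  have : expR (2 * t) * s = 1 by rewrite /s -expRD subrr expR0.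
  rewrite rs; set e := expR _ => es e1. nra.
rewrite -2!mulrA ler_wpM2l ?divr_ge0 ?(ltW G0)//.
rewrite -[leRHS]mulr1 ler_pM ?powR_ge0//.
- by rewrite mulr_ge0 ?expR_ge0// Ea_ge0// divr_ge0 ?sqr_ge0// mulr_ge0// mulr_ge0 ?sqr_ge0.
- rewrite -(powRV _ (ltW t0)).
  by rewrite ge0_ler_powR// ?nnegrE ?invr_ge0 ?divr_ge0 ?ltW.
- apply: le_trans (_ : expR (- ((1 + r) / (2 * (1 - r)) * (x ^+ 2 + y ^+ 2))) *
     expR (2 * Num.sqrt (r * (x ^+ 2 * y ^+ 2) / (1 - r) ^+ 2)) <= _).
    by rewrite ler_wpM2l ?expR_ge0// Ea_le// divr_ge0 ?sqr_ge0// mulr_ge0// mulr_ge0 ?sqr_ge0.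
  rewrite -expRD expR_le1.
  have -> : r * (x ^+ 2 * y ^+ 2) / (1 - r) ^+ 2 = (s * (x * y) / (1 - r)) ^+ 2.
    by rewrite rs; field; rewrite -rs gt_eqF.
  rewrite sqrtr_sqr normrM normfV (gtr0_norm r10) normrM (gtr0_norm s0).
  rewrite addrC subr_le0 -subr_ge0.
  have h : `|x * y| * 2 <= x ^+ 2 + y ^+ 2.
    rewrite normrM -(real_normK (num_real x)) -(real_normK (num_real y)).
    have := sqr_ge0 (`|x| - `|y|); rewrite sqrrB; lra.
  have -> : (1 + r) / (2 * (1 - r)) * (x ^+ 2 + y ^+ 2) - 2 * (s * `|x * y| / (1 - r)) =
     ((1 + r) * (x ^+ 2 + y ^+ 2) - 2 * s * (`|x * y| * 2)) / (2 * (1 - r)).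
    by field; rewrite gt_eqF.
  rewrite divr_ge0 ?mulr_ge0 ?(ltW r10)// subr_ge0.
  apply: (@le_trans _ _ (2 * s * (x ^+ 2 + y ^+ 2))); first by rewrite ler_wpM2l// mulr_ge0// ltW.
  rewrite ler_wpM2r ?addr_ge0 ?sqr_ge0// rs.
  have := sqr_ge0 (1 - s); rewrite sqrrB; lra.
Qed.

(** [Ea] is expanded and the Gaussian moments integrated; the resulting series sums to exp(w/c). The
    exponent -c x^2 + w/c simplifies to -(1 - r)/(2 (1 + r)) x^2, and this decay in x is what makes
    the double integral of the kernel finite. *)
Lemma integral_heat1 nu t x : 0 < nu + 1 -> 0 < t -> let r := expR (- (4 * t)) in
  (\int[leb]_(y in `]0%R, +oo[) (heat1 nu t x y * y `^ (2 * nu + 1))%:E =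
   ((2 * expR (- (2 * t)) / (1 + r)) `^ (nu + 1) *
     expR (- ((1 - r) / (2 * (1 + r)) * x ^+ 2)))%:E)%E.
Proof.
move=> a0 t0 r; have G0 := Gamma_gt0 a0; have /andP[r0 r1] := expR4_lt1 t0.
rewrite -/r in r0 r1; have r10 : 0 < 1 - r by rewrite subr_gt0.
have r10' : 0 < 1 + r by lra.
set a := nu + 1 in a0 G0 *; set c := (1 + r) / (2 * (1 - r)).
have c0 : 0 < c by rewrite divr_gt0// mulr_gt0.
set w := r * x ^+ 2 / (1 - r) ^+ 2.
have w0 : 0 <= w by rewrite divr_ge0 ?sqr_ge0// mulr_ge0 ?sqr_ge0.
set K := 2 / Gamma a * (expR (- (2 * t)) / (1 - r)) `^ a * expR (- (c * x ^+ 2)).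
have K0 : 0 <= K by rewrite !mulr_ge0 ?expR_ge0 ?powR_ge0 ?invr_ge0 ?(ltW G0).
pose f m y : R := (K * (w ^+ m / (m`!%:R * poch a m))) *
  (y `^ (2 * (a + m%:R) - 1) * expR (- (c * y ^+ 2))).
have mf m : measurable_fun (`]0, +oo[%classic : set R) (f m).
  apply: measurable_funTS; apply: measurable_funM => //; apply: measurable_funM => //.
  do 2 apply: measurableT_comp => //; apply: measurable_funM => //.
rewrite (@integral_psum _ _ _ leb `]0, +oo[ f)//; last first.
  move=> y; rewrite /= in_itv/= andbT => y0.
  have -> : heat1 nu t x y * y `^ (2 * nu + 1) =
      (K * (y `^ (2 * nu + 1) * expR (- (c * y ^+ 2)))) * Ea a (w * y ^+ 2).
    rewrite /heat1 -/r -/a -/c mulrDr opprD expRD.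
    have -> : r * (x ^+ 2 * y ^+ 2) / (1 - r) ^+ 2 = w * y ^+ 2 by rewrite /w; ring.
    rewrite /K; ring.
  have h : psum (fun m => (w * y ^+ 2) ^+ m / (m`!%:R * poch a m)) (Ea a (w * y ^+ 2)).
    apply: hsum_psum (hsum_Ea _ a0) => m.
    apply: divr_ge0; first by rewrite exprn_ge0// mulr_ge0// sqr_ge0.
    by rewrite mulr_ge0// ltW// poch_gt0.
  apply: eq_psum (psumZ _ h) => [m|]; last by rewrite mulr_ge0// mulr_ge0 ?powR_ge0 ?expR_ge0.
  rewrite /f; have -> : 2 * (a + m%:R) - 1 = 2 * nu + 1 + (m.*2)%:R.
    by rewrite -mul2n natrM /a; ring.
  rewrite powRD_natr// exprMn -exprM mul2n; ring.
have h := hsum_exp (w / c).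
have {}h : psum (fun n => K * Gamma a / (2 * c `^ a) * ((w / c) ^+ n / n`!%:R))
   (K * Gamma a / (2 * c `^ a) * expR (w / c)).
  apply: psumZ.
    by apply: divr_ge0; [rewrite mulr_ge0// ltW|rewrite mulr_ge0// powR_ge0].
  by apply: hsum_psum h => n; rewrite divr_ge0// exprn_ge0// divr_ge0// ltW.
have [_ <-] : psum (fun n => K * Gamma a / (2 * c `^ a) * ((w / c) ^+ n / n`!%:R))
   ((2 * expR (- (2 * t)) / (1 + r)) `^ a * expR (- ((1 - r) / (2 * (1 + r)) * x ^+ 2))).
  suff <- : K * Gamma a / (2 * c `^ a) * expR (w / c) =
    (2 * expR (- (2 * t)) / (1 + r)) `^ a * expR (- ((1 - r) / (2 * (1 + r)) * x ^+ 2)) by [].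
  have -> : 2 * expR (- (2 * t)) / (1 + r) = expR (- (2 * t)) / (1 - r) / c.
    by rewrite /c; field; rewrite !gt_eqF.
  have -> : - ((1 - r) / (2 * (1 + r)) * x ^+ 2) = - (c * x ^+ 2) + w / c.
    by rewrite /c /w; field; rewrite !gt_eqF.
  have sr0 : 0 <= expR (- (2 * t)) / (1 - r) by rewrite divr_ge0 ?expR_ge0 ?ltW.
  have cV0 : 0 <= c^-1 by rewrite invr_ge0 ltW.
  rewrite expRD /K [X in _ = X * _](powRM _ sr0 cV0).
  rewrite (powRV _ (ltW c0)) powRN.
  by field; rewrite !gt_eqF// powR_gt0.
apply: eq_esum => m _; rewrite /f.
have am0 : 0 < a + m%:R by rewrite ltr_wpDr.
under eq_integral do rewrite EFinM.
rewrite ge0_integralZl//.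
- rewrite integral_powR_expR_sqr// -EFinM; congr EFin.
  have alg (k W F P G A C : R) : F != 0 -> P != 0 -> A != 0 -> C != 0 ->
      k * (W / (F * P)) * (P * G / (2 * (A * C))) = k * G / (2 * A) * (W / C / F).
    by move=> F0 P0 A0 C0; field; rewrite F0 P0 A0 C0.
  rewrite Gamma_poch// powRD_natr// [(w / c) ^+ m]expr_div_n alg//.
  + by rewrite gt_eqF// poch_gt0.
  + by rewrite gt_eqF// powR_gt0.
  + by rewrite gt_eqF// exprn_gt0.
- apply/measurable_EFinP; apply: measurable_funTS; apply: measurable_funM => //.
  do 2 apply: measurableT_comp => //; apply: measurable_funM => //.
- by move=> y _; rewrite lee_fin mulr_ge0 ?powR_ge0 ?expR_ge0.
- by rewrite lee_fin mulr_ge0// divr_ge0 ?exprn_ge0// mulr_ge0// ltW// poch_gt0.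
Qed.

End heat1.

Section integral_hsum.
Context d (T : measurableType d) {R : realType} (mu : {measure set T -> \bar R}).

(** Dominated convergence with the sum of the |f_n| as majorant. The conclusion is a limit of
    integrals of partial sums because [eigen1_heat1] evaluates these by orthogonality. *)
Lemma integral_hsum (D : set T) (f : nat -> T -> R) (g : T -> R) : measurable D ->
  (forall n, measurable_fun D (f n)) ->
  (forall x, D x -> hsum (fun n => f n x) (g x)) ->
  (\esum_(n in [set: nat]) \int[mu]_(x in D) `|f n x|%:E < +oo)%E ->
  mu.-integrable D (EFin \o g) /\
  (\int[mu]_(x in D) (\sum_(i < n) f i x)%:E)%E @[n --> \oo] --> (\int[mu]_(x in D) (g x)%:E)%E.
Proof.
move=> mD mf fg fi.
have mS n : measurable_fun D (fun x => \sum_(i < n) f i x).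
  by apply: measurable_sum => i.
have mg : measurable_fun D g.
  apply: (measurable_fun_cvg (h := fun n x => \sum_(i < n) f i x)) => // x Dx.
  exact: hsum_series (fg _ Dx).
pose h x := fine (\esum_(n in [set: nat]) `|f n x|%:E)%E.
have fh x : D x -> psum (fun n => `|f n x|) (h x).
  move=> /fg/hsum_abs[t ht]; rewrite /h ht.2/=; exact: ht.
have mh : measurable_fun D h.
  apply: (measurable_fun_cvg (h := fun n x => \sum_(i < n) `|f i x|)) => [n|x Dx].
    by apply: measurable_sum => i; exact: measurableT_comp.
  exact: psum_series (fh _ Dx).
have hi : mu.-integrable D (EFin \o h).
  apply/integrableP; split; first exact/measurable_EFinP.
  under eq_integral => x /[1!inE] Dx.
    rewrite /= ger0_norm; last exact: psum_sum_ge0 (fh _ Dx).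
    over.
  rewrite (@integral_psum _ _ _ mu D (fun n x => `|f n x|))// => n.
  exact: measurableT_comp.
have [] := @dominated_convergence _ _ _ mu D mD (fun n x => (\sum_(i < n) f i x)%:E)
   (EFin \o g) (EFin \o h).
- by move=> n; exact/measurable_EFinP.
- exact/measurable_EFinP.
- apply/aeW => x Dx; apply: cvg_EFin; first exact: nearW.
  exact: hsum_series (fg _ Dx).
- exact: hi.
- apply/aeW => x n Dx /=; rewrite lee_fin.
  apply: le_trans (ler_norm_sum _ _ _) _.
  have [p0 hp] := fh _ Dx; rewrite -lee_fin -hp -nneseries_esumT//.
  rewrite -(big_mkord xpredT (fun i => `|f i x|)) -sumEFin.
  by apply: nneseries_lim_ge => i _ _; rewrite lee_fin.
by move=> gi _ cv; split.
Qed.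

End integral_hsum.

(** * Orthonormality *)

Section orthonormality.
Context {R : realType}.
Local Notation leb := (@lebesgue_measure R).
Local Opaque Gamma.
Implicit Types nu a t x y : R.

(* An iterated difference of the polynomial [poch ^~ n], hence [0] for [n < k]:
   this is the orthogonality of the Laguerre polynomials. *)
Definition fdiff n k (b : R) := \sum_(l < k.+1) (-1) ^+ l * 'C(k, l)%:R * poch (b + l%:R) n.

Lemma fdiffS n k b : fdiff n k.+1 b = fdiff n k b - fdiff n k (b + 1).
Proof.
have E : fdiff n k b = \sum_(l < k.+2) (-1) ^+ l * 'C(k, l)%:R * poch (b + l%:R) n.
  by rewrite [RHS]big_ord_recr/= bin_small// mulr0 mul0r addr0.
rewrite E /fdiff big_ord_recl [in RHS]big_ord_recl/= !bin0 -addrA; congr (_ + _).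
rewrite -sumrN -big_split/=; apply: eq_bigr => l _.
rewrite /bump/= !add1n binS natrD -natr1 exprS.
have -> : b + (l%:R + 1) = b + 1 + l%:R by ring.
ring.
Qed.

(** Differencing lowers the degree by one, so that [fdiff] lowers both of its indices at once. *)
Lemma poch_diff n (b : R) : poch b n.+1 - poch (b + 1) n.+1 = - n.+1%:R * poch (b + 1) n.
Proof. by rewrite pochSl pochSr -[n.+1%:R]natr1; ring. Qed.

Lemma fdiff0 k b : fdiff 0 k.+1 b = 0.
Proof.
rewrite fdiffS /fdiff; apply/eqP; rewrite subr_eq0; apply/eqP.
by apply: eq_bigr => l _; rewrite !poch0.
Qed.

Lemma fdiffSS n k b : fdiff n.+1 k.+1 b = - n.+1%:R * fdiff n k (b + 1).
Proof.
rewrite fdiffS /fdiff -sumrB mulr_sumr; apply: eq_bigr => l _.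
rewrite -mulrBr.
have -> : b + 1 + l%:R = b + l%:R + 1 by ring.
by rewrite poch_diff; ring.
Qed.

Lemma fdiff_lt n k b : (n < k)%N -> fdiff n k b = 0.
Proof.
elim: n k b => [|n IH] [|k] b //; first by rewrite fdiff0.
by rewrite ltnS => nk; rewrite fdiffSS IH// mulr0.
Qed.

Lemma fdiff_eq k b : fdiff k k b = (-1) ^+ k * k`!%:R.
Proof.
elim: k b => [|k IH] b; first by rewrite /fdiff big_ord1 poch0 bin0 !mulr1.
by rewrite fdiffSS IH exprS factS natrM; ring.
Qed.

(** For a = nu + 1 this is y^(2 n) times the weight y^(2 nu + 1) and the Gaussian factor of a
    product of two Laguerre functions. *)
Definition moment a (n : nat) y : R := y `^ (2 * (a + n%:R) - 1) * expR (- (y ^+ 2)).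

Lemma measurable_moment a n : measurable_fun [set: R] (moment a n).
Proof. by apply: measurable_funM => //; do 2 apply: measurableT_comp => //. Qed.

Lemma integral_moment a n : 0 < a ->
  (\int[leb]_(y in `]0%R, +oo[) (moment a n y)%:E = (Gamma a * poch a n / 2)%:E)%E.
Proof.
move=> a0; have an : 0 < a + n%:R by rewrite ltr_wpDr.
have := integral_powR_expR_sqr an ltr01; rewrite powR1 mulr1 Gamma_poch// [poch _ _ * _]mulrC => <-.
by apply: eq_integral => y _; rewrite mul1r.
Qed.

Lemma integrable_moment a n : 0 < a ->
  leb.-integrable `]0%R, +oo[ (EFin \o moment a n).
Proof.
move=> a0; apply/integrableP; split.
  by apply/measurable_EFinP/measurable_funTS; exact: measurable_moment.
under eq_integral do rewrite /= ger0_norm ?mulr_ge0 ?powR_ge0 ?expR_ge0//.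
by rewrite integral_moment// ltry.
Qed.

Lemma integral_sum_moment a (I : finType) (c : I -> R) (n : I -> nat) : 0 < a ->
  leb.-integrable `]0%R, +oo[ (fun y => (\sum_i c i * moment a (n i) y)%:E) /\
  (\int[leb]_(y in `]0%R, +oo[) (\sum_i c i * moment a (n i) y)%:E =
   (\sum_i c i * (Gamma a * poch a (n i) / 2))%:E)%E.
Proof.
move=> a0.
have E : (fun y => (\sum_i c i * moment a (n i) y)%:E) =
    (fun y => \sum_(i <- index_enum I) (c i)%:E * (EFin \o moment a (n i)) y)%E.
  by apply/funext => y; rewrite -sumEFin.
have h i : leb.-integrable `]0%R, +oo[ (fun y => (c i)%:E * (EFin \o moment a (n i)) y)%E.
  by apply: integrableZl => //; exact: integrable_moment.
rewrite E; split; first exact: integrable_sum.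
rewrite integral_sum// -sumEFin; apply: eq_bigr => i _.
by rewrite integralZl//; [rewrite integral_moment|exact: integrable_moment].
Qed.

Lemma laguerre_fun1_moment nu j k y : 0 < nu + 1 -> 0 < y ->
  laguerre_fun1 nu j y * laguerre_fun1 nu k y * y `^ (2 * nu + 1) =
  \sum_(p : 'I_j.+1 * 'I_k.+1)
    (Num.sqrt (lnorm (nu + 1) j) * Num.sqrt (lnorm (nu + 1) k) *
     ((-1) ^+ p.1 * (poch (nu + 1 + p.1%:R) (j - p.1) / ((j - p.1)`!%:R * p.1`!%:R)) *
      ((-1) ^+ p.2 * (poch (nu + 1 + p.2%:R) (k - p.2) / ((k - p.2)`!%:R * p.2`!%:R))))) *
    moment (nu + 1) (p.1 + p.2) y.
Proof.
move=> a0 y0; set a := nu + 1.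
have S : expR (- (y ^+ 2)) = expR (- (y ^+ 2 / 2)) * expR (- (y ^+ 2 / 2)).
  by rewrite -expRD; congr expR; field.
rewrite !laguerre_fun1E//.
transitivity (Num.sqrt (lnorm a j) * Num.sqrt (lnorm a k) * (Lag a j (y ^+ 2) * Lag a k (y ^+ 2)) *
    (y `^ (2 * nu + 1) * expR (- (y ^+ 2)))); first by rewrite S; ring.
rewrite /Lag big_distrlr/= pair_bigA/= mulr_sumr mulr_suml; apply: eq_bigr => -[i l] _ /=.
have N n : (- y ^+ 2) ^+ n = (-1) ^+ n * (y ^+ 2) ^+ n :> R by rewrite -exprMn mulN1r.
rewrite /moment; have -> : 2 * (a + (i + l)%:R) - 1 = 2 * nu + 1 + (i + l).*2%:R.
  by rewrite -mul2n natrM /a; ring.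
by rewrite powRD_natr// -mul2n exprM exprD !N; ring.
Qed.

(** Both polynomials are expanded into moments, with j <= k. For a fixed power i from the factor of
    degree j, the sum over the powers of the other one is a multiple of [fdiff i k a]. It vanishes
    for i < k, so only i = j = k can contribute. *)
Lemma laguerre_fun1_ortho nu j k : 0 < nu + 1 ->
  leb.-integrable `]0%R, +oo[
    (fun y => (laguerre_fun1 nu j y * laguerre_fun1 nu k y * y `^ (2 * nu + 1))%:E) /\
  (\int[leb]_(y in `]0%R, +oo[)
    (laguerre_fun1 nu j y * laguerre_fun1 nu k y * y `^ (2 * nu + 1))%:E =
   ((j == k)%:R)%:E)%E.
Proof.
move=> a0; wlog jk : j k / (j <= k)%N.
  move=> hw; have [/hw//|/ltnW/hw] := leqP j k.
  rewrite [k == j]eq_sym => -[h1 h2]; split.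
    by apply: eq_integrable h1 => // y _; rewrite [laguerre_fun1 nu k y * _]mulrC.
  by rewrite -h2; apply: eq_integral => y _; rewrite [laguerre_fun1 nu k y * _]mulrC.
set a := nu + 1 in a0 *; have G0 := Gamma_gt0 a0.
pose c (p : 'I_j.+1 * 'I_k.+1) := Num.sqrt (lnorm a j) * Num.sqrt (lnorm a k) *
     ((-1) ^+ p.1 * (poch (a + p.1%:R) (j - p.1) / ((j - p.1)`!%:R * p.1`!%:R)) *
      ((-1) ^+ p.2 * (poch (a + p.2%:R) (k - p.2) / ((k - p.2)`!%:R * p.2`!%:R)))).
have [h1 h2] := integral_sum_moment c (fun p : 'I_j.+1 * 'I_k.+1 => (p.1 + p.2)%N) a0.
have E y : y \in `]0%R, +oo[%classic ->
    (\sum_p c p * moment a (p.1 + p.2) y)%:E =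
    (laguerre_fun1 nu j y * laguerre_fun1 nu k y * y `^ (2 * nu + 1))%:E.
  rewrite inE/= in_itv/= andbT => y0; congr EFin; apply/esym.
  exact: laguerre_fun1_moment.
split; first by apply: eq_integrable h1.
transitivity (\int[leb]_(y in `]0%R, +oo[) (\sum_p c p * moment a (p.1 + p.2) y)%:E)%E.
  by apply: eq_integral => y /E.
rewrite h2; congr EFin.
rewrite -(pair_bigA _ (fun (i : 'I_j.+1) (l : 'I_k.+1) => c (i, l) * (Gamma a * poch a (i + l) / 2)))/=.
have inner (i : 'I_j.+1) : \sum_(l < k.+1) c (i, l) * (Gamma a * poch a (i + l) / 2) =
   Num.sqrt (lnorm a j) * Num.sqrt (lnorm a k) *
   ((-1) ^+ i * (poch (a + i%:R) (j - i) / ((j - i)`!%:R * i`!%:R))) *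
   (Gamma a * poch a k / (2 * k`!%:R)) * fdiff i k a.
  rewrite /fdiff mulr_sumr; apply: eq_bigr => l _; rewrite /c/=.
  have lk : (l <= k)%N by rewrite -ltnS.
  (* The factor (a)_l of the moment and the factor (a + l)_(k - l) of the coefficient combine into
     (a)_k, free of l; the remaining (a + l)_i is the polynomial that is differenced. *)
  have -> : poch a (i + l) = poch a l * poch (a + l%:R) i by rewrite addnC pochD.
  have -> : poch a k = poch a l * poch (a + l%:R) (k - l) by rewrite -pochD subnKC.
  rewrite -(bin_fact lk) !natrM; field.
  by rewrite !pnatr_eq0 -!lt0n !fact_gt0 bin_gt0 lk.
rewrite (eq_bigr _ (fun i _ => inner i)).
move: jk; rewrite leq_eqVlt => /predU1P[jk|jk].
  rewrite -jk in c h1 h2 E inner *; rewrite eqxx big_ord_recr/= big1 ?add0r; last first.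
    by move=> i _; rewrite fdiff_lt// mulr0.
  rewrite fdiff_eq subnn poch0 fact0.
  have -> : forall x y z : R, Num.sqrt (lnorm a j) * Num.sqrt (lnorm a j) * x * y * z = lnorm a j * x * y * z.
    by move=> *; rewrite -expr2 sqr_sqrtr// ltW// lnorm_gt0.
  have s1 : (-1) ^+ j * (-1) ^+ j = 1 :> R by rewrite -expr2 sqrr_sign.
  transitivity (lnorm a j * (Gamma a * poch a j / (2 * j`!%:R)) * ((-1) ^+ j * (-1) ^+ j)).
    by field; rewrite pnatr_eq0 -lt0n fact_gt0.
  rewrite s1 /lnorm; field.
  by rewrite !gt_eqF ?poch_gt0// ltr0n fact_gt0.
rewrite (ltn_eqF jk) big1// => i _; rewrite fdiff_lt ?mulr0//.
by rewrite (leq_trans (ltn_ord i)).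
Qed.

(** |l_j l_k| <= (l_j^2 + l_k^2)/2 and the normalization. The bound is uniform in the indices, as
    the summation in [eigen1_heat1] requires. *)
Lemma laguerre_fun1_int nu j k : 0 < nu + 1 ->
  (\int[leb]_(y in `]0%R, +oo[)
    `|laguerre_fun1 nu j y * laguerre_fun1 nu k y * y `^ (2 * nu + 1)|%:E <= 1)%E.
Proof.
move=> a0.
pose F j y := laguerre_fun1 nu j y * laguerre_fun1 nu j y * y `^ (2 * nu + 1).
have [ij Ij] := laguerre_fun1_ortho j j a0; have [ik Ik] := laguerre_fun1_ortho k k a0.
have [ijk _] := laguerre_fun1_ortho j k a0.
have F0 i y : 0 <= F i y by rewrite mulr_ge0 ?powR_ge0// -expr2 sqr_ge0.
have -> : (1 = \int[leb]_(y in `]0%R, +oo[) (2^-1%:E * ((F j y)%:E + (F k y)%:E)) :> \bar R)%E.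
  rewrite ge0_integralZl//.
  - by rewrite integralD//= Ij Ik !eqxx -EFinD -EFinM mulVf.
  - by apply: emeasurable_funD; [case/integrableP: ij|case/integrableP: ik].
  - by move=> y _; rewrite -EFinD lee_fin addr_ge0.
apply: ge0_le_integral => //.
- by apply/measurable_EFinP/measurableT_comp => //; apply/measurable_EFinP; case/integrableP: ijk.
- apply: measurable_funeM.
  by apply: emeasurable_funD; [case/integrableP: ij|case/integrableP: ik].
- move=> y _; rewrite -EFinD -EFinM lee_fin /F normrM (ger0_norm (powR_ge0 _ _)) -mulrDl mulrA.
  rewrite ler_wpM2r ?powR_ge0// normrM.
  rewrite -!expr2 -(real_normK (num_real (laguerre_fun1 nu j y))) -(real_normK (num_real (laguerre_fun1 nu k y))).
  have := sqr_ge0 (`|laguerre_fun1 nu j y| - `|laguerre_fun1 nu k y|); rewrite sqrrB; lra.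
Qed.

Lemma measurable_laguerre_fun1 nu k : measurable_fun setT (@laguerre_fun1 R nu k).
Proof.
apply: measurable_funM.
  apply: measurable_funM => //.
  rewrite (_ : (fun s => _) = (fun s : R => \sum_(i < size (laguerre_poly nu k))
     (laguerre_poly nu k)`_i * (s ^+ 2) ^+ i)); last first.
    by apply/funext => s; rewrite horner_coef.
  by apply: measurable_sum => i; apply: measurable_funM => //; do 2 apply: measurable_funX => //.
by do 2 apply: measurableT_comp => //; apply: measurable_funM.
Qed.

(** The kernel is expanded into its Laguerre series and integrated term by term; orthogonality
    leaves the term of index [k] alone. *)
Lemma eigen1_heat1 nu k t x : 0 < nu + 1 -> 0 < t ->
  leb.-integrable `]0%R, +oo[
    (fun y => (heat1 nu t x y * laguerre_fun1 nu k y * y `^ (2 * nu + 1))%:E) /\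
  (\int[leb]_(y in `]0%R, +oo[)
    (heat1 nu t x y * laguerre_fun1 nu k y * y `^ (2 * nu + 1))%:E =
   (expR (- t * eigen1 nu k) * laguerre_fun1 nu k x)%:E)%E.
Proof.
move=> a0 t0.
pose e j := expR (- t * eigen1 nu j).
pose f j y := e j * laguerre_fun1 nu j x *
   (laguerre_fun1 nu j y * laguerre_fun1 nu k y * y `^ (2 * nu + 1)).
have mf j : measurable_fun (`]0, +oo[%classic : set R) (f j).
  apply: measurable_funTS; apply: measurable_funM => //.
  apply: measurable_funM => //; apply: measurable_funM; exact: measurable_laguerre_fun1.
have hf y : `]0, +oo[%classic y -> hsum (f^~ y) (heat1 nu t x y * laguerre_fun1 nu k y * y `^ (2 * nu + 1)).
  move=> _; rewrite -mulrA mulrC.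
  apply: eq_hsum (hsumZ _ (hsum_heat1 x y a0 t0)) => j; rewrite /f /e; ring.
(* Term n is at most e_n |l_n(x)| <= e_n (1 + l_n(x)^2): a geometric series plus the series of the
   kernel on the diagonal. *)
have fi : (\esum_(n in [set: nat]) \int[leb]_(y in `]0%R, +oo[) `|f n y|%:E < +oo)%E.
  have r01 := expR4_lt1 t0.
  have p1 : psum (fun n => expR (- (t * (2 * nu + 2))) * expR (- (4 * t)) ^+ n)
     (expR (- (t * (2 * nu + 2))) * (1 - expR (- (4 * t))) `^ (-1)).
    apply: psumZ; first exact: expR_ge0.
    apply: eq_psum (psum_binomial ltr01 r01) => n.
    have -> : poch 1 n = n`!%:R :> R.
      elim: n => [|n IH]; first by rewrite poch0.
      by rewrite pochSr IH factS natrM -nat1r; ring.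
    by rewrite divff ?mul1r// pnatr_eq0 -lt0n fact_gt0.
  have p2 : psum (fun n => e n * (laguerre_fun1 nu n x * laguerre_fun1 nu n x)) (heat1 nu t x x).
    apply: hsum_psum (hsum_heat1 x x a0 t0) => n.
    by rewrite mulr_ge0 ?expR_ge0// -expr2 sqr_ge0.
  have [_ p3] := psumD p1 p2.
  have := ltry (expR (- (t * (2 * nu + 2))) * (1 - expR (- (4 * t))) `^ (-1) + heat1 nu t x x).
  rewrite -p3; apply: le_lt_trans; apply: le_esum => n _.
  apply: (@le_trans _ _ (`|e n * laguerre_fun1 nu n x|%:E * 1)%E).
    rewrite /f; under eq_integral do rewrite normrM EFinM.
    rewrite ge0_integralZl ?lee_fin//.
      by apply: lee_wpmul2l; [rewrite lee_fin|exact: laguerre_fun1_int].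
    apply/measurable_EFinP/measurable_funTS; apply: measurableT_comp => //.
    apply: measurable_funM => //; apply: measurable_funM; exact: measurable_laguerre_fun1.
  have -> : expR (- (t * (2 * nu + 2))) * expR (- (4 * t)) ^+ n = e n.
    by rewrite -expRM_natr -expRD /e /eigen1; congr expR; ring.
  rewrite mule1 lee_fin normrM (ger0_norm (expR_ge0 _)) -[X in _ <= X + _]mulr1 -mulrDr.
  rewrite ler_wpM2l ?expR_ge0// -expr2 -(real_normK (num_real (laguerre_fun1 nu n x))).
  have := sqr_ge0 (`|laguerre_fun1 nu n x| - 1); rewrite sqrrB1.
  have := normr_ge0 (laguerre_fun1 nu n x); lra.
have [h1 h2] := @integral_hsum _ _ _ leb `]0%R, +oo[%classic f _ (measurable_itv _) mf hf fi.
split => //; apply: (cvg_unique _ h2) => //.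
(* The integrals of the partial sums are constant as soon as n > k. *)
apply: (@cvg_near_cst _ _ (e k * laguerre_fun1 nu k x)%:E); near=> n.
have -> : (\int[leb]_(y in `]0%R, +oo[) (\sum_(i < n) f i y)%:E =
   \sum_(i < n) (e i * laguerre_fun1 nu i x * (i == k :> nat)%:R)%:E)%E.
  have fE i : (EFin \o f i) = (fun y => (e i * laguerre_fun1 nu i x)%:E *
      (laguerre_fun1 nu i y * laguerre_fun1 nu k y * y `^ (2 * nu + 1))%:E)%E.
    by apply/funext => y; rewrite /f /= EFinM.
  under eq_integral do rewrite -sumEFin.
  rewrite (@integral_sum _ _ _ leb _ (measurable_itv _) _ (fun i : 'I_n => EFin \o f i)); last first.
    by move=> i; rewrite fE; apply: integrableZl => //; have [] := laguerre_fun1_ortho i k a0.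
  apply: eq_bigr => i _; rewrite fE integralZl//; last by have [] := laguerre_fun1_ortho i k a0.
  by have [_ ->] := laguerre_fun1_ortho i k a0; rewrite -EFinM.
have nk : (k < n)%N by near: n; exact: nbhs_infty_gt.
rewrite (bigD1 (Ordinal nk))//= eqxx mulr1 big1 ?adde0// => i ik.
by rewrite (_ : (i == k :> nat) = false) ?mulr0//; apply/negbTE.
Unshelve. all: by end_near. Qed.

End orthonormality.

(** * The Laguerre measure *)

Section density.
Context d (T : measurableType d) {R : realType}.
Variables (mu nu : {measure set T -> \bar R}) (g : T -> R).
Hypotheses (g0 : forall x, 0 <= g x) (mg : measurable_fun setT g).
Hypothesis nuE : forall A, measurable A -> nu A = (\int[mu]_(x in A) (g x)%:E)%E.
Local Open Scope ereal_scope.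

Let eg0 x : 0 <= (g x)%:E. Proof. by rewrite lee_fin. Qed.
Let meg : measurable_fun setT (EFin \o g). Proof. exact/measurable_EFinP. Qed.

Let integral_density_indic E : measurable E ->
  \int[nu]_x (\1_E x)%:E = \int[mu]_x ((\1_E x)%:E * (g x)%:E).
Proof.
move=> mE; rewrite integral_indic//= setIT nuE// integral_mkcond; apply: eq_integral => x _.
by rewrite patchE indicE; case: ifPn => _; rewrite ?mul1e ?mul0e.
Qed.

Import HBNNSimple.

Let integral_density_nnsfun (f : {nnsfun T >-> R}) :
  \int[nu]_x (f x)%:E = \int[mu]_x ((f x)%:E * (g x)%:E).
Proof.
under [LHS]eq_integral do rewrite fimfunE -fsumEFin//.
rewrite [LHS]ge0_integral_fsum//; last 2 first.
  - by move=> r; exact/measurable_EFinP/measurableT_comp.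
  - by move=> n x _; rewrite EFinM nnfun_muleindic_ge0.
under [RHS]eq_integral.
  move=> x _; rewrite fimfunE -fsumEFin// muleC ge0_mule_fsumr; last first.
    by move=> r; rewrite EFinM nnfun_muleindic_ge0.
  over.
rewrite [RHS]ge0_integral_fsum//; last 2 first.
  - move=> r; apply: emeasurable_funM => //; exact/measurable_EFinP/measurableT_comp.
  - by move=> n x _; rewrite EFinM mule_ge0// nnfun_muleindic_ge0.
apply: eq_fsbigr => r; rewrite inE => -[x _ <-].
under eq_integral do rewrite EFinM.
under [RHS]eq_integral do rewrite EFinM muleCA.
rewrite !ge0_integralZl//.
- by rewrite integral_density_indic//; congr (_ * _); apply: eq_integral => y _; rewrite muleC.
- by apply: emeasurable_funM => //; exact/measurable_EFinP.
- by move=> y _; rewrite mule_ge0// lee_fin.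
- by rewrite lee_fin.
- exact/measurable_EFinP.
- by rewrite lee_fin.
Qed.

(** From indicators to simple functions to monotone limits. The density is given by its integrals
    over measurable sets, not as a Radon-Nikodym derivative. *)
Lemma ge0_integral_density (f : T -> \bar R) : measurable_fun setT f -> (forall x, 0 <= f x) ->
  \int[nu]_x f x = \int[mu]_x (f x * (g x)%:E).
Proof.
move=> mf f0; pose f_ := nnsfun_approx measurableT mf.
transitivity (lim (\int[nu]_x (f_ n x)%:E @[n --> \oo])).
  rewrite -monotone_convergence//=.
  - apply: eq_integral => ? /[!inE] xD; apply/esym/cvg_lim => //=.
    exact: cvg_nnsfun_approx.
  - by move=> n; exact/measurable_EFinP/measurable_funTS.
  - by move=> n ? _; rewrite lee_fin.
  - by move=> ? _ ? ? mn; rewrite lee_fin; exact/lefP/nd_nnsfun_approx.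
have -> : \int[mu]_x (f x * (g x)%:E) = lim (\int[mu]_x ((f_ n x)%:E * (g x)%:E) @[n --> \oo]).
  rewrite -monotone_convergence//=.
  - apply: eq_integral => x /[!inE] xD; apply/esym/cvg_lim => //.
    apply: cvgeMr => //; first exact: cvg_nnsfun_approx.
  - by move=> n; apply: emeasurable_funM => //; exact/measurable_EFinP/measurable_funTS.
  - by move=> n ? _; rewrite mule_ge0// lee_fin.
  - by move=> x _ ? ? ?; rewrite lee_wpmul2r// lee_fin; exact/lefP/nd_nnsfun_approx.
by apply: congr_lim; apply/funext => n; exact: integral_density_nnsfun.
Qed.

Lemma integral_density (f : T -> \bar R) : measurable_fun setT f ->
  mu.-integrable setT (fun x => f x * (g x)%:E) ->
  nu.-integrable setT f /\ \int[nu]_x f x = \int[mu]_x (f x * (g x)%:E).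
Proof.
move=> mf /integrableP[mfg fgi]; split.
  apply/integrableP; split => //; rewrite ge0_integral_density//; last exact: measurableT_comp.
  apply: le_lt_trans fgi; rewrite le_eqVlt; apply/orP; left; apply/eqP.
  by apply: eq_integral => x _; rewrite abseM (gee0_abs (eg0 x)).
rewrite integralE [in RHS]integralE !ge0_integral_density//; last 2 first.
- exact: measurable_funeneg.
- exact: measurable_funepos.
congr (_ - _); apply: eq_integral => x _; rewrite ?funeposE ?funenegE.
  by rewrite maxeMl// mul0e.
by rewrite maxeMl// mul0e mulNe.
Qed.

End density.

(** * Lebesgue measure on tuples and product integrands *)

Section lebesgue_tuple.
Context {R : realType}.
Local Notation leb := (@lebesgue_measure R).

(* A constant in front of the fixpoint [lebesgue_tuple], to which a sigma-finite
   instance can be attached. *)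
Definition leb_tuple (n : nat) : set (n.-tuple R) -> \bar R := lebesgue_tuple n.

HB.instance Definition _ n := Measure.copy (@leb_tuple n) (lebesgue_tuple n).

Definition box n (k : nat) : set (n.-tuple R) := [set x | forall i, `|tnth x i| <= k%:R].

Lemma measurable_box n k : measurable (@box n k).
Proof.
rewrite (_ : box k = \bigcap_(i in [set: 'I_n])
    ((fun x : n.-tuple R => tnth x i) @^-1` `[- k%:R, k%:R])).
  apply: fin_bigcap_measurable => // i _; rewrite -[X in measurable X]setTI.
  exact: measurable_tnth.
by apply/seteqP; split=> x /= h i; have := h i; rewrite /= in_itv/= ler_norml//; apply.
Qed.

Lemma lebesgue_tuple_box n k : (@leb_tuple n (box k) < +oo)%E.
Proof.
rewrite /leb_tuple; elim: n => [|n IH] /=; first by rewrite diracE; case: (_ \in _); rewrite ltry.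
rewrite /tuple_product /pushforward.
have -> : @tuple_of_prod R n @^-1` box k = box k `*` `[- k%:R, k%:R]%classic.
  apply/seteqP; split=> [[x y]|[x y]] /=.
    move=> h; split.
      by move=> i; have := h (lift ord0 i); rewrite tnthS.
    by rewrite in_itv/=; have := h ord0; rewrite tnth0 ler_norml.
  rewrite in_itv/= -ler_norml => -[h1 h2] i.
  by case: (unliftP ord0 i) => [j ->|->]; rewrite ?tnth0 ?tnthS//; exact: h1.
rewrite product_measure1E//; last exact: measurable_box.
apply: lte_mul_pinfty => //; first by rewrite ge0_fin_numE.
have h : (leb `[(- k%:R)%R, k%:R%R] < +oo)%E.
  by rewrite lebesgue_measure_itv/=; case: ifP => _; rewrite ?ltry// -EFinB ltry.
exact: h.
Qed.

Lemma bigcup_box n : \bigcup_k (@box n k) = setT.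
Proof.
apply/seteqP; split=> // x _; exists (\max_(i < n) (Num.truncn `|tnth x i|).+1) => // i.
apply: (@le_trans _ _ (Num.truncn `|tnth x i|).+1%:R); first by rewrite ltW// truncnS_gt.
by rewrite ler_nat (leq_bigmax i).
Qed.

Lemma sigma_finite_leb_tuple n : sigma_finite setT (@leb_tuple n).
Proof.
exists (@box n); first by rewrite bigcup_box.
by move=> k; split; [exact: measurable_box|exact: lebesgue_tuple_box].
Qed.

HB.instance Definition _ n :=
  @Measure_isSigmaFinite.Build _ _ _ (@leb_tuple n) (@sigma_finite_leb_tuple n).

(** [tuple_of_prod] conses its second component, so [y] is coordinate 0 and [x] holds the others. *)
Lemma ge0_integral_leb_tupleS n (f : n.+1.-tuple R -> \bar R) :
  measurable_fun setT f -> (forall x, 0 <= f x)%E ->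
  (\int[@leb_tuple n.+1]_x f x =
   \int[@leb_tuple n]_x \int[leb]_y f (tuple_of_prod (x, y)))%E.
Proof.
move=> mf f0.
have mt : measurable_fun [set: n.-tuple R * measurableTypeR R] (@tuple_of_prod R n).
  exact: measurable_tuple_of_prod.
have -> : (\int[@leb_tuple n.+1]_x f x = \int[@leb_tuple n \x leb]_z (f \o @tuple_of_prod R n) z)%E.
  have H := ge0_integral_pushforward mt (@leb_tuple n \x leb)%E measurableT mf (fun x _ => f0 x).
  by etransitivity; [|exact: H]; exact: eq_measure_integral.
by rewrite fubini_tonelli1//=; apply: measurableT_comp.
Qed.

Lemma ge0_integral_leb_tuple_prod n (F : 'I_n -> R -> R) (I : 'I_n -> R) :
  (forall i, measurable_fun setT (F i)) -> (forall i s, 0 <= F i s) ->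
  (forall i, \int[leb]_s (F i s)%:E = (I i)%:E)%E ->
  (\int[@leb_tuple n]_x (\prod_(i < n) F i (tnth x i))%:E = (\prod_(i < n) I i)%:E)%E.
Proof.
elim: n F I => [|n IH] F I mF F0 FI.
  rewrite big_ord0; under eq_integral do rewrite big_ord0.
  transitivity (1 * (@dirac _ _ ([tuple] : 0.-tuple R) R [set: 0.-tuple R]))%E; first exact: integral_cst.
  by rewrite diracT mule1.
rewrite ge0_integral_leb_tupleS; last 2 first.
- apply/measurable_EFinP; apply: measurable_prod => i _.
  by apply: measurableT_comp => //; exact: measurable_tnth.
- by move=> x; rewrite lee_fin prodr_ge0.
transitivity (\int[@leb_tuple n]_x ((I ord0)%:E * (\prod_(i < n) F (lift ord0 i) (tnth x i))%:E))%E.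
  apply: eq_integral => x _.
  transitivity (\int[leb]_y ((F ord0 y)%:E * (\prod_(i < n) F (lift ord0 i) (tnth x i))%:E))%E.
    apply: eq_integral => y _; rewrite big_ord_recl tnth0 EFinM; congr (_ * (_)%:E)%E.
    by apply: eq_bigr => i _; rewrite tnthS.
  rewrite ge0_integralZr//= ?FI//.
  - by apply/measurable_EFinP; exact: mF.
  - by move=> y _; rewrite lee_fin.
  - by rewrite lee_fin prodr_ge0.
have I0 : 0 <= I ord0 by rewrite -lee_fin -FI; apply: integral_ge0 => y _; rewrite lee_fin.
rewrite ge0_integralZl//=.
- by rewrite (IH (fun i => F (lift ord0 i)) (fun i => I (lift ord0 i)))// -EFinM big_ord_recl.
- apply/measurable_EFinP; apply: measurable_prod => i _.
  by apply: measurableT_comp => //; exact: measurable_tnth.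
- by move=> x _; rewrite lee_fin prodr_ge0.
Qed.

Lemma integral_leb_tuple_prod n (F : 'I_n -> R -> R) (I : 'I_n -> R) :
  (forall i, measurable_fun setT (F i)) ->
  (forall i, leb.-integrable setT (EFin \o F i)) ->
  (forall i, \int[leb]_s (F i s)%:E = (I i)%:E)%E ->
  (@leb_tuple n).-integrable setT (fun x => (\prod_(i < n) F i (tnth x i))%:E) /\
  (\int[@leb_tuple n]_x (\prod_(i < n) F i (tnth x i))%:E = (\prod_(i < n) I i)%:E)%E.
Proof.
move=> mF iF FI.
have mP m (G : 'I_m -> R -> R) : (forall i, measurable_fun setT (G i)) ->
    measurable_fun setT (fun x : m.-tuple R => (\prod_(i < m) G i (tnth x i))).
  by move=> mG; apply: measurable_prod => i _; apply: measurableT_comp => //; exact: measurable_tnth.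
(* Integrability is proved in every dimension, since the induction below also needs it for the tail
   of [F]; it is the nonnegative case applied to the |G_i|. *)
have ip m (G : 'I_m -> R -> R) : (forall i, measurable_fun setT (G i)) ->
    (forall i, leb.-integrable setT (EFin \o G i)) ->
    (@leb_tuple m).-integrable setT (fun x => (\prod_(i < m) G i (tnth x i))%:E).
  move=> mG iG; apply/integrableP; split; first by apply/measurable_EFinP; exact: mP.
  have fin i : (\int[leb]_s `|G i s|%:E)%E \is a fin_num.
    rewrite ge0_fin_numE ?integral_ge0//.
    by have /integrableP[] := iG i.
  under eq_integral do rewrite /= normr_prod.
  rewrite (@ge0_integral_leb_tuple_prod m (fun i s => `|G i s|)
    (fun i => fine (\int[leb]_s `|G i s|%:E)%E))//.
  - exact: ltry.
  - by move=> i; exact: measurableT_comp.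
  - by move=> i; rewrite fineK.
split; first exact: ip.
elim: n F I mF iF FI => [|n IH] F I mF iF FI.
  rewrite big_ord0; under eq_integral do rewrite big_ord0.
  transitivity (1 * (@dirac _ _ ([tuple] : 0.-tuple R) R [set: 0.-tuple R]))%E; first exact: integral_cst.
  by rewrite diracT mule1.
have mt : measurable_fun [set: n.-tuple R * measurableTypeR R] (@tuple_of_prod R n).
  exact: measurable_tuple_of_prod.
pose f (x : n.+1.-tuple R) := (\prod_(i < n.+1) F i (tnth x i))%:E.
have mf : measurable_fun setT f by apply/measurable_EFinP; exact: mP.
have if_ : (@leb_tuple n \x leb)%E.-integrable setT (f \o @tuple_of_prod R n).
  have /integrableP[_ h] := ip _ _ mF iF.
  apply/integrableP; split; first exact: (measurableT_comp mf mt).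
  have mft : measurable_fun setT (fun z : n.-tuple R * measurableTypeR R => `|(f \o @tuple_of_prod R n) z|)%E.
    by apply: measurableT_comp => //; exact: (measurableT_comp mf mt).
  rewrite (fubini_tonelli1 _ mft)//.
  by move: h; rewrite ge0_integral_leb_tupleS//; exact: measurableT_comp.
have -> : (\int[@leb_tuple n.+1]_x f x = \int[@leb_tuple n \x leb]_z (f \o @tuple_of_prod R n) z)%E.
  have H := integral_pushforward mt mf if_ measurableT.
  by etransitivity; [|exact: H]; exact: eq_measure_integral.
rewrite -integral12_prod_meas1//=.
transitivity (\int[@leb_tuple n]_x ((I ord0)%:E * (\prod_(i < n) F (lift ord0 i) (tnth x i))%:E))%E.
  apply: eq_integral => x _; rewrite /fubini_F/f/=.
  transitivity (\int[leb]_y ((F ord0 y)%:E * (\prod_(i < n) F (lift ord0 i) (tnth x i))%:E))%E.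
    apply: eq_integral => y _; rewrite big_ord_recl tnth0 EFinM; congr (_ * (_)%:E)%E.
    by apply: eq_bigr => i _; rewrite tnthS.
  by rewrite integralZr//= ?FI//; exact: iF.
have ip' := ip n (fun i => F (lift ord0 i)) (fun i => mF _) (fun i => iF _).
rewrite integralZl//=.
by rewrite (IH (fun i => F (lift ord0 i)) (fun i => I (lift ord0 i)))// -EFinM big_ord_recl.
Qed.

End lebesgue_tuple.

Section laguerre_measure.
Context {R : realType} {d : nat}.
Local Notation leb := (@lebesgue_measure R).
Variable alpha : d.-tuple R.
Local Notation mu := (laguerre_measure alpha).

(** With the indicator in each factor, the restriction to the orthant becomes part of a product
    density, and integrals over all of R^d factor. *)
Definition weight1 (nu s : R) : R := (s `^ (2 * nu + 1)) * (0 < s)%R%:R.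

Lemma weight1_ge0 nu s : 0 <= weight1 nu s.
Proof. by rewrite mulr_ge0 ?powR_ge0. Qed.

Lemma measurable_weight1 nu : measurable_fun setT (weight1 nu).
Proof.
apply: measurable_funM; first exact: measurable_powR.
by apply: measurable_fun_boolr; apply: measurable_fun_ltr => //; exact: measurable_cst.
Qed.

Lemma integral_weight1 nu (f : R -> \bar R) :
  (\int[leb]_s (f s * (weight1 nu s)%:E) =
   \int[leb]_(s in `]0%R, +oo[) (f s * (s `^ (2 * nu + 1))%:E))%E.
Proof.
rewrite [RHS]integral_mkcond; apply: eq_integral => s _.
rewrite patchE mem_setE in_itv/= andbT /weight1.
by case: ifPn => _; rewrite ?mulr1// mulr0 mule0.
Qed.

Definition laguerre_density (x : d.-tuple R) : R := \prod_(i < d) weight1 (tnth alpha i) (tnth x i).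

Lemma laguerre_densityE x :
  laguerre_density x = mu_density alpha x * (x \in orthant)%:R.
Proof.
rewrite /laguerre_density big_split/=; congr (_ * _).
case: (boolP (x \in orthant)) => [|/negP xo].
  by rewrite inE => xo; rewrite big1// => i _; rewrite xo.
have [i hi] : exists i, ~~ (0 < tnth x i).
  apply/not_existsP => h; apply: xo; rewrite inE => i.
  by apply/negPn/negP => /h.
by rewrite (bigD1 i)//= (negbTE hi) mul0r.
Qed.

Lemma laguerre_density_ge0 x : 0 <= laguerre_density x.
Proof. by apply: prodr_ge0 => i _; exact: weight1_ge0. Qed.

Lemma measurable_laguerre_density : measurable_fun setT laguerre_density.
Proof.
apply: measurable_prod => i _; apply: measurableT_comp; first exact: measurable_weight1.
exact: measurable_tnth.
Qed.

Lemma laguerre_measureE A : measurable A ->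
  mu A = (\int[@leb_tuple R d]_(x in A) (laguerre_density x)%:E)%E.
Proof.
move=> mA; rewrite /laguerre_measure integral_mkcondr.
apply: eq_integral => x _; rewrite patchE laguerre_densityE.
by case: ifPn => _; rewrite ?mulr1 ?mulr0.
Qed.

(** A box alone does not suffice: a negative exponent 2 alpha_i + 1 makes the density unbounded near
    a coordinate hyperplane. Boxes are therefore cut by the sublevel sets of the density. *)
Lemma sigma_finite_laguerre_measure : sigma_finite setT mu.
Proof.
exists (fun k => box k `&` [set x | laguerre_density x <= k%:R]).
  apply/esym/seteqP; split=> // x _.
  have : setT x by []; rewrite -(@bigcup_box R d) => -[k _ xk].
  exists (maxn k (Num.truncn (laguerre_density x)).+1) => //; split => /=.
    by move=> i; rewrite (le_trans (xk i))// ler_nat leq_maxl.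
  by rewrite (le_trans (ltW (truncnS_gt _)))// ler_nat leq_maxr.
move=> k.
have mA : measurable (box k `&` [set x | laguerre_density x <= k%:R]).
  apply: measurableI; first exact: measurable_box.
  rewrite -[X in measurable X]setTI.
  rewrite (_ : [set x | _] = laguerre_density @^-1` `]-oo, k%:R]).
    exact: measurable_laguerre_density.
  by apply/seteqP; split => x; rewrite /= in_itv.
split => //; rewrite laguerre_measureE//.
apply: (@le_lt_trans _ _ (\int[@leb_tuple R d]_(x in box k) k%:R%:E)%E).
  rewrite integral_mkcondr; apply: ge0_le_integral => //.
  - exact: measurable_box.
  - by move=> x _; rewrite patchE; case: ifPn => // _; rewrite lee_fin laguerre_density_ge0.
  - apply: measurable_funTS; apply/(measurable_restrictT _ _).1.
      rewrite -[X in measurable X]setTI (_ : [set x | _] = laguerre_density @^-1` `]-oo, k%:R]).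
        exact: measurable_laguerre_density.
      by apply/seteqP; split => x; rewrite /= in_itv.
    by apply/measurable_EFinP/measurable_funTS; exact: measurable_laguerre_density.
  - by move=> x _; rewrite patchE; case: ifPn; rewrite ?notin_setE ?inE/= lee_fin.
rewrite integral_cst; last exact: measurable_box.
by apply: lte_mul_pinfty => //; exact: lebesgue_tuple_box.
Qed.

HB.instance Definition _ := @Measure_isSigmaFinite.Build _ _ _ mu sigma_finite_laguerre_measure.

Lemma ge0_integral_laguerre (f : d.-tuple R -> \bar R) : measurable_fun setT f ->
  (forall x, 0 <= f x)%E ->
  (\int[mu]_x f x = \int[@leb_tuple R d]_x (f x * (laguerre_density x)%:E))%E.
Proof.
apply: ge0_integral_density; first exact: laguerre_density_ge0.
  exact: measurable_laguerre_density.
exact: laguerre_measureE.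
Qed.

Lemma ge0_integral_laguerre_prod (F : 'I_d -> R -> R) (I : 'I_d -> R) :
  (forall i, measurable_fun setT (F i)) -> (forall i s, 0 <= F i s) ->
  (forall i, \int[leb]_(s in `]0%R, +oo[) (F i s * s `^ (2 * tnth alpha i + 1))%:E = (I i)%:E)%E ->
  (\int[mu]_x (\prod_(i < d) F i (tnth x i))%:E = (\prod_(i < d) I i)%:E)%E.
Proof.
move=> mF F0 FI; rewrite ge0_integral_laguerre; last 2 first.
- apply/measurable_EFinP; apply: measurable_prod => i _.
  by apply: measurableT_comp => //; exact: measurable_tnth.
- by move=> x; rewrite lee_fin prodr_ge0.
rewrite -(@ge0_integral_leb_tuple_prod R d (fun i s => F i s * weight1 (tnth alpha i) s) I).
- by apply: eq_integral => x _; rewrite -EFinM -big_split.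
- by move=> i; apply: measurable_funM => //; exact: measurable_weight1.
- by move=> i s; rewrite mulr_ge0// weight1_ge0.
- move=> i; under eq_integral do rewrite EFinM.
  by rewrite integral_weight1 -FI; apply: eq_integral => s _; rewrite EFinM.
Qed.

Lemma integral_laguerre_prod (F : 'I_d -> R -> R) (I : 'I_d -> R) :
  (forall i, measurable_fun setT (F i)) ->
  (forall i, leb.-integrable `]0%R, +oo[ (fun s => (F i s * s `^ (2 * tnth alpha i + 1))%:E)) ->
  (forall i, \int[leb]_(s in `]0%R, +oo[) (F i s * s `^ (2 * tnth alpha i + 1))%:E = (I i)%:E)%E ->
  mu.-integrable setT (fun x => (\prod_(i < d) F i (tnth x i))%:E) /\
  (\int[mu]_x (\prod_(i < d) F i (tnth x i))%:E = (\prod_(i < d) I i)%:E)%E.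
Proof.
move=> mF iF FI.
have mw i : measurable_fun setT (fun s => F i s * weight1 (tnth alpha i) s).
  by apply: measurable_funM => //; exact: measurable_weight1.
have [||h1 h2] := @integral_leb_tuple_prod R d (fun i s => F i s * weight1 (tnth alpha i) s) I mw.
- move=> i; apply/integrableP; split; first by apply/measurable_EFinP; exact: mw.
  have /integrableP[_] := iF i; apply: le_lt_trans.
  rewrite le_eqVlt; apply/orP; left; apply/eqP; rewrite [RHS]integral_mkcond.
  apply: eq_integral => s _; rewrite patchE mem_setE in_itv/= andbT /weight1.
  by case: ifPn => _; rewrite ?mulr1// !mulr0 normr0.
- move=> i; under eq_integral do rewrite EFinM.
  by rewrite integral_weight1 -FI; apply: eq_integral => s _; rewrite EFinM.
have mP : measurable_fun setT (fun x : d.-tuple R => (\prod_(i < d) F i (tnth x i))%:E).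
  apply/measurable_EFinP; apply: measurable_prod => i _.
  by apply: measurableT_comp => //; exact: measurable_tnth.
have E : (fun x : d.-tuple R => (\prod_(i < d) (F i (tnth x i) * weight1 (tnth alpha i) (tnth x i)))%:E) =
   (fun x => (\prod_(i < d) F i (tnth x i))%:E * (laguerre_density x)%:E)%E.
  by apply/funext => x; rewrite -EFinM -big_split.
rewrite -h2 E; apply: (integral_density laguerre_density_ge0 measurable_laguerre_density) => //.
  exact: laguerre_measureE.
by rewrite -E.
Qed.

End laguerre_measure.

(** * Bilinear estimates *)

Section iterated.
Context d1 d2 d3 (T1 : measurableType d1) (T2 : measurableType d2) (T3 : measurableType d3).
Context {R : realType}.
Variables (m1 : {sigma_finite_measure set T1 -> \bar R}) (m2 : {sigma_finite_measure set T2 -> \bar R})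
  (m3 : {sigma_finite_measure set T3 -> \bar R}).
Variable F : T1 -> T2 -> T3 -> \bar R.
Hypothesis F0 : forall x y z, (0 <= F x y z)%E.
Hypothesis mF : measurable_fun setT (fun z : T1 * T2 * T3 => F z.1.1 z.1.2 z.2).
Local Open Scope ereal_scope.

Lemma measurable_integral3 : measurable_fun setT (fun z : T1 * T2 => \int[m3]_t F z.1 z.2 t).
Proof. by apply: (@measurable_fun_fubini_tonelli_F _ _ _ _ _ m3 (fun z : T1 * T2 * T3 => F z.1.1 z.1.2 z.2)). Qed.

Lemma measurable_integral23 : measurable_fun setT (fun x => \int[m2]_y \int[m3]_t F x y t).
Proof.
apply: (@measurable_fun_fubini_tonelli_F _ _ _ _ _ m2 (fun z : T1 * T2 => \int[m3]_t F z.1 z.2 t)).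
  exact: measurable_integral3.
by move=> z; exact: integral_ge0.
Qed.

Lemma measurable_section x : measurable_fun setT (fun z : T2 * T3 => F x z.1 z.2).
Proof.
apply: (measurableT_comp mF (g := fun z : T2 * T3 => (x, z.1, z.2))).
by apply: measurable_fun_pair => //; exact: measurable_fun_pair.
Qed.

Lemma measurable_integral2 : measurable_fun setT (fun z : T1 * T3 => \int[m2]_y F z.1 y z.2).
Proof.
apply: (@measurable_fun_fubini_tonelli_F _ _ _ _ _ m2 (fun w : T1 * T3 * T2 => F w.1.1 w.2 w.1.2)).
  apply: (measurableT_comp mF (g := fun w : T1 * T3 * T2 => (w.1.1, w.2, w.1.2))).
  apply: measurable_fun_pair; last exact: measurableT_comp.
  by apply: measurable_fun_pair => //; exact: measurableT_comp.
by move=> z; exact: F0.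
Qed.

Lemma measurable_integral12 : measurable_fun setT (fun t => \int[m1]_x \int[m2]_y F x y t).
Proof.
apply: (@measurable_fun_fubini_tonelli_G _ _ _ _ _ m1 (fun z : T1 * T3 => \int[m2]_y F z.1 y z.2)).
  exact: measurable_integral2.
by move=> z; exact: integral_ge0.
Qed.

Lemma integral_swap23 : \int[m1]_x \int[m2]_y \int[m3]_t F x y t =
  \int[m1]_x \int[m3]_t \int[m2]_y F x y t.
Proof.
apply: eq_integral => x _.
apply: (@fubini_tonelli _ _ _ _ _ m2 m3 (fun z => F x z.1 z.2)) => //.
exact: measurable_section.
Qed.

Lemma integral_rot3 : \int[m1]_x \int[m2]_y \int[m3]_t F x y t =
  \int[m3]_t \int[m1]_x \int[m2]_y F x y t.
Proof.
rewrite integral_swap23.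
apply: (@fubini_tonelli _ _ _ _ _ m1 m3 (fun z : T1 * T3 => \int[m2]_y F z.1 y z.2)).
  exact: measurable_integral2.
by move=> z; exact: integral_ge0.
Qed.

End iterated.

Lemma ge0_integralZl2 d1 d2 (T1 : measurableType d1) (T2 : measurableType d2) (R : realType)
    (m1 : {sigma_finite_measure set T1 -> \bar R}) (m2 : {sigma_finite_measure set T2 -> \bar R})
    (c : R) (h : T1 -> T2 -> \bar R) :
  0 <= c -> (forall x y, 0 <= h x y)%E -> measurable_fun setT (fun z : T1 * T2 => h z.1 z.2) ->
  (\int[m1]_x \int[m2]_y (c%:E * h x y) = c%:E * \int[m1]_x \int[m2]_y h x y)%E.
Proof.
move=> c0 h0 mh; rewrite -ge0_integralZl//; last 2 first.
- by apply: (measurable_fun_fubini_tonelli_F _ mh) => z; exact: h0.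
- by move=> x _; exact: integral_ge0.
apply: eq_integral => x _; rewrite ge0_integralZl//.
by apply: (measurableT_comp mh (g := fun y => (x, y))); exact: measurable_fun_pair.
Qed.

Section duality.
Context d (T : measurableType d) {R : realType}.
Variable mu : {sigma_finite_measure set T -> \bar R}.

(* Test with [b] proportional to [P n `^ q], where [P n] is [Phi] truncated at
   height [n] and to a set of finite measure. *)
Lemma poweR_dual (q C : R) (Phi : T -> \bar R) : 1 <= q -> 0 <= C ->
  measurable_fun setT Phi -> (forall x, 0 <= Phi x)%E ->
  (forall b : T -> R, measurable_fun setT b -> (forall x, 0 <= b x) ->
     (\int[mu]_x (b x)%:E <= 1)%E ->
     (\int[mu]_x (Phi x * (b x `^ (1 - q^-1))%:E) <= C%:E)%E) ->
  (\int[mu]_x (Phi x `^ q) <= (C `^ q)%:E)%E.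
Proof.
move=> q1 C0 mPhi Phi0 H.
have q0 : 0 < q by apply: lt_le_trans q1.
have /sigma_finiteP[E [ET Ei mE]] := @sigma_finiteT _ _ _ mu.
pose P n x : R := fine (mine (Phi x) n%:R%:E) * \1_(E n) x.
have P0 n x : 0 <= P n x.
  by apply: mulr_ge0 => //; apply: fine_ge0; rewrite le_min Phi0 lee_fin/= ler0n.
have PE n x : (fine (mine (Phi x) n%:R%:E))%:E = mine (Phi x) n%:R%:E.
  rewrite fineK// ge0_fin_numE; first by rewrite gt_min ltry orbT.
  by rewrite le_min Phi0 lee_fin/= ler0n.
have Pn n x : P n x <= n%:R * \1_(E n) x.
  by rewrite ler_wpM2r// -lee_fin PE ge_min lexx orbT.
have PPhi n x : ((P n x)%:E <= Phi x)%E.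
  rewrite /P EFinM PE indicE; case: (_ \in _); rewrite ?mule1 ?mule0//.
  by rewrite ge_min lexx.
have mP n : measurable_fun setT (P n).
  apply: measurable_funM => //; last exact: measurable_indic (mE n).1.
  apply: (measurableT_comp (f := fine)) => //.
  by apply: measurable_mine => //; exact: measurable_cst.
have mPq n : measurable_fun setT (fun x => P n x `^ q).
  by apply: (measurableT_comp (measurable_powR _)).
have Pbound n : (\int[mu]_x (P n x `^ q)%:E <= (C `^ q)%:E)%E.
  set N := (\int[mu]_x _)%E.
  have N0 : (0 <= N)%E by apply: integral_ge0 => x _; rewrite lee_fin powR_ge0.
  (* The truncation is made for this finiteness, which allows the division by [N] in the choice of
     [b]. *)
  have Nfin : N \is a fin_num.
    rewrite ge0_fin_numE//; apply: (@le_lt_trans _ _ (\int[mu]_x ((n%:R `^ q)%:E * (\1_(E n) x)%:E))%E).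
      apply: ge0_le_integral => //.
      - by move=> x _; rewrite lee_fin powR_ge0.
      - exact/measurable_EFinP.
      - apply/measurable_EFinP/measurable_funM => //.
        exact: measurable_indic (mE n).1.
      - move=> x _; rewrite -EFinM lee_fin; move: (Pn n x) (P0 n x); rewrite indicE.
        case: (_ \in _); rewrite ?mulr1 ?mulr0 => h1 h2.
          by rewrite ge0_ler_powR// ?nnegrE// ltW.
        have -> : P n x = 0 by apply/eqP; rewrite eq_le h1.
        by rewrite powR0// gt_eqF.
    rewrite ge0_integralZl//.
    - rewrite integral_indic ?setIT//; last exact: (mE n).1.
      by apply: lte_mul_pinfty; rewrite ?lee_fin ?powR_ge0//; exact: (mE n).2.
    - apply/measurable_EFinP; exact: measurable_indic (mE n).1.
  have NE : N = (fine N)%:E by rewrite fineK.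
  have : 0 <= fine N by rewrite fine_ge0.
  rewrite le_eqVlt => /predU1P[N00|N1]; first by rewrite NE -N00 lee_fin powR_ge0.
  (* For b = P^q / N the power 1 - 1/q is P^(q-1) N^(1/q-1), and Phi P^(q-1) >= P^q, so the bound
     becomes N^(1/q) <= C. *)
  have h : (\int[mu]_x (Phi x * ((P n x `^ q / fine N) `^ (1 - q^-1))%:E) <= C%:E)%E.
    apply: H.
    - by apply: measurable_funM.
    - by move=> x; rewrite divr_ge0 ?powR_ge0// ltW.
    - under eq_integral do rewrite EFinM.
      rewrite ge0_integralZr//.
      + by rewrite -/N NE -EFinM divff// gt_eqF.
      + exact/measurable_EFinP.
      + by move=> x _; rewrite lee_fin powR_ge0.
      + by rewrite lee_fin invr_ge0 ltW.
  have : ((fine N `^ q^-1)%:E <= C%:E)%E.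
    apply: le_trans h.
    have -> : (fine N `^ q^-1)%:E = (\int[mu]_x ((P n x `^ q)%:E * (fine N `^ (q^-1 - 1))%:E))%E.
      rewrite ge0_integralZr//.
      + rewrite -/N NE -EFinM; congr EFin.
        rewrite -{2}(powRr1 (ltW N1)) -powRD ?(gt_eqF N1) ?implybT//.
        by congr (_ `^ _); ring.
      + exact/measurable_EFinP.
      + by move=> x _; rewrite lee_fin powR_ge0.
      + by rewrite lee_fin powR_ge0.
    apply: ge0_le_integral => //.
    - by move=> x _; rewrite -EFinM lee_fin mulr_ge0 ?powR_ge0.
    - by apply/measurable_EFinP; apply: measurable_funM.
    - apply: emeasurable_funM => //; apply/measurable_EFinP.
      by apply: (measurableT_comp (measurable_powR _)); apply: measurable_funM.
    - move=> x _; rewrite powRM ?powR_ge0 ?invr_ge0 ?(ltW N1)//.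
      rewrite (powRV _ (ltW N1)) opprB -powRrM EFinM muleA.
      rewrite lee_wpmul2r ?lee_fin ?powR_ge0//.
      have -> : q * (1 - q^-1) = q - 1 by rewrite mulrBr mulr1 divff// gt_eqF.
      apply: (@le_trans _ _ ((P n x)%:E * (P n x `^ (q - 1))%:E)%E).
        rewrite -EFinM lee_fin.
        have := P0 n x; rewrite le_eqVlt => /predU1P[<-|h0]; first by rewrite mul0r powR0// gt_eqF.
        by rewrite -{2}(powRr1 (ltW h0)) -powRD ?(gt_eqF h0) ?implybT// addrC subrK.
      by rewrite lee_wpmul2r// lee_fin powR_ge0.
  rewrite NE !lee_fin => h2.
  rewrite -[leLHS](powRr1 (ltW N1)) -[1](mulVf (lt0r_neq0 q0)) powRrM.
  by rewrite ge0_ler_powR// ?nnegrE ?powR_ge0// ltW.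
have cvP x : (P n x `^ q)%:E @[n --> \oo] --> (Phi x `^ q)%E.
  have [m _ Em] : (\bigcup_i E i) x by rewrite -ET.
  have En n : (m <= n)%N -> \1_(E n) x = 1 :> R.
    move=> mn; rewrite indicE mem_set//.
    by have /subsetPset := Ei _ _ mn; exact.
  have Pm n : (m <= n)%N -> (P n x)%:E = mine (Phi x) n%:R%:E.
    by move=> mn; rewrite /P En// mulr1 PE.
  case: (Phi x) (Phi0 x) Pm => [r r0 Pm|_ Pm|//].
    rewrite poweR_EFin; apply: cvg_near_cst; near=> n.
    congr EFin; congr (_ `^ _); apply: EFin_inj; rewrite Pm; last by near: n; exists m.
    apply/min_idPl; rewrite lee_fin; near: n.
    exists (Num.truncn r).+1 => // n /= rn.
    by rewrite (le_trans (ltW (truncnS_gt r)))// ler_nat.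
  rewrite poweRyr ?gt_eqF//; apply/cvgeyPge => A; near=> n.
  have -> : P n x = n%:R.
    by apply: EFin_inj; rewrite Pm; [apply/min_idPr; rewrite leey|near: n; exists m].
  rewrite lee_fin; apply: (@le_trans _ _ n%:R).
    near: n; exists (Num.truncn A).+1 => // n /= rn.
    by rewrite (le_trans (ltW (truncnS_gt A)))// ler_nat.
  have n1 : 1 <= n%:R :> R by rewrite ler1n; near: n; exists 1%N.
  by rewrite -[leLHS]powRr1 ?(le_trans _ n1)// ler_powR.
have Pmono x n m : (n <= m)%N -> ((P n x `^ q)%:E <= (P m x `^ q)%:E)%E.
  move=> nm; rewrite lee_fin ge0_ler_powR ?nnegrE ?(ltW q0)//.
  rewrite /P ler_pM ?fine_ge0 ?le_min ?Phi0 ?lee_fin ?ler0n//.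
    by rewrite -lee_fin !PE le_min ge_min lexx/= ge_min lee_fin ler_nat nm orbT.
  rewrite !indicE ler_nat; case: (boolP (x \in E n)) => // xE.
  by rewrite mem_set//; have /subsetPset := Ei _ _ nm; apply; rewrite inE in xE.
have -> : (\int[mu]_x (Phi x `^ q) = lim (\int[mu]_x (P n x `^ q)%:E @[n --> \oo]))%E.
  rewrite -monotone_convergence//.
  - by apply: eq_integral => x _; apply/esym/cvg_lim.
  - by move=> n; exact/measurable_EFinP.
  - by move=> n x _; rewrite lee_fin powR_ge0.
  - by move=> x _ n m nm; exact: Pmono.
apply: lime_le; last by near=> n; exact: Pbound.
apply: ereal_nondecreasing_is_cvgn => n m nm; apply: ge0_le_integral => //.
- by move=> x _; rewrite lee_fin powR_ge0.
- exact/measurable_EFinP.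
- exact/measurable_EFinP.
- by move=> x _; exact: Pmono.
Unshelve. all: end_near.
Qed.

End duality.

Section real_powers.
Context {R : realType}.
Implicit Types x y r s : R.

(** With nonnegative exponents the law extends to x = 0, where the power 0 is 1. This matters
    because the kernel and the test functions may vanish. *)
Lemma powRD_ge0 x r s : 0 <= r -> 0 <= s -> x `^ (r + s) = x `^ r * x `^ s.
Proof.
move=> r0 s0; have [->|x0] := eqVneq x 0; last by rewrite powRD// x0 implybT.
have [->|rn] := eqVneq r 0; first by rewrite add0r powRr0 mul1r.
have r0' : 0 < r by rewrite lt_neqAle eq_sym rn.
by rewrite (powR0 (lt0r_neq0 (ltr_wpDr s0 r0'))) (powR0 rn) mul0r.
Qed.

Lemma powR3_le_sum x y z r s t : 0 <= x -> 0 <= y -> 0 <= z -> 0 <= r -> 0 <= s -> 0 <= t ->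
  r + s + t = 1 -> x `^ r * y `^ s * z `^ t <= x + y + z.
Proof.
move=> x0 y0 z0 r0 s0 t0 rst.
have S0 : 0 <= x + y + z by rewrite !addr_ge0.
rewrite -[leRHS]powRr1// -rst (powRD_ge0 _ (addr_ge0 r0 s0) t0) (powRD_ge0 _ r0 s0).
by rewrite !ler_pM ?mulr_ge0 ?powR_ge0 ?ge0_ler_powR// ?nnegrE//; lra.
Qed.

Lemma powR2_le_sum x y r s : 0 <= x -> 0 <= y -> 0 <= r -> 0 <= s ->
  x `^ r * y `^ s <= x `^ (r + s) + y `^ (r + s).
Proof.
move=> x0 y0 r0 s0; rewrite !powRD_ge0//.
have [xy|yx] := leP x y.
  apply: (@le_trans _ _ (y `^ r * y `^ s)); last by rewrite ler_wpDl// mulr_ge0 ?powR_ge0.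
  by rewrite ler_wpM2r ?powR_ge0// ge0_ler_powR.
apply: (@le_trans _ _ (x `^ r * x `^ s)); last by rewrite ler_wpDr// mulr_ge0 ?powR_ge0.
by rewrite ler_wpM2l ?powR_ge0// ge0_ler_powR// ltW.
Qed.

End real_powers.

Section schur.
Context d (T : measurableType d) {R : realType}.
Variable mu : {sigma_finite_measure set T -> \bar R}.
Local Open Scope ereal_scope.

(* With [e = u + v - 1], the factors raised to powers of total exponent 1 are
   [a b], [g a / m], [g b / m] if [0 <= e], and [g / M], [g a / m], [g b / m]
   otherwise. *)
Lemma schur_bound (g : T -> T -> R) (a b : T -> R) (u v m M : R) :
  (forall x y, 0 <= g x y)%R -> measurable_fun setT (fun z : T * T => g z.1 z.2) ->
  (0 <= u <= 1)%R -> (0 <= v <= 1)%R -> (0 < m)%R -> (0 < M)%R ->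
  measurable_fun setT a -> (forall x, 0 <= a x)%R -> \int[mu]_x (a x)%:E <= 1 ->
  measurable_fun setT b -> (forall x, 0 <= b x)%R -> \int[mu]_x (b x)%:E <= 1 ->
  (forall x, \int[mu]_y (g x y)%:E <= m%:E) -> (forall y, \int[mu]_x (g x y)%:E <= m%:E) ->
  (forall x y, g x y <= M)%R -> \int[mu]_x \int[mu]_y (g x y)%:E <= M%:E ->
  \int[mu]_x \int[mu]_y (g x y * a y `^ u * b x `^ v)%:E <=
    (3 * (M `^ `|u + v - 1| * m `^ (1 - `|u + v - 1|)))%:E.
Proof.
move=> g0 mg /andP[u0 u1] /andP[v0 v1] m0 M0 ma a0 ia mb b0 ib gy gx gM igM.
have [m0' M0'] := (ltW m0, ltW M0).
have mgE : measurable_fun setT (fun z : T * T => (g z.1 z.2)%:E) by exact/measurable_EFinP.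
have mga : measurable_fun setT (fun z : T * T => (g z.1 z.2 * a z.2)%:E).
  apply/measurable_EFinP; apply: measurable_funM => //; exact: measurableT_comp.
have mgb : measurable_fun setT (fun z : T * T => (g z.1 z.2 * b z.1)%:E).
  apply/measurable_EFinP; apply: measurable_funM => //; exact: measurableT_comp.
have mab : measurable_fun setT (fun z : T * T => (a z.2 * b z.1)%:E).
  by apply/measurable_EFinP; apply: measurable_funM; exact: measurableT_comp.
have mx x : measurable_fun setT (g x).
  apply: (measurableT_comp mg (g := fun y => (x, y))); exact: measurable_fun_pair.
have my y : measurable_fun setT (g ^~ y).
  apply: (measurableT_comp mg (g := fun x => (x, y))); exact: measurable_fun_pair.
have A1 : \int[mu \x mu]_z (g z.1 z.2 * a z.2)%:E <= m%:E.
  rewrite (fubini_tonelli2 _ mga)/=; last by move=> z; rewrite lee_fin mulr_ge0.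
  apply: (@le_trans _ _ (\int[mu]_y (m%:E * (a y)%:E))).
    apply: ge0_le_integral => //.
    - by move=> y _; apply: integral_ge0 => x _; rewrite lee_fin mulr_ge0.
    - by apply: (measurable_fun_fubini_tonelli_G _ mga) => z; rewrite lee_fin mulr_ge0.
    - by apply: emeasurable_funM => //; exact/measurable_EFinP.
    - move=> y _; rewrite /fubini_G/=; under eq_integral do rewrite EFinM.
      rewrite ge0_integralZr//; first by rewrite lee_wpmul2r// lee_fin.
      + exact/measurable_EFinP.
      + by move=> x _; rewrite lee_fin.
      + by rewrite lee_fin.
  rewrite ge0_integralZl//.
  - by rewrite -[leRHS]mule1 lee_wpmul2l// lee_fin.
  - exact/measurable_EFinP.
  - by move=> x _; rewrite lee_fin.
have A2 : \int[mu \x mu]_z (g z.1 z.2 * b z.1)%:E <= m%:E.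
  rewrite (fubini_tonelli1 _ mgb)/=; last by move=> z; rewrite lee_fin mulr_ge0.
  apply: (@le_trans _ _ (\int[mu]_y (m%:E * (b y)%:E))).
    apply: ge0_le_integral => //.
    - by move=> y _; apply: integral_ge0 => x _; rewrite lee_fin mulr_ge0.
    - by apply: (measurable_fun_fubini_tonelli_F _ mgb) => z; rewrite lee_fin mulr_ge0.
    - by apply: emeasurable_funM => //; exact/measurable_EFinP.
    - move=> y _; rewrite /fubini_F/=; under eq_integral do rewrite EFinM.
      rewrite ge0_integralZr//; first by rewrite lee_wpmul2r// lee_fin.
      + exact/measurable_EFinP.
      + by move=> x _; rewrite lee_fin.
      + by rewrite lee_fin.
  rewrite ge0_integralZl//.
  - by rewrite -[leRHS]mule1 lee_wpmul2l// lee_fin.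
  - exact/measurable_EFinP.
  - by move=> x _; rewrite lee_fin.
have A3 : \int[mu \x mu]_z (a z.2 * b z.1)%:E <= 1.
  rewrite (fubini_tonelli1 _ mab)/=; last by move=> z; rewrite lee_fin mulr_ge0.
  apply: (@le_trans _ _ (\int[mu]_y (b y)%:E)) => //.
  apply: ge0_le_integral => //.
  - by move=> y _; apply: integral_ge0 => x _; rewrite lee_fin mulr_ge0.
  - by apply: (measurable_fun_fubini_tonelli_F _ mab) => z; rewrite lee_fin mulr_ge0.
  - exact/measurable_EFinP.
  - move=> y _; rewrite /fubini_F/=; under eq_integral do rewrite EFinM.
    rewrite ge0_integralZr//; last 3 first.
    + exact/measurable_EFinP.
    + by move=> x _; rewrite lee_fin.
    + by rewrite lee_fin.
    by rewrite -[leRHS]mul1e lee_wpmul2r// lee_fin.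
have A4 : \int[mu \x mu]_z (g z.1 z.2)%:E <= M%:E.
  by rewrite (fubini_tonelli1 _ mgE)//= => z; rewrite lee_fin.
have mF : measurable_fun setT (fun z : T * T => (g z.1 z.2 * a z.2 `^ u * b z.1 `^ v)%:E).
  apply/measurable_EFinP; apply: measurable_funM; last first.
    by apply: (measurableT_comp (measurable_powR _)); exact: measurableT_comp.
  apply: measurable_funM => //.
  by apply: (measurableT_comp (measurable_powR _)); exact: measurableT_comp.
have F0 (z : T * T) : 0 <= (g z.1 z.2 * a z.2 `^ u * b z.1 `^ v)%:E.
  by rewrite lee_fin !mulr_ge0 ?powR_ge0.
rewrite -(fubini_tonelli1 _ mF F0).
set e := (u + v - 1)%R.
(* [h] stands for the first of the three factors, the only one that depends on the sign of [e]. Each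
   of the three summands has integral at most 1, which gives the constant 3. *)
have key (h : T * T -> R) : measurable_fun setT h -> (forall z, 0 <= h z)%R ->
   \int[mu \x mu]_z (h z)%:E <= 1 ->
   (forall x y, g x y * a y `^ u * b x `^ v <= (M `^ `|e| * m `^ (1 - `|e|)) *
      (h (x, y) + m^-1 * (g x y * a y) + m^-1 * (g x y * b x)))%R ->
   \int[mu \x mu]_z (g z.1 z.2 * a z.2 `^ u * b z.1 `^ v)%:E <=
     (3 * (M `^ `|e| * m `^ (1 - `|e|)))%:E.
  move=> mh h0 ih H.
  set K := (M `^ `|e| * m `^ (1 - `|e|))%R.
  have K0 : (0 <= K)%R by rewrite mulr_ge0 ?powR_ge0.
  have mi0 : (0 <= m^-1)%R by rewrite invr_ge0.
  have mhE : measurable_fun setT (EFin \o h) by exact/measurable_EFinP.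
  have mga' : measurable_fun setT (fun z : T * T => (m^-1)%:E * (g z.1 z.2 * a z.2)%:E).
    exact: emeasurable_funM.
  have mgb' : measurable_fun setT (fun z : T * T => (m^-1)%:E * (g z.1 z.2 * b z.1)%:E).
    exact: emeasurable_funM.
  apply: (@le_trans _ _ (\int[mu \x mu]_z (K%:E * ((h z)%:E + (m^-1)%:E * (g z.1 z.2 * a z.2)%:E +
     (m^-1)%:E * (g z.1 z.2 * b z.1)%:E)))).
    apply: ge0_le_integral => //.
    - apply: emeasurable_funM => //; apply: emeasurable_funD => //; exact: emeasurable_funD.
    - move=> [x y] _ /=; apply: le_trans (_ : (K * (h (x, y) + m^-1 * (g x y * a y) + m^-1 * (g x y * b x)))%:E <= _).
        by rewrite lee_fin; exact: H.
      by rewrite EFinM !EFinD !(EFinM m^-1).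
  rewrite ge0_integralZl//; last 2 first.
  - by apply: emeasurable_funD => //; exact: emeasurable_funD.
  - by move=> z _; rewrite -!EFinM -!EFinD lee_fin !addr_ge0// mulr_ge0 ?mulr_ge0.
  rewrite [leRHS]EFinM [leRHS]muleC; apply: lee_wpmul2l; first by rewrite lee_fin.
  rewrite ge0_integralD//; last 3 first.
  - by move=> z _; rewrite -!EFinM -!EFinD lee_fin !addr_ge0// mulr_ge0 ?mulr_ge0.
  - exact: emeasurable_funD.
  - by move=> z _; rewrite -!EFinM lee_fin mulr_ge0 ?mulr_ge0.
  rewrite ge0_integralD//; last 2 first.
  - by move=> z _; rewrite lee_fin.
  - by move=> z _; rewrite -!EFinM lee_fin mulr_ge0 ?mulr_ge0.
  rewrite !ge0_integralZl//; last 2 first.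
  - by move=> z _; rewrite lee_fin mulr_ge0.
  - by move=> z _; rewrite lee_fin mulr_ge0.
  have -> : (3%:R : R)%:E = 1 + m^-1%:E * m%:E + m^-1%:E * m%:E.
    by rewrite -!EFinM -!EFinD mulVf ?gt_eqF//; congr EFin; ring.
  by rewrite !leeD// lee_wpmul2l// lee_fin.
have [e0|e0] := leP 0%R e.
  apply: (key (fun z => a z.2 * b z.1)%R) => //.
  - exact/measurable_EFinP.
  - by move=> z; rewrite mulr_ge0.
  move=> x y /=; rewrite ger0_norm//.
  (* Exponents e, 1 - v, 1 - u. They reproduce a^u b^v exactly, and of g = g^e g^(1-v) g^(1-u) only
     the factor g^e is estimated, by M^e. *)
  have ue : u = (e + (1 - v))%R by rewrite /e; ring.
  have ve : v = (e + (1 - u))%R by rewrite /e; ring.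
  have v1' : (0 <= 1 - v)%R by rewrite subr_ge0.
  have u1' : (0 <= 1 - u)%R by rewrite subr_ge0.
  have ge1 : (g x y = g x y `^ e * (g x y `^ (1 - v) * g x y `^ (1 - u)))%R.
    rewrite -(powRD_ge0 _ v1' u1') -(powRD_ge0 _ e0 (addr_ge0 v1' u1')).
    have -> : (e + (1 - v + (1 - u)) = 1)%R by rewrite /e; ring.
    by rewrite powRr1.
  have me : (m `^ (1 - e) = m `^ (1 - v) * m `^ (1 - u))%R.
    rewrite -powRD_ge0//; congr (_ `^ _)%R; rewrite /e; ring.
  apply: (@le_trans _ _ (M `^ e * m `^ (1 - e) * ((a y * b x) `^ e *
      (m^-1 * (g x y * a y)) `^ (1 - v) * (m^-1 * (g x y * b x)) `^ (1 - u)))%R).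
    rewrite !powRM ?mulr_ge0 ?invr_ge0// !(powRV _ m0') me.
    have mm r : (m `^ (- r) = (m `^ r)^-1)%R by rewrite powRN.
    rewrite !mm [X in (X * _ * _)%R]ge1 [in X in (_ * X * _)%R]ue [in X in (_ * X)%R]ve.
    rewrite (powRD_ge0 (a y) e0 v1') (powRD_ge0 (b x) e0 u1').
    have mv : (m `^ (1 - v) != 0)%R by rewrite gt_eqF// powR_gt0.
    have mu' : (m `^ (1 - u) != 0)%R by rewrite gt_eqF// powR_gt0.
    rewrite [leRHS](_ : _ = (M `^ e * (g x y `^ (1 - v) * g x y `^ (1 - u)) *
       (a y `^ e * a y `^ (1 - v)) * (b x `^ e * b x `^ (1 - u)))%R); last first.
      by field; rewrite mv mu'.
    rewrite !ler_wpM2r ?mulr_ge0 ?powR_ge0//.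
    by apply: ge0_ler_powR; rewrite ?nnegrE ?g0 ?gM.
  rewrite ler_wpM2l ?mulr_ge0 ?powR_ge0// powR3_le_sum ?mulr_ge0 ?invr_ge0//.
  rewrite /e; ring.
apply: (key (fun z => M^-1 * g z.1 z.2)%R) => //.
- exact: measurable_funM.
- by move=> z; rewrite mulr_ge0 ?invr_ge0.
- under eq_integral do rewrite EFinM.
  rewrite ge0_integralZl//; last 2 first.
  + by move=> z _; rewrite lee_fin.
  + by rewrite lee_fin invr_ge0.
  have -> : (1 : \bar R) = M^-1%:E * M%:E by rewrite -EFinM mulVf// gt_eqF.
  by rewrite lee_wpmul2l// lee_fin invr_ge0.
move=> x y /=; rewrite ltr0_norm// opprK.
(* Exponents -e, u, v: the powers of [M] and [m] cancel and the product of the factors is exactly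
   the integrand. *)
have ne0 : (0 <= - e)%R by rewrite oppr_ge0 ltW.
have ge1 : (g x y = g x y `^ (- e) * (g x y `^ u * g x y `^ v))%R.
  rewrite -(powRD_ge0 _ u0 v0) -(powRD_ge0 _ ne0 (addr_ge0 u0 v0)).
  have -> : (- e + (u + v) = 1)%R by rewrite /e; ring.
  by rewrite powRr1.
have me : (m `^ (1 + e) = m `^ u * m `^ v)%R.
  rewrite -powRD_ge0//; congr (_ `^ _)%R; rewrite /e; ring.
apply: (@le_trans _ _ (M `^ (- e) * m `^ (1 + e) * ((M^-1 * g x y) `^ (- e) *
      (m^-1 * (g x y * a y)) `^ u * (m^-1 * (g x y * b x)) `^ v))%R).
  rewrite !powRM ?mulr_ge0 ?invr_ge0// !(powRV _ m0') (powRV _ M0') me.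
  have mm r : (m `^ (- r) = (m `^ r)^-1)%R by rewrite powRN.
  rewrite !mm (powRN M (- e)) [X in (X * _ * _)%R]ge1.
  have mv : (m `^ v != 0)%R by rewrite gt_eqF// powR_gt0.
  have mu' : (m `^ u != 0)%R by rewrite gt_eqF// powR_gt0.
  have Me : (M `^ (- e) != 0)%R by rewrite gt_eqF// powR_gt0.
  rewrite le_eqVlt; apply/orP; left; apply/eqP.
  by field; rewrite mv mu' Me.
rewrite ler_wpM2l ?mulr_ge0 ?powR_ge0// powR3_le_sum ?mulr_ge0 ?invr_ge0//.
rewrite /e; ring.
Qed.

End schur.

Section iterated_order.
Context d1 d2 d3 (T1 : measurableType d1) (T2 : measurableType d2) (T3 : measurableType d3).
Context {R : realType}.
Variables (m1 : {sigma_finite_measure set T1 -> \bar R}) (m2 : {sigma_finite_measure set T2 -> \bar R})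
  (m3 : {sigma_finite_measure set T3 -> \bar R}).
Variables F H : T1 -> T2 -> T3 -> \bar R.
Hypothesis F0 : forall x y z, (0 <= F x y z)%E.
Hypothesis mF : measurable_fun setT (fun z : T1 * T2 * T3 => F z.1.1 z.1.2 z.2).
Hypothesis H0 : forall x y z, (0 <= H x y z)%E.
Hypothesis mH : measurable_fun setT (fun z : T1 * T2 * T3 => H z.1.1 z.1.2 z.2).
Local Open Scope ereal_scope.

Let m3F (K : T1 -> T2 -> T3 -> \bar R) x y :
  measurable_fun setT (fun z : T1 * T2 * T3 => K z.1.1 z.1.2 z.2) ->
  measurable_fun setT (K x y).
Proof.
move=> mK; apply: (measurableT_comp mK (g := fun z => (x, y, z))).
exact: measurable_fun_pair.
Qed.

Let m2F (K : T1 -> T2 -> T3 -> \bar R) x :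
  (forall x y z, 0 <= K x y z) ->
  measurable_fun setT (fun z : T1 * T2 * T3 => K z.1.1 z.1.2 z.2) ->
  measurable_fun setT (fun y => \int[m3]_t K x y t).
Proof.
move=> K0 mK; apply: (measurableT_comp (measurable_integral3 m3 K0 mK) (g := fun y => (x, y))).
exact: measurable_fun_pair.
Qed.

Lemma ge0_le_integral3 : (forall x y t, F x y t <= H x y t) ->
  \int[m1]_x \int[m2]_y \int[m3]_t F x y t <= \int[m1]_x \int[m2]_y \int[m3]_t H x y t.
Proof.
move=> FH; apply: ge0_le_integral => //.
- by move=> x _; apply: integral_ge0 => y _; exact: integral_ge0.
- exact: (measurable_integral23 m2 m3 F0 mF).
- exact: (measurable_integral23 m2 m3 H0 mH).
move=> x _; apply: ge0_le_integral => //.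
- by move=> y _; exact: integral_ge0.
- exact: m2F.
- exact: m2F.
by move=> y _; apply: ge0_le_integral => //; exact: m3F.
Qed.

Lemma ge0_integral3D : \int[m1]_x \int[m2]_y \int[m3]_t (F x y t + H x y t) =
  \int[m1]_x \int[m2]_y \int[m3]_t F x y t + \int[m1]_x \int[m2]_y \int[m3]_t H x y t.
Proof.
rewrite -ge0_integralD//; first last.
- exact: (measurable_integral23 m2 m3 H0 mH).
- by move=> x _; apply: integral_ge0 => y _; exact: integral_ge0.
- exact: (measurable_integral23 m2 m3 F0 mF).
- by move=> x _; apply: integral_ge0 => y _; exact: integral_ge0.
apply: eq_integral => x _; rewrite -ge0_integralD//; first last.
- exact: m2F.
- by move=> y _; exact: integral_ge0.
- exact: m2F.
- by move=> y _; exact: integral_ge0.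
by apply: eq_integral => y _; rewrite ge0_integralD//; exact: m3F.
Qed.

End iterated_order.

(* Time is a measurable function [tau] on an abstract measure space because the
   measurable structures of [R] and of the domain of [lebesgue_measure] differ. *)
Section potential_bilinear.
Context d d' (T : measurableType d) (T' : measurableType d') {R : realType}.
Variables (mu : {sigma_finite_measure set T -> \bar R}) (nu : {sigma_finite_measure set T' -> \bar R}).
Variables (tau : T' -> R) (G : R -> T -> T -> R) (D S B beta sigma : R).
Hypotheses (mtau : measurable_fun setT tau)
  (mG : measurable_fun setT (fun z : T * T * T' => G (tau z.2) z.1.1 z.1.2))
  (G0 : forall t x y, 0 <= G t x y) (Gneg : forall t x y, t <= 0 -> G t x y = 0)
  (D0 : 0 < D) (S0 : 0 < S) (B0 : 0 < B) (beta0 : 0 < beta) (sigma0 : 0 < sigma).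
Hypothesis GS : forall t x y, 0 < t -> G t x y <= S * t `^ (- D).
Hypothesis Gy : forall t x, 0 < t -> (\int[mu]_y (G t x y)%:E <= (B * expR (- (beta * t)))%:E)%E.
Hypothesis Gx : forall t y, 0 < t -> (\int[mu]_x (G t x y)%:E <= (B * expR (- (beta * t)))%:E)%E.
Hypothesis Gxy : forall t, 0 < t -> (\int[mu]_x \int[mu]_y (G t x y)%:E <= (S * t `^ (- D))%:E)%E.
Hypothesis nu_gamma : forall c b, 0 < c -> 0 < b -> exists M,
  (\int[nu]_t (tau t `^ (c - 1) * expR (- (b * tau t)) * (0 < tau t)%R%:R)%:E <= M%:E)%E.
Hypothesis nu_small : forall c A, 0 < c -> 0 < A ->
  (\int[nu]_t (tau t `^ (c - 1) * (0 < tau t <= A)%R%:R)%:E <= (A `^ c / c)%:E)%E.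
Hypothesis nu_large : forall c A, 0 < c -> 0 < A ->
  (\int[nu]_t (tau t `^ (- c - 1) * (A <= tau t)%R%:R)%:E <= (A `^ (- c) / c)%:E)%E.
Local Open Scope ereal_scope.

Let k x y t : R := (tau t `^ (sigma - 1) * G (tau t) x y)%R.

Let k0 x y t : (0 <= k x y t)%R.
Proof. by rewrite /k mulr_ge0 ?powR_ge0. Qed.

Lemma measurable_potential_integrand :
  measurable_fun setT (fun z : T * T * T' => k z.1.1 z.1.2 z.2).
Proof.
apply: measurable_funM => //.
by apply: (measurableT_comp (measurable_powR _)); exact: measurableT_comp.
Qed.

Let mF (a b : T -> R) u v : measurable_fun setT a -> measurable_fun setT b ->
  measurable_fun setT (fun z : T * T * T' => (k z.1.1 z.1.2 z.2 * a z.1.2 `^ u * b z.1.1 `^ v)%:E).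
Proof.
move=> ma mb; apply/measurable_EFinP; apply: measurable_funM; last first.
  apply: (measurableT_comp (measurable_powR _)).
  by apply: (measurableT_comp mb); exact: measurableT_comp.
apply: measurable_funM; first exact: measurable_potential_integrand.
apply: (measurableT_comp (measurable_powR _)).
by apply: (measurableT_comp ma); exact: measurableT_comp.
Qed.

Let unit_ball (a : T -> R) :=
  [/\ measurable_fun setT a, (forall x, 0 <= a x)%R & \int[mu]_x (a x)%:E <= 1].

(** [schur_bound] at fixed t with m = B exp(-beta t) and M = S t^(-D). With e = |u + v - 1|, the
    condition D e < sigma gives integrability in t at 0, and e < 1 keeps part of the exponential
    decay for integrability at infinity. *)
Lemma bilinear_strict (u v : R) : (0 <= u <= 1)%R -> (0 <= v <= 1)%R ->
  (`|u + v - 1| < 1)%R -> (D * `|u + v - 1| < sigma)%R ->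
  exists C : R, forall a b : T -> R, unit_ball a -> unit_ball b ->
  \int[mu]_x \int[mu]_y \int[nu]_t (k x y t * a y `^ u * b x `^ v)%:E <= C%:E.
Proof.
move=> u01 v01; set e := `|u + v - 1|%R => e1 De.
have e0 : (0 <= e)%R by exact: normr_ge0.
have c1 : (0 < sigma - D * e)%R by rewrite subr_gt0.
have c2 : (0 < beta * (1 - e))%R by rewrite mulr_gt0// subr_gt0.
have [M HM] := nu_gamma c1 c2.
set K := (3 * (S `^ e * B `^ (1 - e)))%R.
have K0 : (0 <= K)%R by rewrite !mulr_ge0 ?powR_ge0.
exists (K * M)%R => a b [ma a0 ia] [mb b0 ib].
have mab := mF u v ma mb.
have ab0 x y t : 0 <= (k x y t * a y `^ u * b x `^ v)%:E.
  by rewrite lee_fin !mulr_ge0 ?powR_ge0.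
rewrite (integral_rot3 mu mu nu ab0 mab).
have mphi : measurable_fun setT (fun t => (tau t `^ (sigma - D * e - 1) *
    expR (- (beta * (1 - e) * tau t)) * (0 < tau t)%R%:R)%:E).
  apply/measurable_EFinP; apply: measurable_funM.
    apply: measurable_funM; first exact: (measurableT_comp (measurable_powR _)).
    by apply: measurableT_comp => //; apply: measurableT_comp => //; exact: measurable_funM.
  by apply: measurable_fun_boolr; apply: measurable_fun_ltr => //; exact: measurable_cst.
apply: (@le_trans _ _ (\int[nu]_t (K%:E * (tau t `^ (sigma - D * e - 1) *
    expR (- (beta * (1 - e) * tau t)) * (0 < tau t)%R%:R)%:E))); last first.
  rewrite ge0_integralZl//.
    by rewrite [leRHS]EFinM lee_wpmul2l ?lee_fin.
  by move=> t _; rewrite lee_fin !mulr_ge0 ?powR_ge0 ?expR_ge0.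
apply: ge0_le_integral => //.
- by move=> t _; apply: integral_ge0 => x _; exact: integral_ge0.
- exact: (measurable_integral12 mu mu ab0 mab).
- exact: emeasurable_funM.
move=> t _; have [t0|t0] := ltP 0%R (tau t); last first.
  rewrite mulr0 mule0.
  rewrite integral0_eq// => x _; rewrite integral0_eq// => y _.
  by rewrite /k Gneg// mulr0 !mul0r.
have mGt : measurable_fun setT (fun z : T * T => G (tau t) z.1 z.2).
  apply: (measurableT_comp mG (g := fun z : T * T => (z, t))).
  exact: measurable_fun_pair.
have ineq := @schur_bound _ T R mu (G (tau t)) a b u v (B * expR (- (beta * tau t)))
  (S * tau t `^ (- D)) (G0 _) mGt u01 v01.
apply: (@le_trans _ _ ((tau t `^ (sigma - 1))%:E *
  \int[mu]_x \int[mu]_y (G (tau t) x y * a y `^ u * b x `^ v)%:E)).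
  rewrite -ge0_integralZl2 ?powR_ge0//; last 2 first.
  - by move=> x y; rewrite lee_fin !mulr_ge0 ?powR_ge0.
  - apply/measurable_EFinP; apply: measurable_funM; last first.
      by apply: (measurableT_comp (measurable_powR _)); exact: measurableT_comp.
    apply: measurable_funM => //.
    by apply: (measurableT_comp (measurable_powR _)); exact: measurableT_comp.
  rewrite le_eqVlt; apply/orP; left; apply/eqP.
  by apply: eq_integral => x _; apply: eq_integral => y _; rewrite -EFinM /k !mulrA.
apply: (@le_trans _ _ ((tau t `^ (sigma - 1))%:E * (3 * ((S * tau t `^ (- D)) `^ e *
    (B * expR (- (beta * tau t))) `^ (1 - e)))%:E)).
  rewrite lee_wpmul2l ?lee_fin ?powR_ge0//; apply: ineq => //.
  - by rewrite mulr_gt0// expR_gt0.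
  - by rewrite mulr_gt0// powR_gt0.
  - by move=> x; exact: Gy.
  - by move=> y; exact: Gx.
  - by move=> x y; exact: GS.
  - exact: Gxy.
rewrite -!EFinM lee_fin mulr1.
rewrite !powRM ?powR_ge0 ?expR_ge0 ?(ltW S0) ?(ltW B0)//.
rewrite powR_expR -powRrM.
have -> : (sigma - D * e - 1 = (sigma - 1) + (- D * e))%R by ring.
rewrite (@powRD _ _ (sigma - 1) (- D * e)) ?(gt_eqF t0) ?implybT// /K.
rewrite le_eqVlt; apply/orP; left; apply/eqP.
have -> : ((1 - e) * - (beta * tau t) = - (beta * (1 - e) * tau t))%R by ring.
ring.
Qed.

(** The endpoint is 1/p - 1/q = theta, that is, u + v = 1 + theta. *)
Let theta := (sigma / D)%R.

Let thetaD : (D * theta = sigma)%R.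
Proof. by rewrite /theta mulrC divfK// gt_eqF. Qed.

(** The cut c t^D = 1 is at t = c^(-1/D), so t^(sigma-1) integrates to c^(-theta)/sigma below it,
    and the factor c^(1+theta) brings the t-integral to c/sigma. *)
Definition hls_low (c t : R) : R :=
  (c `^ (1 + theta) * t `^ (sigma - 1) * (0 < t)%R%:R * (c * t `^ D <= 1)%R%:R)%R.

(** Above the cut this power of t is integrable at infinity because e < 1 in all uses, with a
    t-integral of order c^(1-e). *)
Definition hls_tail (e c t : R) : R :=
  (t `^ (- (D * (1 - e)) - 1) * (0 < t)%R%:R * (1 < c * t `^ D)%R%:R)%R.

Let hls_low_ge0 c t : (0 <= hls_low c t)%R.
Proof. by rewrite !mulr_ge0 ?powR_ge0. Qed.

Let hls_tail_ge0 e c t : (0 <= hls_tail e c t)%R.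
Proof. by rewrite !mulr_ge0 ?powR_ge0. Qed.

Let mlow d0 (U : measurableType d0) (f : U -> R) (g : U -> T') : measurable_fun setT f ->
  measurable_fun setT g -> measurable_fun setT (fun z => hls_low (f z) (tau (g z))).
Proof.
move=> mf mg; have mt : measurable_fun setT (tau \o g) by exact: measurableT_comp.
have mtp r : measurable_fun setT (fun z => (tau (g z) `^ r)%R).
  exact: (measurableT_comp (measurable_powR _)).
apply: measurable_funM.
  apply: measurable_funM.
    by apply: measurable_funM => //; exact: (measurableT_comp (measurable_powR _)).
  by apply: measurable_fun_boolr; apply: measurable_fun_ltr.
by apply: measurable_fun_boolr; apply: measurable_fun_ler => //; exact: measurable_funM.
Qed.

Let mtail d0 (U : measurableType d0) e (f : U -> R) (g : U -> T') : measurable_fun setT f ->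
  measurable_fun setT g -> measurable_fun setT (fun z => hls_tail e (f z) (tau (g z))).
Proof.
move=> mf mg; have mt : measurable_fun setT (tau \o g) by exact: measurableT_comp.
have mtp r : measurable_fun setT (fun z => (tau (g z) `^ r)%R).
  exact: (measurableT_comp (measurable_powR _)).
apply: measurable_funM.
  apply: measurable_funM => //.
  by apply: measurable_fun_boolr; apply: measurable_fun_ltr.
by apply: measurable_fun_boolr; apply: measurable_fun_ltr => //; exact: measurable_funM.
Qed.

Let hls_cut (c t : R) : (0 < c)%R -> (0 < t)%R -> (c * t `^ D <= 1)%R -> (t <= c `^ (- D^-1))%R.
Proof.
move=> c0 t0 ct; rewrite -(powRV _ (ltW c0)).
have -> : (t = (t `^ D) `^ D^-1)%R by rewrite -powRrM divff ?gt_eqF// powRr1// ltW.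
apply: ge0_ler_powR; rewrite ?nnegrE ?invr_ge0 ?powR_ge0 ?(ltW D0) ?(ltW c0)//.
by rewrite -[leRHS]mul1r ler_pdivlMr// mulrC.
Qed.

Let hls_cut' (c t : R) : (0 < c)%R -> (0 < t)%R -> (1 < c * t `^ D)%R -> (c `^ (- D^-1) <= t)%R.
Proof.
move=> c0 t0 ct; rewrite -(powRV _ (ltW c0)).
have -> : (t = (t `^ D) `^ D^-1)%R by rewrite -powRrM divff ?gt_eqF// powRr1// ltW.
apply: ge0_ler_powR; rewrite ?nnegrE ?invr_ge0 ?powR_ge0 ?(ltW D0) ?(ltW c0)//.
by rewrite -[leLHS]mul1r ler_pdivrMr// mulrC ltW.
Qed.

Lemma integral_hls_low (c : R) : (0 <= c)%R -> \int[nu]_t (hls_low c (tau t))%:E <= (c / sigma)%:E.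
Proof.
rewrite le_eqVlt => /predU1P[<-|c0].
  rewrite mul0r integral0_eq// => t _.
  by rewrite /hls_low powR0 ?mul0r// gt_eqF// addr_gt0// divr_gt0.
have cD : (0 < c `^ (- D^-1))%R by rewrite powR_gt0.
have msmall : measurable_fun setT (fun t =>
    (tau t `^ (sigma - 1) * (0 < tau t <= c `^ (- D^-1))%R%:R)%:E).
  apply/measurable_EFinP; apply: measurable_funM.
    exact: (measurableT_comp (measurable_powR _)).
  apply: measurable_fun_boolr; apply: measurable_and.
    by apply: measurable_fun_ltr => //; exact: measurable_cst.
  by apply: measurable_fun_ler => //; exact: measurable_cst.
apply: (@le_trans _ _ (\int[nu]_t ((c `^ (1 + theta))%:E *
    (tau t `^ (sigma - 1) * (0 < tau t <= c `^ (- D^-1))%R%:R)%:E))).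
  apply: ge0_le_integral => //.
  - by move=> t _; rewrite lee_fin.
  - by apply/measurable_EFinP; apply: mlow => //; exact: measurable_id.
  - exact: emeasurable_funM.
  - move=> t _; rewrite -EFinM lee_fin /hls_low -!mulrA ler_wpM2l ?powR_ge0//.
    rewrite ler_wpM2l ?powR_ge0//.
    case: (ltP 0%R (tau t)) => t0 /=; rewrite ?mul0r// mul1r.
    by case: (leP (c * tau t `^ D)%R 1%R) => [ct|_] //=; rewrite (hls_cut c0 t0 ct).
rewrite ge0_integralZl//; last 2 first.
- by move=> t _; rewrite lee_fin mulr_ge0 ?powR_ge0.
- by rewrite lee_fin powR_ge0.
apply: (@le_trans _ _ ((c `^ (1 + theta))%:E * ((c `^ (- D^-1)) `^ sigma / sigma)%:E)).
  by rewrite lee_wpmul2l ?lee_fin ?powR_ge0//; exact: nu_small.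
rewrite -EFinM lee_fin mulrA -powRrM -powRD ?(gt_eqF c0) ?implybT//.
have -> : (1 + theta + - D^-1 * sigma = 1)%R by rewrite /theta; ring.
by rewrite powRr1// ltW.
Qed.

Lemma integral_hls_tail (e c : R) : (0 <= c)%R -> (e < 1)%R ->
  \int[nu]_t (hls_tail e c (tau t))%:E <= (c `^ (1 - e) / (D * (1 - e)))%:E.
Proof.
rewrite le_eqVlt => /predU1P[<-|c0] e1.
  rewrite integral0_eq//; last by move=> t _; rewrite /hls_tail mul0r ltr10 mulr0.
  by rewrite lee_fin divr_ge0 ?powR_ge0 ?mulr_ge0 ?(ltW D0)// subr_ge0 ltW.
have cD : (0 < c `^ (- D^-1))%R by rewrite powR_gt0.
have e2 : (0 < D * (1 - e))%R by rewrite mulr_gt0// subr_gt0.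
apply: (@le_trans _ _ (\int[nu]_t
    (tau t `^ (- (D * (1 - e)) - 1) * (c `^ (- D^-1) <= tau t)%R%:R)%:E)).
  apply: ge0_le_integral => //.
  - by move=> t _; rewrite lee_fin.
  - by apply/measurable_EFinP; apply: mtail => //; exact: measurable_id.
  - apply/measurable_EFinP; apply: measurable_funM.
      exact: (measurableT_comp (measurable_powR _)).
    apply: measurable_fun_boolr.
    by apply: measurable_fun_ler => //; exact: measurable_cst.
  - move=> t _; rewrite lee_fin /hls_tail -mulrA ler_wpM2l ?powR_ge0//.
    case: (ltP 0%R (tau t)) => t0 /=; rewrite ?mul0r// mul1r.
    by case: (ltP 1%R (c * tau t `^ D)%R) => [ct|_] //=; rewrite (hls_cut' c0 t0 ct).
apply: le_trans (nu_large e2 cD) _.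
rewrite lee_fin -powRrM.
have -> : (- D^-1 * - (D * (1 - e)) = 1 - e)%R by field; rewrite gt_eqF.
by [].
Qed.

(** The factor c^e compensates the c^(1-e) coming from the tail, so both parts have a t-integral
    bounded by a multiple of [c]. This linearity is what allows the integration of c(x) against [mu]
    afterwards. *)
Let hls (e c t : R) : R := (hls_low c t + c `^ e * hls_tail e c t)%R.

Let hls_ge0 e c t : (0 <= hls e c t)%R.
Proof. by rewrite addr_ge0 ?mulr_ge0 ?powR_ge0. Qed.

Let mhls d0 (U : measurableType d0) e (f : U -> R) (g : U -> T') : measurable_fun setT f ->
  measurable_fun setT g -> measurable_fun setT (fun z => hls e (f z) (tau (g z))).
Proof.
move=> mf mg; apply: measurable_funD; first exact: mlow.
by apply: measurable_funM; [exact: (measurableT_comp (measurable_powR _))|exact: mtail].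
Qed.

Let integral_hls (e c : R) : (0 <= c)%R -> (0 <= e < 1)%R ->
  \int[nu]_t (hls e c (tau t))%:E <= (c * (sigma^-1 + (D * (1 - e))^-1))%:E.
Proof.
move=> c0 /andP[e0 e1].
have -> : \int[nu]_t (hls e c (tau t))%:E =
    \int[nu]_t ((hls_low c (tau t))%:E + (c `^ e)%:E * (hls_tail e c (tau t))%:E).
  by apply: eq_integral => t _; rewrite -EFinM -EFinD.
have ml : measurable_fun setT (fun t => (hls_low c (tau t))%:E).
  by apply/measurable_EFinP; apply: mlow => //; exact: measurable_id.
have mt : measurable_fun setT (fun t => (hls_tail e c (tau t))%:E).
  by apply/measurable_EFinP; apply: mtail => //; exact: measurable_id.
rewrite ge0_integralD//; last 3 first.
- by move=> t _; rewrite lee_fin.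
- by move=> t _; rewrite -EFinM lee_fin mulr_ge0 ?powR_ge0.
- exact: emeasurable_funM.
rewrite mulrDr EFinD leeD ?integral_hls_low// ge0_integralZl ?lee_fin ?powR_ge0//; last first.
  by move=> t _; rewrite lee_fin.
apply: (@le_trans _ _ ((c `^ e)%:E * (c `^ (1 - e) / (D * (1 - e)))%:E)).
  by rewrite lee_wpmul2l ?lee_fin ?powR_ge0// integral_hls_tail.
rewrite -EFinM lee_fin mulrA -powRD_ge0//; last by rewrite subr_ge0 ltW.
by rewrite (_ : e + (1 - e) = 1)%R ?powRr1//; ring.
Qed.

(** The kernel is integrated in y at fixed t, with its integral bounded by [B]; the weight is then
    integrated in t, which leaves a multiple of c(x). [K] is a variable because the transposed
    kernel is needed as well. *)
Let integral_hls_kernel (K : R -> T -> T -> R) (c : T -> R) (e : R) :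
  measurable_fun setT (fun z : T * T * T' => K (tau z.2) z.1.1 z.1.2) ->
  (forall t x y, 0 <= K t x y)%R -> (forall t x y, t <= 0 -> K t x y = 0)%R ->
  (forall t x, (0 < t)%R -> \int[mu]_y (K t x y)%:E <= (B * expR (- (beta * t)))%:E) ->
  (0 <= e < 1)%R -> unit_ball c ->
  \int[mu]_x \int[mu]_y \int[nu]_t (K (tau t) x y * hls e (c x) (tau t))%:E <=
    (B * (sigma^-1 + (D * (1 - e))^-1))%:E.
Proof.
move=> mK K0 Kneg Ky e01 [mc c0 ic].
have w0 : (0 <= sigma^-1 + (D * (1 - e))^-1)%R.
  case/andP: e01 => _ e1.
  by rewrite addr_ge0 ?invr_ge0 ?mulr_ge0 ?(ltW sigma0) ?(ltW D0)// subr_ge0 ltW.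
have mKh : measurable_fun setT (fun z : T * T * T' =>
    (K (tau z.2) z.1.1 z.1.2 * hls e (c z.1.1) (tau z.2))%:E).
  apply/measurable_EFinP; apply: measurable_funM => //.
  by apply: mhls => //; apply: (measurableT_comp mc); exact: measurableT_comp.
have Kh0 x y t : 0 <= (K (tau t) x y * hls e (c x) (tau t))%:E by rewrite lee_fin mulr_ge0.
rewrite (integral_swap23 mu mu nu Kh0 mKh).
apply: (@le_trans _ _ (\int[mu]_x ((B * (sigma^-1 + (D * (1 - e))^-1))%:E * (c x)%:E))); last first.
  rewrite ge0_integralZl//.
  - by rewrite -[leRHS]mule1 lee_wpmul2l// lee_fin mulr_ge0// ltW.
  - exact/measurable_EFinP.
  - by move=> x _; rewrite lee_fin.
  - by rewrite lee_fin mulr_ge0// ltW.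
apply: ge0_le_integral => //.
- by move=> x _; apply: integral_ge0 => t _; exact: integral_ge0.
- apply: (@measurable_fun_fubini_tonelli_F _ _ _ _ _ nu
    (fun z : T * T' => \int[mu]_y (K (tau z.2) z.1 y * hls e (c z.1) (tau z.2))%:E)).
    exact: (measurable_integral2 mu Kh0 mKh).
  by move=> z; exact: integral_ge0.
- by apply: emeasurable_funM => //; exact/measurable_EFinP.
move=> x _.
have mh : measurable_fun setT (fun t => (hls e (c x) (tau t))%:E).
  by apply/measurable_EFinP; apply: mhls => //; exact: measurable_id.
apply: (@le_trans _ _ (\int[nu]_t (B%:E * (hls e (c x) (tau t))%:E))).
  apply: ge0_le_integral => //.
  - by move=> t _; exact: integral_ge0.
  - apply: (measurableT_comp (measurable_integral2 mu Kh0 mKh) (g := fun t => (x, t))).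
    exact: measurable_fun_pair.
  - exact: emeasurable_funM.
  move=> t _.
  under eq_integral do rewrite EFinM.
  rewrite ge0_integralZr//; last 3 first.
  - apply/measurable_EFinP.
    apply: (measurableT_comp mK (g := fun y => (x, y, t))).
    by apply: measurable_fun_pair => //; exact: measurable_fun_pair.
  - by move=> y _; rewrite lee_fin.
  - by rewrite lee_fin.
  rewrite lee_wpmul2r ?lee_fin//.
  have [t0|t0] := ltP 0%R (tau t); last first.
    by rewrite integral0_eq ?lee_fin ?(ltW B0)// => y _; rewrite Kneg.
  apply: le_trans (Ky _ _ t0) _; rewrite lee_fin -[leRHS]mulr1 ler_wpM2l ?(ltW B0)//.
  by rewrite expR_le1 oppr_le0 mulr_ge0// ltW.
rewrite ge0_integralZl ?lee_fin ?(ltW B0)//; last by move=> t _; rewrite lee_fin.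
rewrite -EFinM -mulrA EFinM lee_wpmul2l ?lee_fin ?(ltW B0)// mulrC.
exact: integral_hls.
Qed.

(** The exponents of a add up to u + 1 - theta = 1 + (1 - v). As [a] is the smaller number, the
    surplus a^(1-v) is at most b^(1-v), which completes b^v to b. *)
Let powR_interp (a b u v : R) : (0 <= a)%R -> (a <= b)%R -> (0 <= u)%R -> (0 <= v <= 1)%R ->
  (theta <= 1)%R -> (u + v = 1 + theta)%R -> (a `^ u * b `^ v * a `^ (1 - theta) <= a * b)%R.
Proof.
move=> a0 ab u0 /andP[v0 v1] th1 uv; have b0 := le_trans a0 ab.
have v1' : (0 <= 1 - v)%R by rewrite subr_ge0.
rewrite mulrAC -powRD_ge0 ?subr_ge0//.
have -> : (u + (1 - theta) = 1 + (1 - v))%R by rewrite addrA (addrC u) -addrA; move: uv; lra.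
rewrite powRD_ge0 ?powRr1// -mulrA ler_wpM2l//.
have bE : b = (b `^ (1 - v) * b `^ v)%R by rewrite -powRD_ge0// subrK powRr1.
rewrite [leRHS]bE ler_wpM2r ?powR_ge0//.
by apply: ge0_ler_powR; rewrite ?nnegrE.
Qed.

(* [F1] and [F2] dominate where [a t^D <= 1] or [b t^D <= 1] (there only
   [\int G_t <= B] is used), and [F3] where both exceed 1 (there
   [G_t <= S t^(-D)] is used). *)
Lemma bilinear_endpoint (u v : R) : (sigma < D)%R -> (0 <= u < 1)%R -> (0 <= v < 1)%R ->
  (u + v = 1 + theta)%R ->
  exists C : R, forall a b : T -> R, unit_ball a -> unit_ball b ->
  \int[mu]_x \int[mu]_y \int[nu]_t (k x y t * a y `^ u * b x `^ v)%:E <= C%:E.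
Proof.
move=> sD u01 v01 uv; have [/andP[u0 u1] /andP[v0 v1]] := (u01, v01).
have th0 : (0 < theta)%R by rewrite divr_gt0.
have th1 : (theta < 1)%R by rewrite ltr_pdivrMr// mul1r.
(* One summand for each of [F1], [F2] and [F3]. The tails in [F1] and [F2] converge because u < 1
   and v < 1, and u < 1 means p > 1. *)
exists (B * (sigma^-1 + (D * (1 - u))^-1) + B * (sigma^-1 + (D * (1 - v))^-1) +
  S * (D * (1 - theta))^-1)%R => a b ua ub.
have [[ma a0 ia] [mb b0 ib]] := (ua, ub).
pose F1 x y t := (G (tau t) x y * hls u (a y) (tau t))%R.
pose F2 x y t := (G (tau t) x y * hls v (b x) (tau t))%R.
pose F3 x y t := (S * a y `^ u * b x `^ v * (hls_tail theta (a y) (tau t) *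
  (1 < b x * tau t `^ D)%R%:R))%R.
have max : measurable_fun setT (fun z : T * T * T' => a z.1.2).
  by apply: (measurableT_comp ma); exact: measurableT_comp.
have mbx : measurable_fun setT (fun z : T * T * T' => b z.1.1).
  by apply: (measurableT_comp mb); exact: measurableT_comp.
have mF1 : measurable_fun setT (fun z : T * T * T' => (F1 z.1.1 z.1.2 z.2)%:E).
  by apply/measurable_EFinP; apply: measurable_funM => //; exact: mhls.
have mF2 : measurable_fun setT (fun z : T * T * T' => (F2 z.1.1 z.1.2 z.2)%:E).
  by apply/measurable_EFinP; apply: measurable_funM => //; exact: mhls.
have mF3 : measurable_fun setT (fun z : T * T * T' => (F3 z.1.1 z.1.2 z.2)%:E).
  apply/measurable_EFinP; apply: measurable_funM.
    apply: measurable_funM; last exact: (measurableT_comp (measurable_powR _)).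
    by apply: measurable_funM => //; exact: (measurableT_comp (measurable_powR _)).
  apply: measurable_funM; first exact: mtail.
  apply: measurable_fun_boolr; apply: measurable_fun_ltr => //.
  apply: measurable_funM => //.
  by apply: (measurableT_comp (measurable_powR _)); exact: measurableT_comp.
have F10 x y t : 0 <= (F1 x y t)%:E by rewrite lee_fin mulr_ge0.
have F20 x y t : 0 <= (F2 x y t)%:E by rewrite lee_fin mulr_ge0.
have F30 x y t : 0 <= (F3 x y t)%:E by rewrite lee_fin !mulr_ge0 ?powR_ge0 ?(ltW S0).
have I1 : \int[mu]_x \int[mu]_y \int[nu]_t (F1 x y t)%:E <= (B * (sigma^-1 + (D * (1 - u))^-1))%:E.
  rewrite (fubini_tonelli (fun z : T * T => \int[nu]_t (F1 z.1 z.2 t)%:E)).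
  - have H := @integral_hls_kernel (fun t x y => G t y x) a u.
    rewrite /F1/=; apply: H => //.
      apply: (measurableT_comp mG (g := fun z : T * T * T' => (z.1.2, z.1.1, z.2))).
      apply: measurable_fun_pair => //; apply: measurable_fun_pair; exact: measurableT_comp.
    by move=> t x y; exact: Gneg.
  - exact: (measurable_integral3 nu F10 mF1).
  - by move=> z; exact: integral_ge0.
have I2 : \int[mu]_x \int[mu]_y \int[nu]_t (F2 x y t)%:E <= (B * (sigma^-1 + (D * (1 - v))^-1))%:E.
  exact: integral_hls_kernel.
have D1 : (0 < D * (1 - theta))%R by rewrite mulr_gt0// subr_gt0.
set w := (S * (D * (1 - theta))^-1)%R.
have w0 : (0 <= w)%R by rewrite mulr_ge0 ?invr_ge0 ?(ltW S0) ?(ltW D1).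
(* [c] will be the smaller of a(y) and b(x). Where both are above the cut so is [c], hence the
   t-integral is of order c^(1-theta), and [powR_interp] reduces the product of powers to a(y)
   b(x). *)
have F3_tail x y (c : R) : (0 <= c)%R -> (a y `^ u * b x `^ v * c `^ (1 - theta) <= a y * b x)%R ->
    (forall t, F3 x y t <= S * a y `^ u * b x `^ v * hls_tail theta c (tau t))%R ->
    \int[nu]_t (F3 x y t)%:E <= (w * b x * a y)%:E.
  move=> c0 cab F3c.
  have mt : measurable_fun setT (fun t => (hls_tail theta c (tau t))%:E).
    by apply/measurable_EFinP; apply: mtail => //; exact: measurable_id.
  have sab0 : (0 <= S * a y `^ u * b x `^ v)%R by rewrite !mulr_ge0 ?powR_ge0 ?(ltW S0).
  apply: (@le_trans _ _ (\int[nu]_t ((S * a y `^ u * b x `^ v)%:E * (hls_tail theta c (tau t))%:E))).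
    apply: ge0_le_integral => //.
    - apply: (measurableT_comp mF3 (g := fun t => (x, y, t))).
      exact: measurable_fun_pair.
    - exact: emeasurable_funM.
    - by move=> t _; rewrite -EFinM lee_fin.
  rewrite ge0_integralZl ?lee_fin//; last by move=> t _; rewrite lee_fin.
  apply: (@le_trans _ _ ((S * a y `^ u * b x `^ v)%:E * (c `^ (1 - theta) / (D * (1 - theta)))%:E)).
    by rewrite lee_wpmul2l ?lee_fin// integral_hls_tail.
  rewrite -EFinM lee_fin /w.
  have -> : (S * a y `^ u * b x `^ v * (c `^ (1 - theta) / (D * (1 - theta))) =
     (S / (D * (1 - theta))) * (a y `^ u * b x `^ v * c `^ (1 - theta)))%R by ring.
  by rewrite -[leRHS]mulrA [in leRHS](mulrC (b x)) ler_wpM2l.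
have I3xy x y : \int[nu]_t (F3 x y t)%:E <= (w * b x * a y)%:E.
  have sab0 : (0 <= S * a y `^ u * b x `^ v)%R by rewrite !mulr_ge0 ?powR_ge0 ?(ltW S0).
  have [ab|ba] := leP (a y) (b x).
    apply: (F3_tail _ _ (a y)) => //; first by apply: powR_interp; rewrite ?v0 ?(ltW v1) ?(ltW th1).
    by move=> t; rewrite ler_wpM2l// -[leRHS]mulr1 ler_wpM2l//; case: (_ < _)%R.
  apply: (F3_tail _ _ (b x)) => //.
    rewrite (mulrC (a y `^ u)%R) [leRHS]mulrC.
    by apply: powR_interp; rewrite ?u0 ?(ltW u1) ?(ltW th1) ?(ltW ba)// addrC.
  move=> t; rewrite ler_wpM2l// /hls_tail ler_wpM2r//.
  rewrite -[leRHS]mulr1 ler_wpM2l ?mulr_ge0 ?powR_ge0//.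
  by case: (_ < _)%R.
have I3 : \int[mu]_x \int[mu]_y \int[nu]_t (F3 x y t)%:E <= w%:E.
  apply: (@le_trans _ _ (\int[mu]_x (w%:E * (b x)%:E))); last first.
    rewrite ge0_integralZl ?lee_fin//.
    - by rewrite -[leRHS]mule1 lee_wpmul2l ?lee_fin.
    - exact/measurable_EFinP.
    - by move=> x _; rewrite lee_fin.
  apply: ge0_le_integral => //.
  - by move=> x _; apply: integral_ge0 => y _; exact: integral_ge0.
  - exact: (measurable_integral23 mu nu F30 mF3).
  - by apply: emeasurable_funM => //; exact/measurable_EFinP.
  move=> x _; apply: (@le_trans _ _ (\int[mu]_y ((w * b x)%:E * (a y)%:E))).
    apply: ge0_le_integral => //.
    - by move=> y _; exact: integral_ge0.
    - apply: (measurableT_comp (measurable_integral3 nu F30 mF3) (g := fun y => (x, y))).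
      exact: measurable_fun_pair.
    - by apply: emeasurable_funM => //; exact/measurable_EFinP.
  have wb0 : (0 <= w * b x)%R by exact: mulr_ge0.
  rewrite ge0_integralZl ?lee_fin//.
  - by rewrite -EFinM -[leRHS]mule1 lee_wpmul2l ?lee_fin.
  - exact/measurable_EFinP.
  - by move=> y _; rewrite lee_fin.
have point x y t : (k x y t * a y `^ u * b x `^ v)%:E <= (F1 x y t)%:E + (F2 x y t)%:E + (F3 x y t)%:E.
  have [t0|t0] := leP (tau t) 0%R.
    by rewrite /k Gneg// mulr0 !mul0r !adde_ge0.
  rewrite -!EFinD lee_fin.
  have F1' : (0 <= F1 x y t)%R by rewrite -lee_fin.
  have F2' : (0 <= F2 x y t)%R by rewrite -lee_fin.
  have F3' : (0 <= F3 x y t)%R by rewrite -lee_fin.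
  (* D theta = sigma isolates in the tail the factor t^(sigma-1) of the kernel. *)
  have tn (r : R) : (tau t `^ (- (D * (1 - r)) - 1) = tau t `^ (sigma - 1) * tau t `^ (- D * (1 + theta - r)))%R.
    rewrite -powRD ?(gt_eqF t0) ?implybT//; congr (_ `^ _)%R.
    by rewrite -thetaD; ring.
  have tp (r c : R) : (0 <= c)%R -> (0 <= r)%R -> (c * tau t `^ D <= 1)%R -> (c `^ r <= tau t `^ (- D * r))%R.
    move=> c0 r0 ct; rewrite powRrM; apply: ge0_ler_powR; rewrite ?nnegrE ?powR_ge0//.
    by rewrite powRN -[leRHS]mul1r ler_pdivlMr// powR_gt0.
  (* Both small: a^u b^v <= a^(u+v) + b^(u+v) with u + v = 1 + theta, the two low parts. One small:
     its power is at most a negative power of t, and the tail part of the other one takes the rest.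
     Both large: G_t <= S t^(-D). *)
  have [aD|aD] := leP (a y * tau t `^ D)%R 1%R; have [bD|bD] := leP (b x * tau t `^ D)%R 1%R.
  - apply: (@le_trans _ _ (F1 x y t + F2 x y t)%R); last by rewrite lerDl.
    rewrite /F1 /F2 /k -mulrDr (mulrC (tau t `^ _)%R) -!mulrA ler_wpM2l//.
    rewrite /hls /hls_low /hls_tail t0 aD bD !ltNge aD bD /= !mulr1 !mulr0 !addr0 -mulrDl mulrC ler_wpM2r ?powR_ge0//.
    by rewrite -uv powR2_le_sum.
  - apply: (@le_trans _ _ (F2 x y t)%R); last by rewrite addrAC lerDr addr_ge0.
    rewrite /F2 /k (mulrC (tau t `^ _)%R) -!mulrA ler_wpM2l//.
    have bDn : (b x * tau t `^ D <= 1)%R = false by rewrite leNgt bD.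
    rewrite /hls /hls_low /hls_tail t0 bD bDn /= !mulr1 mulr0 add0r tn.
    rewrite [leRHS]mulrCA ler_wpM2l ?powR_ge0// mulrC ler_wpM2l ?powR_ge0//.
    have -> : (1 + theta - v = u)%R by rewrite -uv; ring.
    exact: tp.
  - apply: (@le_trans _ _ (F1 x y t)%R); last by rewrite -addrA lerDl addr_ge0.
    rewrite /F1 /k (mulrC (tau t `^ _)%R) -!mulrA ler_wpM2l//.
    have aDn : (a y * tau t `^ D <= 1)%R = false by rewrite leNgt aD.
    rewrite /hls /hls_low /hls_tail t0 aD aDn /= !mulr1 mulr0 add0r tn.
    rewrite [leRHS]mulrCA ler_wpM2l ?powR_ge0// ler_wpM2l ?powR_ge0//.
    have -> : (1 + theta - u = v)%R by rewrite -uv; ring.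
    exact: tp.
  - apply: (@le_trans _ _ (F3 x y t)%R); last by rewrite lerDr addr_ge0.
    rewrite /F3 /k /hls_tail t0 aD bD !mulr1 tn.
    have -> : (1 + theta - theta = 1)%R by ring.
    rewrite mulr1 [leRHS](_ : _ = tau t `^ (sigma - 1) * (S * tau t `^ (- D)) * a y `^ u * b x `^ v)%R; last by ring.
    by rewrite !ler_wpM2r ?powR_ge0// ler_wpM2l ?powR_ge0// GS.
apply: (@le_trans _ _ (\int[mu]_x \int[mu]_y \int[nu]_t
   ((F1 x y t)%:E + (F2 x y t)%:E + (F3 x y t)%:E))).
  apply: ge0_le_integral3 => //.
  - by move=> x y t; rewrite lee_fin !mulr_ge0 ?powR_ge0.
  - exact: mF.
  - by move=> x y t; rewrite !adde_ge0.
  - by apply: emeasurable_funD => //; exact: emeasurable_funD.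
rewrite ge0_integral3D//; last 2 first.
- by move=> x y t; rewrite adde_ge0.
- exact: emeasurable_funD.
by rewrite ge0_integral3D// !EFinD !leeD.
Qed.

Definition pre_potential (h : T -> R) (x : T) : \bar R :=
  \int[mu]_y \int[nu]_t (k x y t * h y)%:E.

Let mkh (h : T -> R) : measurable_fun setT h ->
  measurable_fun setT (fun z : T * T * T' => (k z.1.1 z.1.2 z.2 * h z.1.2)%:E).
Proof.
move=> mh; apply/measurable_EFinP; apply: measurable_funM.
  exact: measurable_potential_integrand.
by apply: (measurableT_comp mh); exact: measurableT_comp.
Qed.

Lemma measurable_pre_potential (h : T -> R) : measurable_fun setT h -> (forall x, 0 <= h x)%R ->
  measurable_fun setT (pre_potential h).
Proof.
move=> mh h0; apply: (@measurable_integral23 _ _ _ _ _ _ _ mu nu (fun x y t => (k x y t * h y)%:E)).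
  by move=> x y t; rewrite lee_fin mulr_ge0.
exact: mkh.
Qed.

(** The bilinear estimate with u = 1/p and v = 1 - 1/q, applied to a = h^p / A and to an arbitrary
    [b] in the unit ball of L^1; [poweR_dual] then removes [b]. *)
Lemma pre_potential_bound (p q : R) : (1 <= p)%R -> (1 <= q)%R ->
  (D * `|p^-1 - q^-1| < sigma)%R \/ [/\ sigma < D, 1 < p & q^-1 = p^-1 - sigma / D]%R ->
  exists2 C : R, (0 <= C)%R & forall h : T -> R, measurable_fun setT h -> (forall x, 0 <= h x)%R ->
    \int[mu]_x (h x `^ p)%:E < +oo ->
    (\int[mu]_x (pre_potential h x `^ q)) `^ q^-1 <= C%:E * (\int[mu]_x (h x `^ p)%:E) `^ p^-1.
Proof.
move=> p1 q1 pq.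
have p0 : (0 < p)%R by apply: lt_le_trans p1.
have q0 : (0 < q)%R by apply: lt_le_trans q1.
have pi0 : (0 < p^-1)%R by rewrite invr_gt0.
have qi0 : (0 < q^-1)%R by rewrite invr_gt0.
have pi1 : (p^-1 <= 1)%R by rewrite invf_le1.
have qi1 : (q^-1 <= 1)%R by rewrite invf_le1.
have [C0 HC0] : exists C : R, forall a b : T -> R, unit_ball a -> unit_ball b ->
    \int[mu]_x \int[mu]_y \int[nu]_t (k x y t * a y `^ p^-1 * b x `^ (1 - q^-1))%:E <= C%:E.
  have e : (p^-1 + (1 - q^-1) - 1 = p^-1 - q^-1)%R by ring.
  case: pq => [pq|[sD p1' pq]].
    apply: bilinear_strict.
    - by rewrite pi1 ltW.
    - by apply/andP; split; lra.
    - by rewrite e ltr_norml; apply/andP; split; lra.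
    - by rewrite e.
  apply: bilinear_endpoint => //.
  - by rewrite invf_lt1// p1' ltW.
  - by apply/andP; split; lra.
  - by rewrite pq /theta; ring.
have [C Cge0 C0C] : exists2 C : R, (0 <= C)%R & (C0 <= C)%R.
  by exists `|C0|%R; rewrite ?normr_ge0 ?ler_norm.
exists C => //.
move=> h mh h0 ih.
have Phi0 x : 0 <= pre_potential h x.
  by apply: integral_ge0 => y _; apply: integral_ge0 => t _; rewrite lee_fin mulr_ge0.
have mhp : measurable_fun setT (fun x => (h x `^ p)%:E).
  by apply/measurable_EFinP; exact: (measurableT_comp (measurable_powR _)).
(* [A] is any positive upper bound of the integral of h^p rather than the integral itself, which may
   be 0 and could not serve as a divisor. *)
have key A : (0 < A)%R -> \int[mu]_x (h x `^ p)%:E <= A%:E ->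
    (\int[mu]_x (pre_potential h x `^ q)) `^ q^-1 <= (C * A `^ p^-1)%:E.
  move=> A0 hA.
  have AC : (0 <= A `^ p^-1 * C)%R by exact: mulr_ge0 (powR_ge0 _ _) Cge0.
  have : \int[mu]_x (pre_potential h x `^ q) <= ((A `^ p^-1 * C) `^ q)%:E.
    apply: poweR_dual => //; first exact: measurable_pre_potential.
    move=> b mb b0 ib.
    pose a y := (A^-1 * h y `^ p)%R.
    have ua : unit_ball a.
      split.
      - by apply: measurable_funM => //; exact/measurable_EFinP.
      - by move=> x; rewrite mulr_ge0 ?powR_ge0 ?invr_ge0 ?(ltW A0).
      - rewrite /a; under eq_integral do rewrite EFinM.
        rewrite ge0_integralZl ?lee_fin ?invr_ge0 ?(ltW A0)//; last first.
          by move=> x _; rewrite lee_fin powR_ge0.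
        apply: (@le_trans _ _ (A^-1%:E * A%:E)).
          by rewrite lee_wpmul2l ?lee_fin ?invr_ge0 ?(ltW A0).
        by rewrite -EFinM mulVf ?gt_eqF.
    have ub : unit_ball b by [].
    have [ma a0 _] := ua.
    have ha y : (h y = A `^ p^-1 * a y `^ p^-1)%R.
      rewrite /a powRM ?invr_ge0 ?powR_ge0 ?(ltW A0)// -powRrM divff ?gt_eqF// powRr1//.
      by rewrite mulrA -powRM ?invr_ge0 ?(ltW A0)// divff ?gt_eqF// powR1 mul1r.
    have abk0 x y t : 0 <= (k x y t * a y `^ p^-1 * b x `^ (1 - q^-1))%:E.
      by rewrite lee_fin !mulr_ge0 ?powR_ge0.
    have mabk := mF p^-1 (1 - q^-1) ma mb.
    have := HC0 a b ua ub => HI.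
    apply: (@le_trans _ _ ((A `^ p^-1)%:E * C%:E)); last by rewrite -EFinM.
    apply: (@le_trans _ _ ((A `^ p^-1)%:E * C0%:E)); last first.
      by rewrite lee_wpmul2l ?lee_fin ?powR_ge0.
    apply: le_trans (lee_wpmul2l _ HI); last by rewrite lee_fin powR_ge0.
    rewrite le_eqVlt; apply/orP; left; apply/eqP.
    pose f x := \int[mu]_y \int[nu]_t (k x y t * a y `^ p^-1 * b x `^ (1 - q^-1))%:E.
    have f0 x : 0 <= f x by apply: integral_ge0 => y _; exact: integral_ge0.
    have mf : measurable_fun setT f by exact: (measurable_integral23 mu nu abk0 mabk).
    transitivity (\int[mu]_x ((A `^ p^-1)%:E * f x)); last first.
      by rewrite ge0_integralZl// lee_fin powR_ge0.
    apply: eq_integral => x _; rewrite /pre_potential muleC.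
    have mk2 : measurable_fun setT (fun z : T * T' => (k x z.1 z.2 * h z.1)%:E).
      by apply: (measurable_section (F := fun x y t => (k x y t * h y)%:E)); exact: mkh.
    have mk3 : measurable_fun setT (fun z : T * T' =>
        (k x z.1 z.2 * a z.1 `^ p^-1 * b x `^ (1 - q^-1))%:E).
      exact: (measurable_section (F := fun x y t => (k x y t * a y `^ p^-1 * b x `^ (1 - q^-1))%:E)).
    have kh0 y t : 0 <= (k x y t * h y)%:E by rewrite lee_fin mulr_ge0.
    have /= E1 := ge0_integralZl2 mu nu (powR_ge0 (b x) (1 - q^-1)) kh0 mk2.
    have /= E2 := ge0_integralZl2 mu nu (powR_ge0 A p^-1) (abk0 x) mk3.
    rewrite -E1 /f -E2.
    apply: eq_integral => y _; apply: eq_integral => t _.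
    by rewrite -!EFinM; congr EFin; rewrite ha; ring.
  move=> H.
  apply: (@le_trans _ _ (((A `^ p^-1 * C) `^ q)%:E `^ q^-1)).
    apply: gt0_ler_poweR => //; first exact: ltW.
      by rewrite in_itv/= leey andbT integral_ge0// => x _; exact: poweR_ge0.
    by rewrite in_itv/= leey andbT lee_fin powR_ge0.
  by rewrite poweR_EFin -powRrM divff ?gt_eqF// powRr1// mulrC.
set I := \int[mu]_x (h x `^ p)%:E in ih key *.
have I0 : 0 <= I by apply: integral_ge0 => x _; rewrite lee_fin powR_ge0.
have IE : I = (fine I)%:E by rewrite fineK// ge0_fin_numE.
have : (0 <= fine I)%R by rewrite fine_ge0.
rewrite le_eqVlt => /predU1P[fI|fI]; last first.
  by rewrite [in leRHS]IE poweR_EFin -EFinM; apply: key => //; rewrite -IE.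
rewrite [in leRHS]IE -fI poweR0r ?gt_eqF// mule0.
apply/lee_addgt0Pr => e e0; rewrite add0e.
have C1 : (0 < C + 1)%R by rewrite ltr_wpDl.
(* When the integral of h^p is 0, A = (e/(C + 1))^p makes C A^(1/p) at most [e]; C + 1 is there
   because [C] may be 0. *)
have h1 : (0 < (e / (C + 1)) `^ p)%R by apply: powR_gt0; exact: divr_gt0.
apply: le_trans (key _ h1 _) _.
  by rewrite IE -fI lee_fin ltW.
rewrite lee_fin -powRrM divff ?gt_eqF// powRr1; last by rewrite divr_ge0 ?ltW.
by rewrite mulrCA ger_pMr// ler_pdivrMr// mul1r lerDl.
Qed.

End potential_bilinear.

(** * The heat kernel and the potential operator *)

Section heat1_measurable.
Context {R : realType}.
Local Opaque Gamma.

Lemma measurable_Ea (a : R) : 0 < a -> measurable_fun setT (Ea a).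
Proof.
move=> a0; apply: (@measurable_fun_cvg _ R R setT (fun n (w : R) => \sum_(m < n) w ^+ m / (m`!%:R * poch a m)) (Ea a)).
  move=> n; apply: measurable_sum => i; exact: measurable_funM.
by move=> w _; exact: hsum_series (hsum_Ea w a0).
Qed.

Lemma heat1C (nu t x y : R) : heat1 nu t x y = heat1 nu t y x.
Proof. by rewrite /heat1 (addrC (x ^+ 2)) (mulrC (x ^+ 2)). Qed.

(** The inverse of 1 - r is rewritten as its power -1, a measurable function that agrees with it
    while 1 - r is positive; the indicator removes the other values of t. *)
Lemma measurable_heat1 d (U : measurableType d) (nu : R) (t x y : U -> R) : 0 < nu + 1 ->
  measurable_fun setT t -> measurable_fun setT x -> measurable_fun setT y ->
  measurable_fun setT (fun z => heat1 nu (t z) (x z) (y z) * (0 < t z)%R%:R).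
Proof.
move=> a0 mt mx my.
pose r z := expR (- (4 * t z)); pose s z := (1 - r z) `^ (-1).
have mr : measurable_fun setT r.
  by apply: measurableT_comp => //; apply: measurableT_comp => //; exact: measurable_funM.
have ms : measurable_fun setT s.
  by apply: (measurableT_comp (measurable_powR _)); exact: measurable_funB.
rewrite (_ : (fun z => _) = (fun z => 2 / Gamma (nu + 1) * (expR (- (2 * t z)) * s z) `^ (nu + 1) *
    expR (- ((1 + r z) * s z / 2 * (x z ^+ 2 + y z ^+ 2))) *
    Ea (nu + 1) (r z * (x z ^+ 2 * y z ^+ 2) * s z ^+ 2) * (0 < t z)%R%:R)); last first.
  apply/funext => z; have [t0|t0] := ltP 0 (t z); last by rewrite !mulr0.
  rewrite !mulr1 /heat1 -/(r z).
  have r1 : 0 < 1 - r z by rewrite subr_gt0; have /andP[] := expR4_lt1 t0.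
  have sE : s z = (1 - r z)^-1 by rewrite /s powR_inv1// ltW.
  rewrite sE exprVn; congr (_ * expR (- _) * _).
  by field; rewrite gt_eqF.
have mx2 : measurable_fun setT (fun z => x z ^+ 2) by exact: measurable_funX.
have my2 : measurable_fun setT (fun z => y z ^+ 2) by exact: measurable_funX.
apply: measurable_funM; last first.
  by apply: measurable_fun_boolr; apply: measurable_fun_ltr => //; exact: measurable_cst.
apply: measurable_funM; last first.
  apply: (measurableT_comp (measurable_Ea a0)).
  apply: measurable_funM; last exact: measurable_funX.
  by apply: measurable_funM => //; exact: measurable_funM.
apply: measurable_funM.
  apply: measurable_funM => //; apply: (measurableT_comp (measurable_powR _)).
  apply: measurable_funM => //.
  by apply: measurableT_comp => //; apply: measurableT_comp => //; exact: measurable_funM.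
apply: measurableT_comp => //; apply: measurableT_comp => //.
apply: measurable_funM; last exact: measurable_funD.
apply: measurable_funM => //; apply: measurable_funM => //.
exact: measurable_funD.
Qed.

(** The left side is 1/(2 sinh 2t). *)
Lemma heat_factor_le (t : R) : 0 < t -> expR (- (2 * t)) / (1 - expR (- (4 * t))) <= t^-1.
Proof.
move=> t0; have /andP[_ r1] := expR4_lt1 t0.
have r10 : 0 < 1 - expR (- (4 * t)) by rewrite subr_gt0.
rewrite ler_pdivrMr// ler_pdivlMl//.
set s := expR (- (2 * t)).
have -> : expR (- (4 * t)) = s ^+ 2 by rewrite /s expr2 -expRD; congr expR; ring.
have : 1 + 2 * t <= expR (2 * t) by exact: expR_ge1Dx.
have : expR (2 * t) * s = 1 by rewrite /s -expRD subrr expR0.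
have : s <= 1 by rewrite /s expR_le1 oppr_le0 mulr_ge0// ltW.
have : 0 < s by exact: expR_gt0.
set e := expR _ => s0 s1 es e1; nra.
Qed.

Lemma prod_powR (I : finType) (x : R) (e : I -> R) : 0 < x ->
  \prod_i x `^ (e i) = x `^ (\sum_i e i).
Proof.
move=> x0; elim/big_rec2: _ => [|i u v _ ->]; first by rewrite powRr0.
by rewrite powRD// (gt_eqF x0) implybT.
Qed.

End heat1_measurable.

Section heat_kernel.
Context {R : realType} {d : nat}.
Variable alpha : d.-tuple R.
Hypothesis alpha_ge : forall i, 2^-1 <= tnth alpha i + 1.
Local Notation leb := (@lebesgue_measure R).
Local Notation mu := (laguerre_measure alpha).
Local Opaque Gamma.

Let a0 i : 0 < tnth alpha i + 1.
Proof. by apply: lt_le_trans (alpha_ge i). Qed.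

Let D : R := tsum alpha + d%:R.

Lemma homogeneous_dimE : D = \sum_i (tnth alpha i + 1).
Proof. by rewrite /D /tsum big_split/= sumr_const card_ord. Qed.

Lemma laguerre_eigenvalueE k : laguerre_eigenvalue alpha k = \sum_i eigen1 (tnth alpha i) (tnth k i).
Proof.
rewrite /laguerre_eigenvalue /eigen1 /tsum !big_split/= -!mulr_sumr sumr_const card_ord.
have -> : 2 * d%:R = d%:R + d%:R :> R by rewrite mulrDl mul1r.
congr (4 * _ + _ + _).
by elim/big_rec2: _ => [//|i u v _ <-]; exact: natrD.
Qed.

(** The closed form of [heat_kernel] for t > 0; the indicator extends it by 0, so that time can
    range over all of R in the integrals. *)
Definition heat (t : R) (x y : d.-tuple R) : R :=
  (\prod_i heat1 (tnth alpha i) t (tnth x i) (tnth y i)) * (0 < t)%R%:R.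

Lemma heat_kernelE t x y : 0 < t -> heat_kernel alpha t x y = heat t x y.
Proof.
move=> t0; rewrite /heat t0 mulr1.
have := hsum_tuple (fun i => hsum_heat1 (tnth x i) (tnth y i) (a0 i) t0).
move=> /hsum_rsum <-; congr rsum; apply/funext => k.
rewrite laguerre_eigenvalueE mulr_sumr expR_sum -mulrA /laguerre_fun -!big_split/=.
by apply: eq_bigr => i _; rewrite mulrA.
Qed.

Lemma heat_ge0 t x y : 0 <= heat t x y.
Proof. by rewrite mulr_ge0// prodr_ge0// => i _; exact: heat1_ge0. Qed.

Lemma heat_le0 t x y : t <= 0 -> heat t x y = 0.
Proof. by move=> t0; rewrite /heat ltNge t0 mulr0. Qed.

Lemma heatC t x y : heat t x y = heat t y x.
Proof. by rewrite /heat; congr (_ * _); apply: eq_bigr => i _; exact: heat1C. Qed.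

Lemma heat_le t x y : 0 < t ->
  heat t x y <= (\prod_i (2 / Gamma (tnth alpha i + 1))) * t `^ (- D).
Proof.
move=> t0; rewrite /heat t0 mulr1 homogeneous_dimE -sumrN -prod_powR// -big_split/=.
by apply: ler_prod => i _; rewrite heat1_ge0//= heat1_le.
Qed.

Lemma measurable_heat d' (U : measurableType d') (t : U -> R) (x y : U -> d.-tuple R) :
  measurable_fun setT t -> measurable_fun setT x -> measurable_fun setT y ->
  measurable_fun setT (fun z => heat (t z) (x z) (y z)).
Proof.
move=> mt mx my.
rewrite (_ : (fun z => _) = (fun z => (\prod_i (heat1 (tnth alpha i) (t z) (tnth (x z) i) (tnth (y z) i) *
   (0 < t z)%R%:R)) * (0 < t z)%R%:R)); last first.
  apply/funext => z; rewrite /heat; case: (ltP 0 (t z)) => t0; last by rewrite !mulr0.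
  by rewrite !mulr1; apply: eq_bigr => i _; rewrite mulr1.
apply: measurable_funM; last first.
  by apply: measurable_fun_boolr; apply: measurable_fun_ltr => //; exact: measurable_cst.
apply: measurable_prod => i _; apply: measurable_heat1 => //.
  by apply: (measurableT_comp (f := fun w : d.-tuple R => tnth w i)) => //; exact: measurable_tnth.
by apply: (measurableT_comp (f := fun w : d.-tuple R => tnth w i)) => //; exact: measurable_tnth.
Qed.

Let rt (t : R) : 0 < t -> 0 < 1 + expR (- (4 * t)).
Proof. by move=> _; rewrite ltr_wpDr ?expR_ge0. Qed.

Lemma integral_heatE t x : 0 < t -> let r := expR (- (4 * t)) in
  (\int[mu]_y (heat t x y)%:E =
  (\prod_i ((2 * expR (- (2 * t)) / (1 + r)) `^ (tnth alpha i + 1) *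
     expR (- ((1 - r) / (2 * (1 + r)) * tnth x i ^+ 2))))%:E)%E.
Proof.
move=> t0 r.
rewrite -(@ge0_integral_laguerre_prod R d alpha (fun i s => heat1 (tnth alpha i) t (tnth x i) s * (0 < t)%R%:R)).
- apply: eq_integral => y _; rewrite /heat t0 mulr1.
  by congr EFin; apply: eq_bigr => i _; rewrite mulr1.
- by move=> i; apply: measurable_heat1 => //; exact: measurable_cst.
- by move=> i s; rewrite mulr_ge0// heat1_ge0.
- by move=> i; under eq_integral do rewrite t0 mulr1; rewrite integral_heat1.
Qed.

(** The factors 1/(1 + r) and the Gaussian in x are bounded by 1. The rate 2 D is the lowest
    eigenvalue 2 |alpha| + 2 d. *)
Lemma integral_heat_le t x : 0 < t ->
  (\int[mu]_y (heat t x y)%:E <= (2 `^ D * expR (- (2 * D * t)))%:E)%E.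
Proof.
move=> t0; rewrite integral_heatE//= lee_fin.
have -> : 2 `^ D * expR (- (2 * D * t)) = \prod_i (2 * expR (- (2 * t))) `^ (tnth alpha i + 1).
  rewrite prod_powR ?mulr_gt0 ?expR_gt0// -homogeneous_dimE powRM ?expR_ge0// powR_expR.
  by congr (_ * expR _); ring.
have /andP[r0 r1] := expR4_lt1 t0.
apply: ler_prod => i _; rewrite mulr_ge0 ?powR_ge0 ?expR_ge0//=.
rewrite -[leRHS]mulr1 ler_pM ?powR_ge0 ?expR_ge0//.
  apply: ge0_ler_powR; rewrite ?nnegrE ?(ltW (a0 i)) ?mulr_ge0 ?expR_ge0 ?invr_ge0 ?(ltW (rt t0))//.
  rewrite ger_pMr ?mulr_gt0 ?expR_gt0// invf_le1 ?rt// lerDl//.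
rewrite expR_le1 oppr_le0 mulr_ge0 ?sqr_ge0// divr_ge0 ?subr_ge0 ?(ltW r1)//.
Qed.

(** The Gaussian factors of [integral_heatE] are integrated in x. With [b] and [kap] as below, b /
    kap = 4/(2 sinh 2t) <= 4/t accounts for the powers of 4 and of 1/t. *)
Lemma integral2_heat_le t : 0 < t ->
  (\int[mu]_x \int[mu]_y (heat t x y)%:E <=
   ((\prod_i (Gamma (tnth alpha i + 1) / 2 * 4 `^ (tnth alpha i + 1))) * t `^ (- D))%:E)%E.
Proof.
move=> t0; have /andP[r0 r1] := expR4_lt1 t0.
under eq_integral do rewrite integral_heatE//=.
have r10 : 0 < 1 - expR (- (4 * t)) by rewrite subr_gt0.
have r10' : 0 < 1 + expR (- (4 * t)) by rewrite rt.
set r := expR (- (4 * t)) in r0 r1 r10 r10' *.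
set kap := (1 - r) / (2 * (1 + r)).
have k0 : 0 < kap by rewrite divr_gt0// mulr_gt0.
pose b := 2 * expR (- (2 * t)) / (1 + r).
have b0 : 0 <= b by rewrite mulr_ge0 ?mulr_ge0 ?expR_ge0 ?invr_ge0 ?(ltW r10').
rewrite (@ge0_integral_laguerre_prod R d alpha (fun i s => b `^ (tnth alpha i + 1) * expR (- (kap * s ^+ 2)))
  (fun i => b `^ (tnth alpha i + 1) * (Gamma (tnth alpha i + 1) / (2 * kap `^ (tnth alpha i + 1))))).
- rewrite lee_fin homogeneous_dimE -sumrN -prod_powR// -big_split/=.
  apply: ler_prod => i _; have G0 := Gamma_gt0 (a0 i).
  rewrite mulr_ge0 ?powR_ge0//= ?divr_ge0 ?mulr_ge0 ?powR_ge0 ?(ltW G0)//.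
  have -> : b `^ (tnth alpha i + 1) * (Gamma (tnth alpha i + 1) / (2 * kap `^ (tnth alpha i + 1))) =
     Gamma (tnth alpha i + 1) / 2 * (b / kap) `^ (tnth alpha i + 1).
    rewrite powRM// ?invr_ge0 ?(ltW k0)// (powRV _ (ltW k0)) powRN.
    by field; rewrite gt_eqF// powR_gt0.
  rewrite -[leRHS]mulrA ler_wpM2l ?divr_ge0 ?(ltW G0)//.
  have -> : b / kap = 4 * (expR (- (2 * t)) / (1 - r)).
    by rewrite /b /kap; field; rewrite !gt_eqF.
  have h0 : 0 <= expR (- (2 * t)) / (1 - r) by rewrite divr_ge0 ?expR_ge0 ?(ltW r10).
  rewrite powRM// ler_wpM2l ?powR_ge0// -(powRV _ (ltW t0)).
  apply: ge0_ler_powR; rewrite ?nnegrE ?(ltW (a0 i)) ?invr_ge0 ?(ltW t0)//.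
  exact: heat_factor_le.
- move=> i; apply: measurable_funM => //; apply: measurableT_comp => //.
  by apply: measurableT_comp => //; apply: measurable_funM => //; exact: measurable_funX.
- by move=> i s; rewrite mulr_ge0 ?powR_ge0 ?expR_ge0.
- move=> i; have := integral_powR_expR_sqr (a0 i) k0.
  have -> : 2 * (tnth alpha i + 1) - 1 = 2 * tnth alpha i + 1 by ring.
  move=> E; rewrite EFinM -E -ge0_integralZl//.
  + by apply: eq_integral => s _; rewrite -EFinM; congr EFin; rewrite -mulrA (mulrC (expR _)).
  + apply/measurable_EFinP; apply: measurable_funTS; apply: measurable_funM; first exact: measurable_powR.
    apply: measurableT_comp => //; apply: measurableT_comp => //; exact: measurable_funM.
  + by move=> s _; rewrite lee_fin mulr_ge0 ?powR_ge0 ?expR_ge0.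
  + by rewrite lee_fin powR_ge0.
Qed.

Lemma laguerre_fun_heat k t x : 0 < t ->
  mu.-integrable setT (fun y => (heat t x y * laguerre_fun alpha k y)%:E) /\
  (\int[mu]_y (heat t x y * laguerre_fun alpha k y)%:E =
   (expR (- t * laguerre_eigenvalue alpha k) * laguerre_fun alpha k x)%:E)%E.
Proof.
move=> t0.
pose F i s := heat1 (tnth alpha i) t (tnth x i) s * (0 < t)%R%:R * laguerre_fun1 (tnth alpha i) (tnth k i) s.
pose I i := expR (- t * eigen1 (tnth alpha i) (tnth k i)) * laguerre_fun1 (tnth alpha i) (tnth k i) (tnth x i).
have E : (fun y => (heat t x y * laguerre_fun alpha k y)%:E) =
    (fun y => (\prod_(i < d) F i (tnth y i))%:E).
  apply/funext => y; rewrite /heat t0 mulr1 /laguerre_fun -big_split/=; congr EFin.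
  by apply: eq_bigr => i _; rewrite /F t0 mulr1.
have F1 i : F i = fun s => heat1 (tnth alpha i) t (tnth x i) s * laguerre_fun1 (tnth alpha i) (tnth k i) s.
  by apply/funext => s; rewrite /F t0 mulr1.
rewrite E laguerre_eigenvalueE mulr_sumr expR_sum /laguerre_fun -big_split/=.
apply: integral_laguerre_prod.
- move=> i; apply: measurable_funM; last exact: measurable_laguerre_fun1.
  by apply: measurable_heat1 => //; exact: measurable_cst.
- by move=> i; have [h _] := eigen1_heat1 (tnth k i) (tnth x i) (a0 i) t0; rewrite F1.
- by move=> i; have [_ h] := eigen1_heat1 (tnth k i) (tnth x i) (a0 i) t0; rewrite F1.
Qed.

End heat_kernel.

Section lebesgue_half_line.
Context {R : realType}.
Local Notation leb := (@lebesgue_measure R).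
Local Opaque Gamma.
Local Open Scope ereal_scope.

Lemma integral_mkcond_r (A : set R) (f : R -> R) (b : R -> bool) : (forall t, b t = (t \in A)) ->
  \int[leb]_t (f t * (b t)%:R)%:E = \int[leb]_(t in A) (f t)%:E.
Proof.
move=> bA; rewrite [RHS]integral_mkcond; apply: eq_integral => t _.
by rewrite patchE bA; case: ifPn => _; rewrite ?mulr1 ?mulr0.
Qed.

Lemma lebesgue_gamma (c b : R) : (0 < c)%R -> (0 < b)%R -> exists M : R,
  \int[leb]_t (t `^ (c - 1) * expR (- (b * t)) * (0 < t)%R%:R)%:E <= M%:E.
Proof.
move=> c0 b0; exists (Gamma c / b `^ c)%R; rewrite -integral_powR_expR//.
rewrite (@integral_mkcond_r `]0%R, +oo[%classic)// => t.
by rewrite mem_setE in_itv/= andbT.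
Qed.

Lemma lebesgue_small (c A : R) : (0 < c)%R -> (0 < A)%R ->
  \int[leb]_t (t `^ (c - 1) * (0 < t <= A)%R%:R)%:E <= (A `^ c / c)%:E.
Proof.
move=> c0 A0; rewrite (@integral_mkcond_r `]0%R, A]%classic); last first.
  by move=> t; rewrite mem_setE in_itv.
rewrite mulrC EFinM -integral_powR_itv0// -ge0_integralZl//.
- rewrite le_eqVlt; apply/orP; left; apply/eqP; apply: eq_integral => t _.
  by rewrite -EFinM mulrA mulVf ?mul1r// gt_eqF.
- apply/measurable_EFinP; apply: measurable_funTS; exact: measurable_funM.
- by move=> t _; rewrite lee_fin mulr_ge0 ?powR_ge0 ?(ltW c0).
- by rewrite lee_fin invr_ge0 ltW.
Qed.

Lemma lebesgue_large (c A : R) : (0 < c)%R -> (0 < A)%R ->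
  \int[leb]_t (t `^ (- c - 1) * (A <= t)%R%:R)%:E <= (A `^ (- c) / c)%:E.
Proof.
move=> c0 A0; rewrite (@integral_mkcond_r `[A, +oo[%classic); last first.
  by move=> t; rewrite mem_setE in_itv/= andbT.
rewrite mulrC EFinM -integral_powR_itvy// -ge0_integralZl//.
- rewrite le_eqVlt; apply/orP; left; apply/eqP; apply: eq_integral => t _.
  by rewrite -EFinM mulrA mulVf ?mul1r// gt_eqF.
- apply/measurable_EFinP; apply: measurable_funTS; exact: measurable_funM.
- by move=> t _; rewrite lee_fin mulr_ge0 ?powR_ge0 ?(ltW c0).
- by rewrite lee_fin invr_ge0 ltW.
Qed.

End lebesgue_half_line.

(** The integral is the difference of those of the positive and negative parts, each measurable by
    Tonelli. It serves for potentials of signed functions, where that difference may be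
    indeterminate at some points. *)
Lemma measurable_integral_fst d1 d2 (T1 : measurableType d1) (T2 : measurableType d2)
    (R : realType) (m2 : {sigma_finite_measure set T2 -> \bar R}) (f : T1 -> T2 -> \bar R) :
  measurable_fun setT (fun z : T1 * T2 => f z.1 z.2) ->
  measurable_fun setT (fun x => \int[m2]_y f x y)%E.
Proof.
move=> mf.
rewrite (_ : (fun x => _) = (fun x => (\int[m2]_y ((f x)^\+ y) - \int[m2]_y ((f x)^\- y))%E)); last first.
  by apply/funext => x; rewrite integralE.
apply: emeasurable_funB.
  apply: (@measurable_fun_fubini_tonelli_F _ _ _ _ _ m2 (fun z : T1 * T2 => ((f z.1)^\+ z.2)%E)).
    rewrite (_ : (fun z => _) = ((fun z : T1 * T2 => f z.1 z.2)^\+)%E); first exact: measurable_funepos.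
  by apply/funext => z; rewrite !funeposE.
  by move=> z; exact: funepos_ge0.
apply: (@measurable_fun_fubini_tonelli_F _ _ _ _ _ m2 (fun z : T1 * T2 => ((f z.1)^\- z.2)%E)).
  rewrite (_ : (fun z => _) = ((fun z : T1 * T2 => f z.1 z.2)^\-)%E); first exact: measurable_funeneg.
  by apply/funext => z; rewrite !funenegE.
by move=> z; exact: funeneg_ge0.
Qed.

(** * Bounds for the potential up to its Gamma factor, and size of the Laguerre functions *)

Section heat_potential.
Context {R : realType} {d : nat}.
Variables (alpha : d.-tuple R) (sigma : R).
Hypothesis alpha_ge : forall i, 2^-1 <= tnth alpha i + 1.
Hypotheses (d_gt0 : (0 < d)%N) (sigma0 : 0 < sigma).
Local Notation leb := (@lebesgue_measure R).
Local Notation mu := (laguerre_measure alpha).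
Local Opaque Gamma.

Let a0 i : 0 < tnth alpha i + 1.
Proof. by apply: lt_le_trans (alpha_ge i). Qed.

Let D : R := tsum alpha + d%:R.

Lemma homogeneous_dim_gt0 : 0 < D.
Proof.
rewrite /D homogeneous_dimE; case: d d_gt0 alpha a0 => // n _ al al0.
rewrite big_ord_recl ltr_wpDr//; apply: sumr_ge0 => i _; exact: ltW.
Qed.
Let D0 := homogeneous_dim_gt0.

Lemma laguerre_eigenvalue_gt0 k : 0 < laguerre_eigenvalue alpha k.
Proof.
by rewrite /laguerre_eigenvalue -addrA -mulrDr -/D; apply: ltr_wpDl; rewrite ?mulr_ge0 ?mulr_gt0.
Qed.

Local Notation S1 := (\prod_i (2 / Gamma (tnth alpha i + 1))).
Local Notation S2 := (\prod_i (Gamma (tnth alpha i + 1) / 2 * 4 `^ (tnth alpha i + 1))).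

Let S1_gt0 : 0 < S1.
Proof. by apply: prodr_gt0 => i _; rewrite divr_gt0 ?Gamma_gt0. Qed.

Let S2_gt0 : 0 < S2.
Proof. by apply: prodr_gt0 => i _; rewrite mulr_gt0 ?divr_gt0 ?Gamma_gt0 ?powR_gt0. Qed.

Let mheat : measurable_fun setT (fun z : d.-tuple R * d.-tuple R * measurableTypeR R =>
  heat alpha z.2 z.1.1 z.1.2).
Proof.
apply: (measurable_heat (t := snd) alpha_ge).
- exact: measurable_snd.
- by apply: measurableT_comp => //; exact: measurable_fst.
- by apply: measurableT_comp => //; exact: measurable_fst.
Qed.

Definition heat_potential (h : d.-tuple R -> R) : d.-tuple R -> \bar R :=
  pre_potential mu leb (id : measurableTypeR R -> R) (heat alpha) sigma h.

Lemma heat_potential_bound (p q : R) : 1 <= p -> 1 <= q ->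
  D * `|p^-1 - q^-1| < sigma \/ [/\ sigma < D, 1 < p & q^-1 = p^-1 - sigma / D] ->
  exists2 C : R, 0 <= C & forall h : d.-tuple R -> R, measurable_fun setT h ->
    (forall x, 0 <= h x) -> (\int[mu]_x (h x `^ p)%:E < +oo)%E ->
    ((\int[mu]_x (heat_potential h x `^ q)) `^ q^-1 <= C%:E * (\int[mu]_x (h x `^ p)%:E) `^ p^-1)%E.
Proof.
(* [S1] bounds the kernel pointwise and [S2] its double integral; the abstract estimate has a single
   constant for both, hence the sum. B = 2^D and beta = 2 D come from [integral_heat_le]. *)
apply: (@pre_potential_bound _ _ _ (measurableTypeR R) R mu leb id (heat alpha) D (S1 + S2)
  (2 `^ D) (2 * D) sigma) => //.
- by move=> t x y; exact: heat_ge0.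
- by move=> t x y; exact: heat_le0.
- by rewrite addr_gt0.
- by rewrite mulr_gt0.
- move=> t x y t0; apply: le_trans (heat_le alpha_ge x y t0) _.
  by rewrite ler_wpM2r ?powR_ge0// lerDl ltW.
- by move=> t x t0; exact: integral_heat_le.
- move=> t y t0; under eq_integral do rewrite heatC.
  exact: integral_heat_le.
- move=> t t0; apply: le_trans (integral2_heat_le alpha_ge t0) _.
  by rewrite lee_fin ler_wpM2r ?powR_ge0// lerDr ltW.
- exact: lebesgue_gamma.
- exact: lebesgue_small.
- exact: lebesgue_large.
Qed.

Local Open Scope ereal_scope.

Lemma measurable_laguerre_fun k : measurable_fun setT (laguerre_fun alpha k).
Proof.
apply: measurable_prod => i _.
apply: (measurableT_comp (measurable_laguerre_fun1 _ _)); exact: measurable_tnth.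
Qed.

Lemma laguerre_fun_sqr k : \int[mu]_x (laguerre_fun alpha k x ^+ 2)%:E = 1.
Proof.
have [_] := @integral_laguerre_prod R d alpha
  (fun i s => laguerre_fun1 (tnth alpha i) (tnth k i) s * laguerre_fun1 (tnth alpha i) (tnth k i) s)%R
  (fun=> 1%R) (fun i => measurable_funM (measurable_laguerre_fun1 _ _) (measurable_laguerre_fun1 _ _))
  (fun i => (laguerre_fun1_ortho (tnth k i) (tnth k i) (a0 i)).1)
  (fun i => etrans (laguerre_fun1_ortho (tnth k i) (tnth k i) (a0 i)).2 (congr1 (fun b : bool => (b%:R)%:E) (eqxx _))).
rewrite big1// => <-; apply: eq_integral => x _.
by congr EFin; rewrite /= big_split/= expr2.
Qed.

Let mheat2 t x : measurable_fun setT (heat alpha t x).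
Proof. by apply: (measurable_heat alpha_ge) => //; exact: measurable_cst. Qed.

(* [l = expR lam * \int G_1 l], and [`|l| <= 1 + l ^+ 2] under the integral. *)
Lemma laguerre_fun_bounded k : exists2 M : R, (0 <= M)%R & forall x, (`|laguerre_fun alpha k x| <= M)%R.
Proof.
pose S := (S1 * 1 `^ (- D))%R.
have S0 : (0 <= S)%R by rewrite mulr_ge0 ?powR_ge0 ?(ltW S1_gt0).
pose B := (2 `^ D * expR (- (2 * D * 1)))%R.
pose lam := laguerre_eigenvalue alpha k.
exists (expR lam * (B + S))%R; first by rewrite mulr_ge0 ?addr_ge0 ?expR_ge0 ?mulr_ge0 ?powR_ge0 ?expR_ge0 ?(ltW S1_gt0).
move=> x; have [ih Ih] := laguerre_fun_heat alpha_ge k x ltr01.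
have ml := measurable_laguerre_fun k.
have : `|(expR (- 1 * lam) * laguerre_fun alpha k x)%:E| <= (B + S)%:E.
  rewrite -Ih; apply: le_trans (le_abse_integral _ measurableT _) _.
    by case/integrableP: ih.
  apply: (@le_trans _ _ (\int[mu]_y ((heat alpha 1 x y)%:E + (S * laguerre_fun alpha k y ^+ 2)%:E))).
    apply: ge0_le_integral => //.
    - by apply: measurableT_comp => //; case/integrableP: ih.
    - apply: emeasurable_funD; apply/measurable_EFinP => //.
      by apply: measurable_funM => //; exact: measurable_funX.
    move=> y _; rewrite lee_fin normrM (ger0_norm (heat_ge0 alpha_ge _ _ _)).
    have hS : (heat alpha 1 x y <= S)%R by exact: heat_le.
    have h0 : (0 <= heat alpha 1 x y)%R by exact: heat_ge0.
    rewrite -(real_normK (num_real (laguerre_fun _ _ _))).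
    have := normr_ge0 (laguerre_fun alpha k y); set l := `|_|%R; move=> l0.
    apply: (@le_trans _ _ (heat alpha 1 x y * (1 + l ^+ 2))%R).
      by rewrite ler_wpM2l//; nra.
    by rewrite mulrDr mulr1 lerD2l ler_wpM2r ?sqr_ge0.
  rewrite ge0_integralD//; first last.
  - apply/measurable_EFinP; apply: measurable_funM => //; exact: measurable_funX.
  - by move=> y _; rewrite lee_fin mulr_ge0 ?sqr_ge0.
  - exact/measurable_EFinP.
  - by move=> y _; rewrite lee_fin heat_ge0.
  rewrite EFinD leeD//; first exact: integral_heat_le.
  under eq_integral do rewrite EFinM.
  rewrite ge0_integralZl ?lee_fin//.
  - by rewrite laguerre_fun_sqr mule1.
  - apply/measurable_EFinP; exact: measurable_funX.
  - by move=> y _; rewrite lee_fin sqr_ge0.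
rewrite lee_fin normrM gtr0_norm ?expR_gt0// => h.
have -> : (`|laguerre_fun alpha k x| = expR lam * (expR (- 1 * lam) * `|laguerre_fun alpha k x|))%R.
  by rewrite mulrA -expRD mulN1r subrr expR0 mul1r.
by rewrite ler_wpM2l ?expR_ge0.
Qed.

(** If M bounds |l_k|, then |l_k(x)| is at most exp(lambda_k) M times the integral of G_1(x, y) in
    y, and the double integral of G_1 is finite. *)
Lemma laguerre_fun_integrable k : mu.-integrable setT (EFin \o laguerre_fun alpha k).
Proof.
have [M M0 HM] := laguerre_fun_bounded k.
have ml := measurable_laguerre_fun k.
apply/integrableP; split; first exact/measurable_EFinP.
pose lam := laguerre_eigenvalue alpha k.
have mh2 : measurable_fun setT (fun z : d.-tuple R * d.-tuple R => (heat alpha 1 z.1 z.2)%:E).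
  apply/measurable_EFinP; apply: (measurable_heat alpha_ge) => //; exact: measurable_cst.
have mi : measurable_fun setT (fun x => \int[mu]_y (heat alpha 1 x y)%:E).
  by apply: (measurable_fun_fubini_tonelli_F _ mh2) => z; rewrite lee_fin heat_ge0.
apply: (@le_lt_trans _ _ (\int[mu]_x ((expR lam * M)%:E * \int[mu]_y (heat alpha 1 x y)%:E))).
  apply: ge0_le_integral => //.
  - by apply: measurableT_comp => //; exact/measurable_EFinP.
  - exact: emeasurable_funM.
  move=> x _; have [ih Ih] := laguerre_fun_heat alpha_ge k x ltr01.
  have E : `|(laguerre_fun alpha k x)%:E| =
      (expR lam)%:E * `|\int[mu]_y (heat alpha 1 x y * laguerre_fun alpha k y)%:E|.
    rewrite Ih /= -EFinM; congr EFin; rewrite normrM (gtr0_norm (expR_gt0 _)).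
    by rewrite mulrA -expRD mulN1r subrr expR0 mul1r.
  rewrite [leLHS]E [in leRHS]EFinM -muleA lee_wpmul2l ?lee_fin ?expR_ge0//.
  apply: le_trans (le_abse_integral _ measurableT _) _.
    by case/integrableP: ih.
  rewrite -ge0_integralZl ?lee_fin//; first last.
  - by move=> y _; rewrite lee_fin heat_ge0.
  - exact/measurable_EFinP.
  apply: ge0_le_integral => //.
  - by apply: measurableT_comp => //; case/integrableP: ih.
  - by apply: emeasurable_funM => //; exact/measurable_EFinP.
  move=> y _; rewrite lee_fin normrM (ger0_norm (heat_ge0 alpha_ge _ _ _)) mulrC.
  by rewrite ler_wpM2r// heat_ge0.
rewrite ge0_integralZl//.
- apply: lte_mul_pinfty; rewrite ?lee_fin ?mulr_ge0 ?expR_ge0//.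
  by apply: le_lt_trans (integral2_heat_le alpha_ge ltr01) _; rewrite ltry.
- by move=> x _; apply: integral_ge0 => y _; rewrite lee_fin heat_ge0.
- by rewrite lee_fin mulr_ge0 ?expR_ge0.
Qed.

End heat_potential.

Lemma ge0_integralZl_real d (T : measurableType d) (R : realType) (mu : {measure set T -> \bar R})
    (c : R) (f : T -> \bar R) : measurable_fun setT f -> (forall x, 0 <= f x)%E ->
  (\int[mu]_x (c%:E * f x) = c%:E * \int[mu]_x f x)%E.
Proof.
move=> mf f0; have [c0|c0] := leP 0 c; first by rewrite ge0_integralZl// lee_fin.
have -> : (fun x => c%:E * f x)%E = (fun x => - ((- c)%:E * f x))%E.
  by apply/funext => x; rewrite EFinN mulNe oppeK.
have nc0 : (0 <= (- c)%:E)%E by rewrite lee_fin oppr_ge0 ltW.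
rewrite integral_ge0N; last by move=> x _; rewrite mule_ge0.
by rewrite ge0_integralZl// EFinN mulNe oppeK.
Qed.

Lemma ge0_integral_poweRZl d (T : measurableType d) (R : realType) (mu : {measure set T -> \bar R})
    (c q : R) (f : T -> \bar R) : measurable_fun setT f -> (forall x, 0 <= f x)%E ->
  0 <= c -> 0 < q ->
  ((\int[mu]_x ((c%:E * f x) `^ q)) `^ q^-1 = c%:E * (\int[mu]_x (f x `^ q)) `^ q^-1)%E.
Proof.
move=> mf f0 c0 q0.
under eq_integral do rewrite poweRM// poweR_EFin.
rewrite ge0_integralZl//.
- rewrite poweRM; last 2 first.
  + by rewrite lee_fin powR_ge0.
  + by apply: integral_ge0 => x _; exact: poweR_ge0.
  by rewrite poweR_EFin -powRrM divff ?gt_eqF// powRr1.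
- by apply: (measurableT_comp (measurable_poweR _)).
- by move=> x _; exact: poweR_ge0.
- by rewrite lee_fin powR_ge0.
Qed.

(** * The potential operator on real functions *)

Section potential_real.
Context {R : realType} {d : nat}.
Variables (alpha : d.-tuple R) (sigma : R).
Hypothesis alpha_ge : forall i, 2^-1 <= tnth alpha i + 1.
Hypotheses (d_gt0 : (0 < d)%N) (sigma0 : 0 < sigma).
Local Notation leb := (@lebesgue_measure R).
Local Notation mu := (laguerre_measure alpha).
Local Notation K := (potential_kernel alpha sigma).
Local Notation lag := (laguerre_fun alpha).
Local Notation lam := (laguerre_eigenvalue alpha).
Local Opaque Gamma.
Local Open Scope ereal_scope.

Let k (x y : d.-tuple R) (t : R) : R := (t `^ (sigma - 1) * heat alpha t x y)%R.

Let k0 x y t : 0 <= (k x y t)%:E.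
Proof. by rewrite lee_fin mulr_ge0 ?powR_ge0 ?heat_ge0. Qed.

Let kg0 x y t (c : R) : (0 <= c)%R -> 0 <= (k x y t * c)%:E.
Proof. by move=> c0; rewrite EFinM mule_ge0// lee_fin. Qed.

Let mk : measurable_fun setT
  (fun z : d.-tuple R * d.-tuple R * measurableTypeR R => (k z.1.1 z.1.2 z.2)%:E).
Proof.
apply/measurable_EFinP; apply: measurable_funM.
  apply: (measurableT_comp (measurable_powR _)); exact: measurable_snd.
apply: (measurable_heat (t := snd) alpha_ge).
- exact: measurable_snd.
- by apply: measurableT_comp => //; exact: measurable_fst.
- by apply: measurableT_comp => //; exact: measurable_fst.
Qed.

Let Gi0 : (0 <= (Gamma sigma)^-1 :> R)%R.
Proof. by rewrite invr_ge0 ltW// Gamma_gt0. Qed.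

Lemma potential_kernelE x y : K x y = (Gamma sigma)^-1%:E * \int[leb]_t (k x y t)%:E.
Proof.
rewrite /potential_kernel; congr (_ * _); rewrite integral_mkcond; apply: eq_integral => t _.
rewrite patchE mem_setE in_itv/= andbT /k.
have [t0|t0] := ltP 0%R t; last by rewrite heat_le0// mulr0.
by rewrite heat_kernelE// mulrC.
Qed.

Lemma potential_kernel_ge0 x y : 0 <= K x y.
Proof.
by rewrite potential_kernelE mule_ge0 ?lee_fin//; apply: integral_ge0 => t _.
Qed.

Lemma measurable_potential_kernel :
  measurable_fun setT (fun z : d.-tuple R * d.-tuple R => K z.1 z.2).
Proof.
rewrite (_ : (fun z => _) = (fun z : d.-tuple R * d.-tuple R =>
    (Gamma sigma)^-1%:E * \int[leb]_t (k z.1 z.2 t)%:E)); last first.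
  by apply/funext => z; rewrite potential_kernelE.
apply: emeasurable_funM => //.
exact: (@measurable_integral3 _ _ _ _ _ _ _ leb (fun x y t => (k x y t)%:E) k0 mk).
Qed.

(** The integral extends over all of R^d, as [mu] does not charge the complement of the orthant. *)
Definition potential_real (g : d.-tuple R -> R) (x : d.-tuple R) : \bar R :=
  \int[mu]_y (K x y * (g y)%:E).

Lemma measurable_kernel_mul g : measurable_fun setT g ->
  measurable_fun setT (fun z : d.-tuple R * d.-tuple R => K z.1 z.2 * (g z.2)%:E).
Proof.
move=> mg; apply: emeasurable_funM; first exact: measurable_potential_kernel.
by apply/measurable_EFinP; exact: measurableT_comp.
Qed.

Lemma measurable_kernel_section g x : measurable_fun setT g ->
  measurable_fun setT (fun y => K x y * (g y)%:E).
Proof.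
move=> mg; apply: (measurableT_comp (measurable_kernel_mul mg) (g := fun y => (x, y))).
exact: measurable_fun_pair.
Qed.

Lemma measurable_potential_real g : measurable_fun setT g ->
  measurable_fun setT (potential_real g).
Proof. by move=> mg; exact: (measurable_integral_fst mu (measurable_kernel_mul mg)). Qed.

Lemma potential_real_ge0 g x : (forall y, 0 <= g y)%R -> 0 <= potential_real g x.
Proof.
by move=> g0; apply: integral_ge0 => y _; rewrite mule_ge0 ?lee_fin// potential_kernel_ge0.
Qed.

Lemma potential_realE (g : d.-tuple R -> R) x : measurable_fun setT g -> (forall y, 0 <= g y)%R ->
  potential_real g x = (Gamma sigma)^-1%:E * heat_potential alpha sigma g x.
Proof.
move=> mg g0.
have mk1 y : measurable_fun setT (fun t : measurableTypeR R => (k x y t)%:E).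
  apply: (measurableT_comp mk (g := fun t => (x, y, t))); exact: measurable_fun_pair.
have mkg : measurable_fun setT (fun z : d.-tuple R * d.-tuple R * measurableTypeR R =>
    (k z.1.1 z.1.2 z.2)%:E * (g z.1.2)%:E).
  apply: emeasurable_funM => //; apply/measurable_EFinP; apply: (measurableT_comp mg).
  by apply: measurableT_comp => //; exact: measurable_fst.
rewrite /heat_potential /pre_potential -ge0_integralZl//; first last.
- by move=> y _; apply: integral_ge0 => t _; exact: kg0.
- rewrite (_ : (fun y => _) = (fun y => \int[leb]_t ((k x y t)%:E * (g y)%:E))); last first.
    by apply/funext => y; apply: eq_integral => t _; rewrite EFinM.
  apply: (measurableT_comp (@measurable_integral3 _ _ _ _ _ _ _ leb
    (fun x y t => (k x y t)%:E * (g y)%:E) _ mkg) (g := fun y => (x, y))).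
    by move=> x' y' t; rewrite mule_ge0// lee_fin.
  exact: measurable_fun_pair.
apply: eq_integral => y _; rewrite potential_kernelE -muleA; congr (_ * _).
transitivity (\int[leb]_t ((g y)%:E * (k x y t)%:E)); first by rewrite ge0_integralZl ?lee_fin// muleC.
by apply: eq_integral => t _; rewrite muleC.
Qed.

Lemma potential_real_bound (p q : R) : (1 <= p)%R -> (1 <= q)%R ->
  ((tsum alpha + d%:R) * `|p^-1 - q^-1| < sigma \/ [/\ sigma < tsum alpha + d%:R, 1 < p &
     q^-1 = p^-1 - sigma / (tsum alpha + d%:R)])%R ->
  exists2 C : R, (0 <= C)%R & forall h : d.-tuple R -> R, measurable_fun setT h ->
    (forall x, 0 <= h x)%R -> \int[mu]_x (h x `^ p)%:E < +oo ->
    (\int[mu]_x (potential_real h x `^ q)) `^ q^-1 <= C%:E * (\int[mu]_x (h x `^ p)%:E) `^ p^-1.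
Proof.
move=> p1 q1 pq; have q0 : (0 < q)%R by apply: lt_le_trans q1.
have [C C0 HC] := heat_potential_bound alpha_ge d_gt0 sigma0 p1 q1 pq.
exists ((Gamma sigma)^-1 * C)%R; first by rewrite mulr_ge0.
move=> h mh h0 ih.
have hE x : potential_real h x = (Gamma sigma)^-1%:E * heat_potential alpha sigma h x.
  exact: potential_realE.
have mH : measurable_fun setT (heat_potential alpha sigma h).
  rewrite (_ : heat_potential alpha sigma h = (fun x => (Gamma sigma)%:E * potential_real h x)).
    by apply: emeasurable_funM => //; exact: measurable_potential_real.
  by apply/funext => x; rewrite hE muleA -EFinM divff ?mul1e// gt_eqF// Gamma_gt0.
have H0 x : 0 <= heat_potential alpha sigma h x.
  by apply: integral_ge0 => y _; apply: integral_ge0 => t _; exact: kg0.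
under eq_integral do rewrite hE.
rewrite ge0_integral_poweRZl//.
by rewrite EFinM -muleA lee_wpmul2l ?lee_fin//; exact: HC.
Qed.

(** In place of a Holder inequality: F |l| <= |l| where F <= 1, and F |l| <= M F^r where F > 1. It
    is applied to |g| with r = p and to the potential of |g| with r = q. *)
Lemma laguerre_fun_mul_lty n (F : d.-tuple R -> \bar R) (r : R) : (1 <= r)%R ->
  measurable_fun setT F -> (forall x, 0 <= F x) -> \int[mu]_x (F x `^ r) < +oo ->
  \int[mu]_x (F x * `|lag n x|%:E) < +oo.
Proof.
move=> r1 mF F0 iF; have [M M0 HM] := laguerre_fun_bounded alpha_ge n.
have /integrableP[ml il] := laguerre_fun_integrable alpha_ge n.
have mFr : measurable_fun setT (fun x => F x `^ r).
  by apply: (measurableT_comp (measurable_poweR _)).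
have ml' : measurable_fun setT (fun x => `|lag n x|%:E).
  by apply/measurable_EFinP; apply: measurableT_comp => //; exact/measurable_EFinP.
apply: (@le_lt_trans _ _ (\int[mu]_x (`|lag n x|%:E + M%:E * F x `^ r))).
  apply: ge0_le_integral => //.
  - by move=> x _; rewrite mule_ge0// lee_fin.
  - exact: emeasurable_funM.
  - by apply: emeasurable_funD => //; exact: emeasurable_funM.
  move=> x _; have [F1|F1] := leP (F x) 1.
    apply: (@le_trans _ _ (1 * `|lag n x|%:E)); first by rewrite lee_wpmul2r// lee_fin.
    by rewrite mul1e leeDl// mule_ge0 ?lee_fin// poweR_ge0.
  apply: (@le_trans _ _ (M%:E * F x `^ r)); last by rewrite leeDr// lee_fin.
  rewrite muleC; apply: lee_pmul => //; rewrite ?lee_fin//.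
  case: (F x) F1 => [s s1||//]; last by rewrite poweRyr// gt_eqF// (lt_le_trans _ r1).
  move: s1; rewrite lte_fin => s1; rewrite poweR_EFin lee_fin -[leLHS]powRr1; last by rewrite ltW// (lt_trans _ s1).
  by rewrite ler_powR// ltW.
rewrite ge0_integralD//; last 2 first.
- by move=> x _; rewrite mule_ge0 ?lee_fin ?poweR_ge0.
- exact: emeasurable_funM.
rewrite lte_add_pinfty// ge0_integralZl ?lee_fin//; last by move=> x _; exact: poweR_ge0.
by apply: lte_mul_pinfty; rewrite ?lee_fin.
Qed.

(** Fubini in (x, t): the eigenfunction identity at fixed t leaves the Gamma integral of t^(sigma-1)
    exp(-lambda t). Absolute convergence holds because l_n is bounded and the x-integral of G_t
    decays exponentially. *)
Lemma laguerre_fun_kernel n y :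
  mu.-integrable setT (fun x => K x y * (lag n x)%:E) /\
  \int[mu]_x (K x y * (lag n x)%:E) = (lam n `^ (- sigma) * lag n y)%:E.
Proof.
have [M M0 HM] := laguerre_fun_bounded alpha_ge n.
have ml := @measurable_laguerre_fun R d alpha n.
pose f (z : d.-tuple R * measurableTypeR R) := (k z.1 y z.2)%:E * (lag n z.1)%:E.
have mk' : measurable_fun setT (fun z : d.-tuple R * measurableTypeR R => (k z.1 y z.2)%:E).
  apply: (measurableT_comp mk (g := fun z : d.-tuple R * measurableTypeR R => (z.1, y, z.2))).
  by apply: measurable_fun_pair => //; exact: measurable_fun_pair.
have mf : measurable_fun setT f.
  by apply: emeasurable_funM => //; apply/measurable_EFinP; exact: measurableT_comp.
have l0 : (0 < lam n)%R by exact: (laguerre_eigenvalue_gt0 alpha_ge d_gt0).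
have D0 : (0 < tsum alpha + d%:R)%R by exact: (homogeneous_dim_gt0 alpha_ge d_gt0).
set D := (tsum alpha + d%:R)%R in D0.
have mkt t : measurable_fun setT (fun x => (k x y t)%:E).
  by apply: (measurableT_comp mk' (g := fun x => (x, t))); exact: measurable_fun_pair.
have mheat t : measurable_fun setT (fun x => (heat alpha t x y)%:E).
  by apply/measurable_EFinP; apply: (measurable_heat alpha_ge) => //; exact: measurable_cst.
have hk t : (0 < t)%R -> \int[mu]_x (heat alpha t x y)%:E <= (2 `^ D * expR (- (2 * D * t)))%:E.
  by move=> t0; under eq_integral do rewrite heatC; exact: integral_heat_le.
have ift : \int[leb]_t \int[mu]_x `|f (x, t)| < +oo.
  have D2 : (0 < 2 * D)%R by rewrite mulr_gt0.
  have [M' HM'] := lebesgue_gamma sigma0 D2.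
  have mphi : measurable_fun setT (fun t : measurableTypeR R =>
      (t `^ (sigma - 1) * expR (- (2 * D * t)) * (0 < t)%R%:R)%:E).
    apply/measurable_EFinP; apply: measurable_funM.
      apply: measurable_funM; first exact: (measurableT_comp (measurable_powR _)).
      by apply: measurableT_comp => //; apply: measurableT_comp => //; exact: measurable_funM.
    apply: measurable_fun_boolr; apply: measurable_fun_ltr; first exact: measurable_cst.
    exact: measurable_id.
  apply: (@le_lt_trans _ _ (\int[leb]_t ((M * 2 `^ D)%:E * (t `^ (sigma - 1) * expR (- (2 * D * t)) * (0 < t)%R%:R)%:E))).
    apply: ge0_le_integral => //.
    - by move=> t _; exact: integral_ge0.
    - apply: (@measurable_fun_fubini_tonelli_G _ _ _ _ _ mu (fun z => `|f z|)) => //.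
      exact: measurableT_comp.
    - exact: emeasurable_funM.
    move=> t _; have [t0|t0] := ltP 0%R t; last first.
      rewrite mulr0 mule0 integral0_eq// => x _.
      by rewrite /f /k heat_le0// mulr0 mul0e abse0.
    apply: (@le_trans _ _ (\int[mu]_x ((M * t `^ (sigma - 1))%:E * (heat alpha t x y)%:E))).
      apply: ge0_le_integral => //.
      - apply: measurableT_comp => //; apply: (measurableT_comp mf (g := fun x => (x, t))).
        exact: measurable_fun_pair.
      - exact: emeasurable_funM.
      move=> x _; rewrite /f /= lee_fin normrM ger0_norm -?lee_fin// lee_fin /k mulrC -mulrA.
      by rewrite ler_wpM2r// mulr_ge0 ?powR_ge0 ?heat_ge0.
    have Mt0 : (0 <= M * t `^ (sigma - 1))%R by rewrite mulr_ge0 ?powR_ge0.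
    rewrite ge0_integralZl ?lee_fin//; last by move=> x _; rewrite lee_fin heat_ge0.
    apply: le_trans (lee_wpmul2l _ (hk _ t0)) _; first by rewrite lee_fin.
    by rewrite -!EFinM lee_fin mulr1 le_eqVlt; apply/orP; left; apply/eqP; ring.
  have M20 : (0 <= M * 2 `^ D)%R by rewrite mulr_ge0 ?powR_ge0.
  rewrite ge0_integralZl ?lee_fin//; last first.
    by move=> t _; rewrite lee_fin !mulr_ge0 ?powR_ge0 ?expR_ge0.
  apply: lte_mul_pinfty; rewrite ?lee_fin//.
  by apply: le_lt_trans HM' _; rewrite ltry.
have intf : (mu \x leb).-integrable setT f by apply/(integrable21ltyP mu leb mf).
have KE x : K x y * (lag n x)%:E = (Gamma sigma)^-1%:E * \int[leb]_t f (x, t).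
  rewrite potential_kernelE -muleA; congr (_ * _); rewrite /f /=.
  rewrite muleC -ge0_integralZl_real//; first by apply: eq_integral => t _; rewrite muleC.
  apply: (measurableT_comp mk' (g := fun t => (x, t))); exact: measurable_fun_pair.
have iF := integrable_fubini_F intf.
have -> : (fun x => K x y * (lag n x)%:E) = (fun x => (Gamma sigma)^-1%:E * \int[leb]_t f (x, t)).
  by apply/funext => x; rewrite KE.
split; first exact: integrableZl.
rewrite integralZl//.
rewrite (Fubini intf).
pose phi (t : R) : R := (t `^ (sigma - 1) * expR (- (lam n * t)) * (0 < t)%R%:R)%R.
have gE : \int[leb]_t (phi t)%:E = (Gamma sigma / lam n `^ sigma)%:E.
  rewrite -integral_powR_expR// (@integral_mkcond_r _ `]0%R, +oo[%classic)// => t.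
  by rewrite mem_setE in_itv/= andbT.
have mphi : measurable_fun setT (fun t : measurableTypeR R => (phi t)%:E).
  apply/measurable_EFinP; apply: measurable_funM.
    apply: measurable_funM; first exact: (measurableT_comp (measurable_powR _)).
    by apply: measurableT_comp => //; apply: measurableT_comp => //; exact: measurable_funM.
  apply: measurable_fun_boolr; apply: measurable_fun_ltr; first exact: measurable_cst.
  exact: measurable_id.
have phi0 t : 0 <= (phi t)%:E by rewrite lee_fin !mulr_ge0 ?powR_ge0 ?expR_ge0.
transitivity ((Gamma sigma)^-1%:E * \int[leb]_t ((lag n y)%:E * (phi t)%:E)).
  congr (_ * _); apply: eq_integral => t _.
  have [t0|t0] := leP t 0%R.
    rewrite /phi (ltNge 0%R) t0 mulr0 mule0 integral0_eq// => x _.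
    by rewrite /f /k heat_le0// mulr0 mul0e.
  have [ih Ih] := laguerre_fun_heat alpha_ge n y t0.
  rewrite /phi t0 mulr1.
  have -> : (\int[mu]_x f (x, t)) = \int[mu]_x ((t `^ (sigma - 1))%:E * (heat alpha t y x * lag n x)%:E).
    apply: eq_integral => x _.
    transitivity ((t `^ (sigma - 1) * heat alpha t x y * lag n x)%:E) => //.
    by rewrite -mulrA EFinM heatC.
  rewrite integralZl// Ih -!EFinM; congr EFin.
  by rewrite mulNr (mulrC t); ring.
rewrite ge0_integralZl_real// gE -!EFinM; congr EFin.
have G0 := Gamma_gt0 sigma0.
have ls : (lam n `^ sigma != 0)%R by rewrite gt_eqF// powR_gt0.
rewrite powRN; field; by rewrite ls gt_eqF.
Qed.

(** A function with integrable q-th power is finite almost everywhere. Applied to the modulus of f,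
    this is what places L^p in the natural domain of the operator. *)
Lemma potential_real_lty (p q C : R) : (1 <= q)%R ->
  (forall h : d.-tuple R -> R, measurable_fun setT h ->
    (forall x, 0 <= h x)%R -> \int[mu]_x (h x `^ p)%:E < +oo ->
    (\int[mu]_x (potential_real h x `^ q)) `^ q^-1 <= C%:E * (\int[mu]_x (h x `^ p)%:E) `^ p^-1) ->
  forall h : d.-tuple R -> R, measurable_fun setT h ->
  (forall x, 0 <= h x)%R -> \int[mu]_x (h x `^ p)%:E < +oo ->
  \int[mu]_x (potential_real h x `^ q) < +oo /\ {ae mu, forall x, potential_real h x < +oo}.
Proof.
move=> q1 HC h mh h0 ih; have q0 : (0 < q)%R by apply: lt_le_trans q1.
have P0 x : 0 <= potential_real h x by exact: potential_real_ge0.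
have mPq : measurable_fun setT (fun x => potential_real h x `^ q).
  by apply: (measurableT_comp (measurable_poweR _)); exact: measurable_potential_real.
have l : \int[mu]_x (potential_real h x `^ q) < +oo.
  apply: (@lty_poweRy _ _ q^-1); first by rewrite gt_eqF// invr_gt0.
  apply: le_lt_trans (HC h mh h0 ih) _.
  have : (\int[mu]_x (h x `^ p)%:E) `^ p^-1 \is a fin_num.
    apply: fin_num_poweR; rewrite ge0_fin_numE//.
    by apply: integral_ge0 => x _; rewrite lee_fin powR_ge0.
  by move=> hf; rewrite -(fineK hf) -EFinM ltry.
split=> //.
have : mu.-integrable setT (fun x => potential_real h x `^ q).
  apply/integrableP; split => //.
  by under eq_integral do rewrite gee0_abs ?poweR_ge0//.
move=> /(integrable_ae measurableT); apply: filterS => x /(_ I) h1.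
apply: (@lty_poweRy _ _ q); first by rewrite gt_eqF.
by rewrite -ge0_fin_numE// poweR_ge0.
Qed.

(** The potential of |g| lies in L^q, hence is integrable against |l_n|. This is the absolute
    convergence behind Fubini for K(x, y) g(y) l_n(x), after which [laguerre_fun_kernel] evaluates
    the x-integral. *)
Lemma potential_real_pairing (p q C : R) (g : d.-tuple R -> R) n : (1 <= p)%R -> (1 <= q)%R ->
  (forall h : d.-tuple R -> R, measurable_fun setT h ->
    (forall x, 0 <= h x)%R -> \int[mu]_x (h x `^ p)%:E < +oo ->
    (\int[mu]_x (potential_real h x `^ q)) `^ q^-1 <= C%:E * (\int[mu]_x (h x `^ p)%:E) `^ p^-1) ->
  measurable_fun setT g -> \int[mu]_x (`|g x| `^ p)%:E < +oo ->
  [/\ mu.-integrable setT (fun x => (g x * lag n x)%:E),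
      mu.-integrable setT (fun x => (fine (potential_real g x) * lag n x)%:E) &
      \int[mu]_x (fine (potential_real g x) * lag n x)%:E =
      (lam n `^ (- sigma))%:E * \int[mu]_x (g x * lag n x)%:E].
Proof.
move=> p1 q1 HC mg ig.
pose h x := `|g x|%R.
have mh : measurable_fun setT h by exact: measurableT_comp.
have h0 x : (0 <= h x)%R by exact: normr_ge0.
have [Pq Pae] := potential_real_lty q1 HC mh h0 ig.
have mP := measurable_potential_real mh.
have P0 x : 0 <= potential_real h x by exact: potential_real_ge0.
have ml := @measurable_laguerre_fun R d alpha n.
have mgl : measurable_fun setT (fun x => (g x * lag n x)%:E).
  by apply/measurable_EFinP; exact: measurable_funM.
have igl : mu.-integrable setT (fun x => (g x * lag n x)%:E).
  apply/integrableP; split => //.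
  have := @laguerre_fun_mul_lty n (fun x => (h x)%:E) p p1.
  under eq_integral do rewrite poweR_EFin.
  move=> H; apply: le_lt_trans (H _ _ _) => //; last exact/measurable_EFinP.
  by rewrite le_eqVlt; apply/orP; left; apply/eqP; apply: eq_integral => x _; rewrite /= normrM.
have iPl : \int[mu]_x (potential_real h x * `|lag n x|%:E) < +oo.
  exact: (@laguerre_fun_mul_lty n (potential_real h) q).
have Kg x y : `|K x y * (g y)%:E| = K x y * (h y)%:E.
  by rewrite abseM gee0_abs// potential_kernel_ge0.
have intK x : potential_real h x < +oo -> mu.-integrable setT (fun y => K x y * (g y)%:E).
  move=> hx; apply/integrableP; split; first exact: measurable_kernel_section.
  by under eq_integral do rewrite Kg.
have abs_le x : `|potential_real g x| <= potential_real h x.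
  apply: le_trans (le_abse_integral _ measurableT _) _; first exact: measurable_kernel_section.
  by under eq_integral do rewrite Kg.
(* At an infinite value [fine] returns 0, which respects the bound. *)
have fine_le x : `|(fine (potential_real g x))%:E| <= potential_real h x.
  apply: le_trans (abs_le x); by case: (potential_real g x) => //=; rewrite normr0 ?leey.
have mfl : measurable_fun setT (fun x => (fine (potential_real g x) * lag n x)%:E).
  apply/measurable_EFinP; apply: measurable_funM => //.
  by apply: (measurableT_comp (f := fine)) => //; exact: measurable_potential_real.
have ifl : mu.-integrable setT (fun x => (fine (potential_real g x) * lag n x)%:E).
  apply/integrableP; split => //; apply: le_lt_trans iPl.
  apply: ge0_le_integral => //.
  - exact: measurableT_comp.
  - apply: emeasurable_funM => //; apply/measurable_EFinP; exact: measurableT_comp.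
  - by move=> x _; rewrite EFinM abseM lee_wpmul2r.
split=> //.
pose F (z : d.-tuple R * d.-tuple R) := K z.1 z.2 * (g z.2)%:E * (lag n z.1)%:E.
have mF : measurable_fun setT F.
  apply: emeasurable_funM; first exact: measurable_kernel_mul.
  by apply/measurable_EFinP; exact: measurableT_comp.
have iF : (mu \x mu).-integrable setT F.
  apply/(integrable12ltyP mu mu mF); apply: le_lt_trans iPl.
  rewrite le_eqVlt; apply/orP; left; apply/eqP; apply: eq_integral => x _.
  rewrite /F /=; under eq_integral do rewrite abseM Kg.
  rewrite ge0_integralZr ?lee_fin//; first exact: measurable_kernel_section.
  by move=> y _; rewrite mule_ge0 ?potential_kernel_ge0 ?lee_fin.
transitivity (\int[mu]_x \int[mu]_y F (x, y)).
  (* Off the null set where the potential of |g| is infinite, [fine] does not alter the value. *)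
  apply: ae_eq_integral => //.
    by have /integrableP[] := integrable_fubini_F iF.
  apply: filterS Pae => x hx _; rewrite /F /=.
  rewrite integralZr//; last exact: intK.
  by rewrite EFinM fineK// fin_num_abs (le_lt_trans (abs_le x)).
rewrite (Fubini iF).
transitivity (\int[mu]_y ((lam n `^ (- sigma))%:E * (g y * lag n y)%:E)).
  apply: eq_integral => y _; rewrite /F /=.
  have [ik Ik] := laguerre_fun_kernel n y.
  have -> : (\int[mu]_x (K x y * (g y)%:E * (lag n x)%:E)) = \int[mu]_x ((g y)%:E * (K x y * (lag n x)%:E)).
    by apply: eq_integral => x _; rewrite muleAC muleC.
  rewrite integralZl// Ik -!EFinM; congr EFin; ring.
by rewrite integralZl.
Qed.

End potential_real.

(** * Complex-valued functions *)

Section normc.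
Context {R : rcfType}.
Local Notation normc := Normc.normc.

Lemma normc_ge0 (z : R[i]) : 0 <= normc z.
Proof. by case: z => a b; exact: sqrtr_ge0. Qed.

Lemma normc_ge_absRe (z : R[i]) : `|complex.Re z| <= normc z.
Proof. by case: z => a b /=; rewrite -sqrtr_sqr ler_wsqrtr// lerDl sqr_ge0. Qed.

Lemma normc_ge_absIm (z : R[i]) : `|complex.Im z| <= normc z.
Proof. by case: z => a b /=; rewrite -sqrtr_sqr ler_wsqrtr// lerDr sqr_ge0. Qed.

Lemma normc_le_abs (z : R[i]) : normc z <= `|complex.Re z| + `|complex.Im z|.
Proof.
case: z => a b /=.
have -> : `|a| + `|b| = Num.sqrt ((`|a| + `|b|) ^+ 2) 
  by rewrite sqrtr_sqr (ger0_norm (addr_ge0 (normr_ge0 a) (normr_ge0 b))).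
rewrite ler_wsqrtr//.
rewrite -(real_normK (num_real a)) -(real_normK (num_real b)).
have := normr_ge0 a; have := normr_ge0 b; nra.
Qed.

End normc.

Section potential_complex.
Context {R : realType} {d : nat}.
Variables (alpha : d.-tuple R) (sigma : R).
Hypothesis alpha_ge : forall i, 2^-1 <= tnth alpha i + 1.
Hypotheses (d_gt0 : (0 < d)%N) (sigma0 : 0 < sigma).
Local Notation T := (d.-tuple R).
Local Notation mu := (laguerre_measure alpha).
Local Notation K := (potential_kernel alpha sigma).
Local Notation lag := (laguerre_fun alpha).
Local Notation normc := Normc.normc.
Local Notation PS := (potential_real alpha sigma).
Local Opaque Gamma.

Let mO : measurable (orthant : set T). Proof. exact: measurable_orthant. Qed.

(** The given functions are measurable on the orthant and arbitrary elsewhere; extension by 0 makes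
    them measurable on all of R^d, where the real results are stated. *)
Definition ext0 (g : T -> R) (x : T) : R := if x \in orthant then g x else 0.

Lemma measurable_ext0 g : measurable_fun orthant g -> measurable_fun setT (ext0 g).
Proof. by move=> mg; exact: (measurable_restrictT g mO).1. Qed.

Lemma integral_orthant (F G : T -> \bar R) : (forall x, orthant x -> F x = G x) ->
  (forall x, ~ orthant x -> G x = 0)%E ->
  (\int[mu]_(x in orthant) F x = \int[mu]_x G x)%E.
Proof.
move=> FG G0; rewrite integral_mkcond; apply: eq_integral => x _; rewrite patchE.
by case: ifPn => xO; [rewrite FG//; rewrite inE in xO|rewrite G0//; rewrite notin_setE in xO].
Qed.

Lemma integrable_orthant (F G : T -> \bar R) : (forall x, orthant x -> F x = G x) ->
  mu.-integrable setT G -> mu.-integrable orthant F.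
Proof.
move=> FG iG; apply: (@eq_integrable _ T R mu orthant mO G F).
  by move=> x; rewrite inE => /FG.
exact: (integrableS measurableT mO (subsetT _)).
Qed.

Lemma ae_orthant : {ae mu, forall x, orthant x}.
Proof.
exists (~` orthant); split => //; first exact: measurableC.
by rewrite /laguerre_measure setICl integral_set0.
Qed.

Lemma integral_orthantT (F : T -> \bar R) : measurable_fun setT F ->
  (\int[mu]_(x in orthant) F x = \int[mu]_x F x)%E.
Proof.
move=> mF; rewrite integral_mkcond; apply: ae_eq_integral => //.
  exact: (measurable_restrictT F mO).1 (measurable_funTS mF).
by apply: filterS ae_orthant => x xO _; rewrite patchE mem_set.
Qed.

Lemma integral_ext0 (g : T -> R) x :
  (\int[mu]_(y in orthant) (K x y * (g y)%:E) = PS (ext0 g) x)%E.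
Proof.
apply: integral_orthant => y yO; rewrite /ext0; first by rewrite mem_set.
by rewrite memNset// mule0.
Qed.

Section Lp_function.
Variables (p : R) (f : T -> R[i]).
Hypotheses (p1 : 1 <= p) (Lpf : in_Lp alpha p f).
Let p0 : 0 < p. Proof. exact: lt_le_trans p1. Qed.

Let re := ext0 (fun x => complex.Re (f x)).
Let im := ext0 (fun x => complex.Im (f x)).
Definition modulus := ext0 (fun x => normc (f x)).

Lemma measurable_ext0_Re : measurable_fun setT re.
Proof. by apply: measurable_ext0; case: Lpf. Qed.

Lemma measurable_ext0_Im : measurable_fun setT im.
Proof. by apply: measurable_ext0; case: Lpf. Qed.

Lemma modulus_ge0 x : 0 <= modulus x.
Proof. by rewrite /modulus /ext0; case: ifP => // _; exact: normc_ge0. Qed.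

Lemma measurable_modulus : measurable_fun setT modulus.
Proof.
rewrite (_ : modulus = (fun x => (re x ^+ 2 + im x ^+ 2) `^ 2^-1)).
  apply: (measurableT_comp (measurable_powR _)); apply: measurable_funD.
    by apply: measurable_funX; exact: measurable_ext0_Re.
  by apply: measurable_funX; exact: measurable_ext0_Im.
apply/funext => x; rewrite powR12_sqrt ?addr_ge0 ?sqr_ge0// /modulus /re /im /ext0.
by case: ifP => _; [case: (f x)|rewrite expr0n addr0 sqrtr0].
Qed.

Lemma ext0_Re_le x : `|re x| <= modulus x.
Proof. by rewrite /re /modulus /ext0; case: ifP; rewrite ?normr0// normc_ge_absRe. Qed.

Lemma ext0_Im_le x : `|im x| <= modulus x.
Proof. by rewrite /im /modulus /ext0; case: ifP; rewrite ?normr0// normc_ge_absIm. Qed.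

End Lp_function.

Lemma Lp_normE (p : R) (f : T -> R[i]) : 0 < p ->
  Lp_norm alpha p f = ((\int[mu]_x (modulus f x `^ p)%:E) `^ p^-1)%E.
Proof.
move=> p0; rewrite /Lp_norm unlock; congr (_ `^ _)%E; apply: eq_integral => x _.
rewrite patchE /modulus /ext0; case: ifP => _.
  by rewrite gee0_abs ?lee_fin ?normc_ge0// poweR_EFin.
by rewrite abse0 poweR_EFin.
Qed.

Lemma in_Lp_lty (p : R) (f : T -> R[i]) : 1 <= p -> in_Lp alpha p f ->
  (\int[mu]_x (modulus f x `^ p)%:E < +oo)%E.
Proof.
move=> p1 [_ _]; have p0 : 0 < p by apply: lt_le_trans p1.
by rewrite Lp_normE//; apply: lty_poweRy; rewrite gt_eqF// invr_gt0.
Qed.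

Lemma modulus_lty (p : R) (f : T -> R[i]) (g : T -> R) : 1 <= p -> in_Lp alpha p f ->
  measurable_fun setT g -> (forall x, `|g x| <= modulus f x) ->
  (\int[mu]_x (`|g x| `^ p)%:E < +oo)%E.
Proof.
move=> p1 Lpf mg gf; have p0 : 0 < p by apply: lt_le_trans p1.
apply: le_lt_trans (in_Lp_lty p1 Lpf); apply: ge0_le_integral => //.
- by apply/measurable_EFinP; apply: (measurableT_comp (measurable_powR _)); exact: measurableT_comp.
- apply/measurable_EFinP; apply: (measurableT_comp (measurable_powR _)); exact: (measurable_modulus Lpf).
- move=> x _; rewrite lee_fin ge0_ler_powR ?nnegrE ?(ltW p0)//.
  exact: le_trans (gf x).
Qed.

Lemma potentialE f x : potential alpha sigma f x =
  Complex (fine (PS (ext0 (fun x => complex.Re (f x))) x))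
          (fine (PS (ext0 (fun x => complex.Im (f x))) x)).
Proof. by rewrite /potential !integral_ext0. Qed.

Section bounded.
Variables (p q C : R).
Hypotheses (p1 : 1 <= p) (q1 : 1 <= q) (C0 : 0 <= C).
Hypothesis HC : forall h : T -> R, measurable_fun setT h -> (forall x, 0 <= h x) ->
  (\int[mu]_x (h x `^ p)%:E < +oo)%E ->
  ((\int[mu]_x (PS h x `^ q)) `^ q^-1 <= C%:E * (\int[mu]_x (h x `^ p)%:E) `^ p^-1)%E.
Let p0 : 0 < p. Proof. exact: lt_le_trans p1. Qed.
Let q0 : 0 < q. Proof. exact: lt_le_trans q1. Qed.

Let mPS g : measurable_fun setT g -> measurable_fun setT (PS g).
Proof. exact: measurable_potential_real. Qed.

Let PS_le (f : T -> R[i]) (g : T -> R) x : in_Lp alpha p f -> measurable_fun setT g ->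
  (forall x, `|g x| <= modulus f x) ->
  (\int[mu]_y `|K x y * (g y)%:E| <= PS (modulus f) x)%E.
Proof.
move=> Lpf mg gf; apply: ge0_le_integral => //.
- by apply: measurableT_comp => //; exact: measurable_kernel_section.
- by apply: measurable_kernel_section => //; exact: (measurable_modulus Lpf).
- move=> y _; rewrite abseM gee0_abs ?potential_kernel_ge0//.
  by rewrite lee_wpmul2l ?potential_kernel_ge0// lee_fin.
Qed.

Let fine_le (f : T -> R[i]) (g : T -> R) x : in_Lp alpha p f -> measurable_fun setT g ->
  (forall x, `|g x| <= modulus f x) -> (`|fine (PS g x)|%:E <= PS (modulus f) x)%E.
Proof.
move=> Lpf mg gf; apply: le_trans (PS_le x Lpf mg gf).
apply: le_trans (le_abse_integral _ measurableT _); last exact: measurable_kernel_section.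
by rewrite -/(PS g x); case: (PS g x) => [r||] //=; rewrite normr0 leey.
Qed.

Lemma potential_domain_in_Lp f : in_Lp alpha p f -> potential_domain alpha sigma f.
Proof.
move=> Lpf.
have [_ Pae] := potential_real_lty alpha_ge sigma0 q1 HC (measurable_modulus Lpf) (modulus_ge0 f) (in_Lp_lty p1 Lpf).
apply: filterS Pae => x hx _.
have iK g : measurable_fun setT (ext0 g) -> (forall x, `|ext0 g x| <= modulus f x) ->
    mu.-integrable orthant (fun y => K x y * (g y)%:E)%E.
  move=> mg gf; apply: (@integrable_orthant _ (fun y => K x y * (ext0 g y)%:E)%E).
    by move=> y yO; rewrite /ext0 mem_set.
  apply/integrableP; split; first exact: measurable_kernel_section.
  by apply: le_lt_trans hx; exact: PS_le.
split; apply: iK.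
- exact: (measurable_ext0_Re Lpf).
- exact: ext0_Re_le.
- exact: (measurable_ext0_Im Lpf).
- exact: ext0_Im_le.
Qed.

Let mfine g : measurable_fun setT g -> measurable_fun setT (fun x => fine (PS g x)).
Proof. by move=> mg; apply: (measurableT_comp (f := fine)) => //; exact: mPS. Qed.

(** The real and imaginary parts are each dominated by the potential of the modulus, and |z| <= |Re
    z| + |Im z| costs the factor 2. *)
Let modulus_potential_le f x : in_Lp alpha p f ->
  ((modulus (potential alpha sigma f) x)%:E <= 2%:E * PS (modulus f) x)%E.
Proof.
move=> Lpf.
have P0 : (0 <= PS (modulus f) x)%E by apply: potential_real_ge0 => // y; exact: modulus_ge0.
rewrite /modulus {1}/ext0; case: ifP => _; last by rewrite mule_ge0.
rewrite potentialE; apply: (@le_trans _ _ (`|fine (PS (ext0 (fun x => complex.Re (f x))) x)|%:E +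
   `|fine (PS (ext0 (fun x => complex.Im (f x))) x)|%:E)%E).
  by rewrite -EFinD lee_fin; exact: normc_le_abs.
rewrite (_ : 2%:E = 1 + 1)%E// ge0_muleDl// mul1e leeD//; apply: fine_le => //.
- exact: (measurable_ext0_Re Lpf).
- exact: ext0_Re_le.
- exact: (measurable_ext0_Im Lpf).
- exact: ext0_Im_le.
Qed.

Let measurable_potential f : in_Lp alpha p f ->
  measurable_fun setT (fun x => complex.Re (potential alpha sigma f x)) /\
  measurable_fun setT (fun x => complex.Im (potential alpha sigma f x)).
Proof.
move=> Lpf; split; under eq_fun do rewrite potentialE/=; apply: mfine.
- exact: (measurable_ext0_Re Lpf).
- exact: (measurable_ext0_Im Lpf).
Qed.

Lemma Lp_norm_potential_le f : in_Lp alpha p f ->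
  (Lp_norm alpha q (potential alpha sigma f) <= (2 * C)%:E * Lp_norm alpha p f)%E.
Proof.
move=> Lpf; rewrite !Lp_normE//.
have mm := measurable_modulus Lpf.
have P0 x : (0 <= PS (modulus f) x)%E by apply: potential_real_ge0 => // y; exact: modulus_ge0.
have [mre mim] := measurable_potential Lpf.
have mh : measurable_fun setT (modulus (potential alpha sigma f)).
  rewrite (_ : modulus _ = (fun x => (ext0 (fun x => complex.Re (potential alpha sigma f x)) x ^+ 2 +
     ext0 (fun x => complex.Im (potential alpha sigma f x)) x ^+ 2) `^ 2^-1)).
    apply: (measurableT_comp (measurable_powR _)); apply: measurable_funD;
      by apply: measurable_funX; apply: measurable_ext0; exact: measurable_funTS.
  apply/funext => x; rewrite powR12_sqrt ?addr_ge0 ?sqr_ge0// /modulus /ext0.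
  by case: ifP => _; [case: (potential _ _ _ x)|rewrite expr0n addr0 sqrtr0].
apply: (@le_trans _ _ ((\int[mu]_x ((2%:E * PS (modulus f) x) `^ q)) `^ q^-1)%E).
  apply: gt0_ler_poweR; first by rewrite invr_ge0 ltW.
  - by rewrite in_itv/= leey andbT integral_ge0// => x _; rewrite lee_fin powR_ge0.
  - by rewrite in_itv/= leey andbT integral_ge0// => x _; exact: poweR_ge0.
  apply: ge0_le_integral => //.
  - by move=> x _; rewrite lee_fin powR_ge0.
  - by apply/measurable_EFinP; apply: (measurableT_comp (measurable_powR _)).
  - by apply: (measurableT_comp (measurable_poweR _)); apply: emeasurable_funM => //; exact: mPS.
  - move=> x _; rewrite -poweR_EFin; apply: gt0_ler_poweR; first exact: ltW.
    + by rewrite in_itv/= leey andbT lee_fin modulus_ge0.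
    + by rewrite in_itv/= leey andbT mule_ge0.
    exact: modulus_potential_le.
rewrite ge0_integral_poweRZl//; last exact: mPS.
rewrite EFinM -muleA lee_wpmul2l//; apply: HC => //; first exact: modulus_ge0.
exact: in_Lp_lty.
Qed.

Lemma in_Lp_potential f : in_Lp alpha p f -> in_Lp alpha q (potential alpha sigma f).
Proof.
move=> Lpf; have [mre mim] := measurable_potential Lpf.
split; [exact: measurable_funTS|exact: measurable_funTS|].
apply: le_lt_trans (Lp_norm_potential_le Lpf) _.
have [_ _ h] := Lpf; apply: lte_mul_pinfty => //.
by rewrite lee_fin mulr_ge0.
Qed.

Lemma potential_bounded : Lp_Lq_bounded alpha sigma p q.
Proof.
exists (2 * C) => f Lpf; split; first exact: potential_domain_in_Lp.
  exact: in_Lp_potential.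
exact: Lp_norm_potential_le.
Qed.

(** As [ell] is real-valued, the pairing splits into the real pairings of the real and imaginary
    parts, and [potential_real_pairing] applies to each. *)
Lemma potential_pairing (f : T -> R[i]) n : in_Lp alpha p f ->
  let ell := fun x => real_complex R (lag n x) in
  [/\ pairing_defined alpha f ell,
      pairing_defined alpha (potential alpha sigma f) ell &
      pairing alpha (potential alpha sigma f) ell =
        real_complex R (laguerre_eigenvalue alpha n `^ (- sigma)) * pairing alpha f ell].
Proof.
move=> Lpf ell.
have mre := measurable_ext0_Re Lpf; have mim := measurable_ext0_Im Lpf.
have [ir1 ir2 irE] := potential_real_pairing alpha_ge d_gt0 sigma0 n p1 q1 HC mre
  (modulus_lty p1 Lpf mre (ext0_Re_le f)).
have [ii1 ii2 iiE] := potential_real_pairing alpha_ge d_gt0 sigma0 n p1 q1 HC mim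
  (modulus_lty p1 Lpf mim (ext0_Im_le f)).
have Re_ell (z : R[i]) x : complex.Re (z * conjc (ell x)) = complex.Re z * lag n x.
  by case: z => a b; rewrite /= !(oppr0, mulr0, subr0).
have Im_ell (z : R[i]) x : complex.Im (z * conjc (ell x)) = complex.Im z * lag n x.
  by case: z => a b; rewrite /= !(oppr0, mulr0, add0r).
have l0 : (laguerre_eigenvalue alpha n `^ (- sigma))%:E \is a fin_num by [].
split.
- split.
    apply: integrable_orthant ir1 => x xO; rewrite Re_ell /ext0 mem_set//.
  by apply: integrable_orthant ii1 => x xO; rewrite Im_ell /ext0 mem_set.
- split.
    by apply: integrable_orthant ir2 => x xO; rewrite Re_ell potentialE.
  by apply: integrable_orthant ii2 => x xO; rewrite Im_ell potentialE.
(* From the extended-valued identity over R^d to real-valued integrals over the orthant;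
   integrability lets [fine] commute with the product. *)
have rint (g : T -> R) F : mu.-integrable setT (fun x => (fine (PS (ext0 g) x) * lag n x)%:E) ->
    (forall x, F x = fine (PS (ext0 g) x) * lag n x) ->
    (\int[mu]_x (fine (PS (ext0 g) x) * lag n x)%:E = (laguerre_eigenvalue alpha n `^ (- sigma))%:E *
      \int[mu]_x (ext0 g x * lag n x)%:E)%E ->
    mu.-integrable setT (fun x => (ext0 g x * lag n x)%:E) ->
    \int[mu]_(x in orthant) F x =
     laguerre_eigenvalue alpha n `^ (- sigma) * \int[mu]_(x in orthant) (g x * lag n x).
  move=> ig FE gE ig'; rewrite /Rintegral.
  under eq_integral do rewrite FE.
  rewrite integral_orthantT; last by case/integrableP: ig.
  rewrite gE fineM//; last exact: integrable_fin_num.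
  congr (_ * fine _); apply/esym; apply: integral_orthant => x xO; rewrite /ext0.
    by rewrite mem_set.
  by rewrite memNset// mul0r.
rewrite /pairing.
have E1 := rint _ _ ir2 (fun x => etrans (Re_ell _ x) (congr1 (fun z => complex.Re z * _) (potentialE f x))) irE ir1.
have E2 := rint _ _ ii2 (fun x => etrans (Im_ell _ x) (congr1 (fun z => complex.Im z * _) (potentialE f x))) iiE ii1.
rewrite E1 E2.
have -> : \int[mu]_(x in orthant) complex.Re (f x * conjc (ell x)) = \int[mu]_(x in orthant) (complex.Re (f x) * lag n x).
  by apply: eq_Rintegral => x _; rewrite Re_ell.
have -> : \int[mu]_(x in orthant) complex.Im (f x * conjc (ell x)) = \int[mu]_(x in orthant) (complex.Im (f x) * lag n x).
  by apply: eq_Rintegral => x _; rewrite Im_ell.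
apply/eqP; rewrite eq_complex/=.
by rewrite !mul0r subr0 addr0 !eqxx.
Qed.

End bounded.
End potential_complex.

Theorem theorem4p1 (R : realType) (d : nat) (alpha : d.-tuple R)
    (sigma p q : R) (d_ge1 : (1 <= d)%N)
    (alpha_ge : forall i : 'I_d, - 2^-1 <= tnth alpha i)
    (sigma_gt0 : 0 < sigma) (p_ge1 : 1 <= p) (q_ge1 : 1 <= q) :
  let D : R := tsum alpha + d%:R in
  (D <= sigma -> Lp_Lq_bounded alpha sigma p q) /\
  (sigma < D -> admissible D sigma p q -> Lp_Lq_bounded alpha sigma p q) /\
  (D <= sigma \/ sigma < D /\ admissible D sigma p q ->
   forall (k : d.-tuple nat) (f : d.-tuple R -> complex R), in_Lp alpha p f ->
   let ell := fun x => real_complex R (laguerre_fun alpha k x) in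
   [/\ pairing_defined alpha f ell,
       pairing_defined alpha (potential alpha sigma f) ell &
       pairing alpha (potential alpha sigma f) ell =
         real_complex R (laguerre_eigenvalue alpha k `^ (- sigma))
         * pairing alpha f ell]).
Proof.
move=> D.
have alpha_ge' i : 2^-1 <= tnth alpha i + 1 by have := alpha_ge i; lra.
have D0 : 0 < D := homogeneous_dim_gt0 alpha_ge' d_ge1.
have p0 : 0 < p by apply: lt_le_trans p_ge1.
have q0 : 0 < q by apply: lt_le_trans q_ge1.
have pi0 : 0 < p^-1 by rewrite invr_gt0.
have qi0 : 0 < q^-1 by rewrite invr_gt0.
have pi1 : p^-1 <= 1 by rewrite invf_le1.
have qi1 : q^-1 <= 1 by rewrite invf_le1.
(* Reduction to the two cases of the bilinear estimate. If D <= sigma, then |1/p - 1/q| < 1 yields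
   the strict one. *)
have cond : D <= sigma \/ sigma < D /\ admissible D sigma p q ->
    D * `|p^-1 - q^-1| < sigma \/ [/\ sigma < D, 1 < p & q^-1 = p^-1 - sigma / D].
  case=> [Ds|[sD [/andP[]]]].
    left; apply: lt_le_trans Ds; rewrite -[ltRHS]mulr1 ltr_pM2l// ltr_norml.
    by apply/andP; split; lra.
  rewrite le_eqVlt => /predU1P[E _ pq|l1 l2 _].
    (* Equality in the lower bound is the endpoint; there p = 1 would give q = D/(D - sigma), the
       excluded pair. *)
    right; split => //; rewrite lt_neqAle p_ge1 andbT eq_sym; apply/eqP => p_eq1.
    apply: pq; split => //; rewrite -[q]invrK -E p_eq1 invr1.
    have Ds : D - sigma != 0 by rewrite subr_eq0 gt_eqF.
    by field; rewrite Ds gt_eqF.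
  (* The upper bound is strict by hypothesis, so at this point both bounds are strict. *)
  left; rewrite mulrC -ltr_pdivlMr// ltr_norml; apply/andP; split; lra.
have bounded H : exists2 C : R, 0 <= C & forall h : d.-tuple R -> R, measurable_fun setT h ->
    (forall x, 0 <= h x) -> (\int[laguerre_measure alpha]_x (h x `^ p)%:E < +oo)%E ->
    ((\int[laguerre_measure alpha]_x (potential_real alpha sigma h x `^ q)) `^ q^-1 <=
     C%:E * (\int[laguerre_measure alpha]_x (h x `^ p)%:E) `^ p^-1)%E :=
  potential_real_bound alpha_ge' d_ge1 sigma_gt0 p_ge1 q_ge1 (cond H).
split=> [Ds|].
  by have [C C0 HC] := bounded (or_introl Ds); apply: (potential_bounded _ _ _ _ C0 HC).
split=> [sD adm|H k f Lpf].
  by have [C C0 HC] := bounded (or_intror (conj sD adm)); apply: (potential_bounded _ _ _ _ C0 HC).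
by have [C C0 HC] := bounded H; exact: (potential_pairing _ _ _ _ _ HC).
Qed.
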